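(* For every fixed $N\in\mathbb{N}$ (separately), the following two assertions are equivalent. (i) For all $x,y,z,n\in\mathbb{N}$ with $n\geq 3$, $$\lim_{\tau\to\infty}\frac{1}{\tau}\int_{\frac{x^n+y^n}{z^n}\cdot\frac{\tau}{\ln 2\pi-2c}}^{(N+1)\frac{x^n+y^n}{z^n}\cdot\frac{\tau}{\ln 2\pi-2c}}\left\{\ln t-\left|\zeta\left(\tfrac12+it\right)\right|^2\right\}\,dt\neq N .$$ (ii) (Fermat-Wiles theorem) For all $x,y,z,n\in\mathbb{N}$ with $n\geq 3$, one has $x^n+y^n\neq z^n$.
   Context: $\zeta$ is the Riemann zeta-function, $c$ is Euler's constant ($c\approx 0.577$), $\ln$ is the natural logarithm, and $\mathbb{N}$ is the set of positive integers. Note $\ln 2\pi-2c\approx 0.68>0$. The numbers $\frac{x^n+y^n}{z^n}$ with $x,y,z,n\in\mathbb{N}$, $n\ge 3$, are called Fermat's rationals; the limit is taken with $x,y,z,n,N$ fixed. *)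

(* Defs.v *)
From Stdlib Require Import Reals Lra Lia.
From Coquelicot Require Import Coquelicot.

Local Open Scope R_scope.

Definition Cexp (z : C) : C :=
  (exp (Re z) * cos (Im z), exp (Re z) * sin (Im z)).

(* [Rcpow x s] is [x ^ s] for real [x > 0], with the real logarithm. *)
Definition Rcpow (x : R) (s : C) : C := Cexp (s * RtoC (ln x))%C.

Definition zeta_approx (s : C) (N : nat) : C :=
  (sum_n_m (G := C_AbelianMonoid) (fun n => Rcpow (INR n) (- s)) 1 N
   - Rcpow (INR N) (1 - s) / (1 - s))%C.

(* The limit of [zeta_approx s] exists for [Re s > 0], [s <> 1], and is the
   analytic continuation of the Dirichlet series of zeta to that region; the
   values for [Re s <= 0] and at [s = 1] are meaningless.  The lemmas
   [zeta_approx_lim], [zeta_dirichlet] and [zeta_holomorphic] below establish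
   this, and the last two determine [zeta] there by the identity theorem. *)
Definition zeta (s : C) : C :=
  (real (Lim_seq (fun N => Re (zeta_approx s N))),
   real (Lim_seq (fun N => Im (zeta_approx s N)))).

Definition euler_gamma : R :=
  real (Lim_seq (fun n => sum_n_m (fun k => / INR k) 1 n - ln (INR n))).

Lemma C_eq (a b : C) : Re a = Re b -> Im a = Im b -> a = b.
Proof. destruct a, b; simpl; congruence. Qed.

Lemma Cexp_plus (a b : C) : Cexp (a + b) = (Cexp a * Cexp b)%C.
Proof.
unfold Cexp; apply C_eq; unfold Re, Im; simpl;
  rewrite exp_plus, ?cos_plus, ?sin_plus; ring.
Qed.

Lemma Cmod_Cexp (z : C) : Cmod (Cexp z) = exp (Re z).
Proof.
unfold Cmod, Cexp; simpl.
replace (_ + _) with ((exp (Re z)) ^ 2 * (Rsqr (sin (Im z)) + Rsqr (cos (Im z))))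
  by (unfold Rsqr; ring).
rewrite sin2_cos2, Rmult_1_r, sqrt_pow2; [easy | left; apply exp_pos].
Qed.

Definition cder (f : R -> C) (x : R) (l : C) : Prop :=
  is_derive (fun u => Re (f u)) x (Re l) /\
  is_derive (fun u => Im (f u)) x (Im l).

Lemma cder_eq f x l l' : cder f x l -> l = l' -> cder f x l'.
Proof. now intros H <-. Qed.

Lemma cder_const (c : C) x : cder (fun _ => c) x 0.
Proof. split; exact (is_derive_const (V := R_NormedModule) _ x). Qed.

Lemma cder_real (f : R -> R) (x l : R) :
  is_derive f x l -> cder (fun u => RtoC (f u)) x (RtoC l).
Proof.
intros H; split; [exact H | exact (is_derive_const (V := R_NormedModule) 0 x)].
Qed.

Lemma cder_plus f g x a b :
  cder f x a -> cder g x b -> cder (fun u => f u + g u)%C x (a + b)%C.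
Proof. intros [? ?] [? ?]; split; now apply @is_derive_plus. Qed.

Lemma cder_minus f g x a b :
  cder f x a -> cder g x b -> cder (fun u => f u - g u)%C x (a - b)%C.
Proof. intros [? ?] [? ?]; split; now apply @is_derive_minus. Qed.

Lemma is_derive_Rmult f g (x a b : R) :
  is_derive f x a -> is_derive g x b ->
  is_derive (fun u : R => f u * g u) x (a * g x + f x * b).
Proof. intros; apply (is_derive_mult f g); auto; intros; apply Rmult_comm. Qed.

Lemma cder_mult f g x a b :
  cder f x a -> cder g x b ->
  cder (fun u => f u * g u)%C x (a * g x + f x * b)%C.
Proof.
intros [Ha1 Ha2] [Hb1 Hb2]; split; simpl.
- eapply is_derive_ext_loc; [apply filter_forall; intros; reflexivity |].
  replace (_ + _) with
    ((Re a * Re (g x) + Re (f x) * Re b) - (Im a * Im (g x) + Im (f x) * Im b))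
    by (unfold Re, Im; ring).
  apply @is_derive_minus; now apply is_derive_Rmult.
- replace (_ + _) with
    ((Re a * Im (g x) + Re (f x) * Im b) + (Im a * Re (g x) + Im (f x) * Re b))
    by (unfold Re, Im; ring).
  apply @is_derive_plus; now apply is_derive_Rmult.
Qed.

Lemma cder_Cexp f x l :
  cder f x l -> cder (fun u => Cexp (f u)) x (l * Cexp (f x))%C.
Proof.
intros [H1 H2].
pose proof (is_derive_comp exp (fun u => Re (f u)) x _ _
  (is_derive_exp (Re (f x))) H1) as He.
pose proof (is_derive_comp cos (fun u => Im (f u)) x _ _
  (is_derive_cos (Im (f x))) H2) as Hc.
pose proof (is_derive_comp sin (fun u => Im (f u)) x _ _
  (is_derive_sin (Im (f x))) H2) as Hs.
unfold Cexp; split.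
- pose proof (is_derive_Rmult _ _ x _ _ He Hc) as H.
  eapply is_derive_ext; [| replace (Re (l * _)) with
    (scal (Re l) (exp (Re (f x))) * cos (Im (f x)) +
     exp (Re (f x)) * scal (Im l) (- sin (Im (f x)))); [exact H |]].
  + reflexivity.
  + unfold Re, Im, scal; simpl; unfold mult; simpl; ring.
- pose proof (is_derive_Rmult _ _ x _ _ He Hs) as H.
  eapply is_derive_ext; [| replace (Im (l * _)) with
    (scal (Re l) (exp (Re (f x))) * sin (Im (f x)) +
     exp (Re (f x)) * scal (Im l) (cos (Im (f x)))); [exact H |]].
  + reflexivity.
  + unfold Re, Im, scal; simpl; unfold mult; simpl; ring.
Qed.

Lemma dot_le_Cmod (a b : C) : Re a * Re b + Im a * Im b <= Cmod a * Cmod b.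
Proof.
rewrite <- (Cmod_conj b), <- Cmod_mult.
replace (Re a * Re b + Im a * Im b) with (Re (a * Cconj b)%C)
  by (unfold Re, Im; simpl; ring).
eapply Rle_trans; [apply Rle_abs |].
eapply Rle_trans; [apply Rmax_l | apply Rmax_Cmod].
Qed.

Lemma mvt_nonneg (q q' : R -> R) a b :
  a <= b -> (forall x, a <= x <= b -> is_derive q x (q' x) /\ 0 <= q' x) ->
  q a <= q b.
Proof.
intros Hab H.
destruct (MVT_gen q a b q') as [c [Hc E]].
- intros x; rewrite Rmin_left, Rmax_right by easy; intros; apply H; lra.
- intros x; rewrite Rmin_left, Rmax_right by easy; intros Hx.
  apply continuity_pt_filterlim, (@ex_derive_continuous R_AbsRing R_NormedModule).
  exists (q' x); now apply H.
- rewrite Rmin_left, Rmax_right in Hc by easy.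
  destruct (H c Hc); nra.
Qed.

Lemma cder_incr (f f' : R -> C) (G G' : R -> R) a b :
  a <= b ->
  (forall x, a <= x <= b -> cder f x (f' x)) ->
  (forall x, a <= x <= b -> is_derive G x (G' x)) ->
  (forall x, a <= x <= b -> Cmod (f' x) <= G' x) ->
  Cmod (f b - f a) <= G b - G a.
Proof.
intros Hab Hf HG Hle.
set (D := (f b - f a)%C).
assert (H0 : G a <= G b).
{ apply mvt_nonneg with G'; auto; intros x Hx; split; auto.
  eapply Rle_trans; [apply Cmod_ge_0 | now apply Hle]. }
assert (H1 : Cmod D * G a - (Re D * Re (f a) + Im D * Im (f a)) <=
             Cmod D * G b - (Re D * Re (f b) + Im D * Im (f b))).
{ apply (mvt_nonneg (fun x => Cmod D * G x - (Re D * Re (f x) + Im D * Im (f x)))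
    (fun x => Cmod D * G' x - (Re D * Re (f' x) + Im D * Im (f' x)))); auto.
  intros x Hx; split.
  - destruct (Hf x Hx).
    apply @is_derive_minus; [now apply is_derive_scal; auto |].
    apply @is_derive_plus; now apply is_derive_scal.
  - pose proof (dot_le_Cmod D (f' x)); pose proof (Cmod_ge_0 D).
    pose proof (Hle x Hx); nra. }
assert (H2 : Cmod D * Cmod D =
  Re D * (Re (f b) - Re (f a)) + Im D * (Im (f b) - Im (f a))).
{ unfold Cmod; rewrite sqrt_sqrt; [| nra].
  unfold D, Re, Im; simpl; ring. }
destruct (Cmod_ge_0 D) as [HD | HD]; [| lra].
apply Rmult_le_reg_l with (Cmod D); auto; lra.
Qed.

Lemma exp_le x y : x <= y -> exp x <= exp y.
Proof. intros [H | ->]; [left; now apply exp_increasing | lra]. Qed.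

Lemma Re_le_Cmod z : Re z <= Cmod z.
Proof.
eapply Rle_trans; [apply Rle_abs |].
eapply Rle_trans; [apply Rmax_l | apply Rmax_Cmod].
Qed.

Lemma cder_line (w : C) u : cder (fun u => RtoC u * w)%C u w.
Proof.
eapply cder_eq.
- apply cder_mult; [apply cder_real, @is_derive_id | apply cder_const].
- simpl; apply C_eq; unfold Re, Im; simpl; change one with 1; ring.
Qed.

Lemma Cexp_bound1 w u : 0 <= u <= 1 ->
  Cmod (Cexp (RtoC u * w) - 1) <= Cmod w * exp (Cmod w).
Proof.
intros Hu.
replace (RtoC 1) with (Cexp (RtoC 0 * w)).
2: { unfold Cexp; apply C_eq; simpl.
     - replace (_ - _) with 0 by ring; rewrite exp_0.
       replace (_ + _) with 0 by ring; rewrite cos_0; ring.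
     - replace (_ + _) with 0 by ring; rewrite sin_0; ring. }
apply Rle_trans with (Cmod w * exp (Cmod w) * u - Cmod w * exp (Cmod w) * 0).
- apply (cder_incr (fun u => Cexp (RtoC u * w)) (fun u => w * Cexp (RtoC u * w))%C
    (fun u => Cmod w * exp (Cmod w) * u) (fun _ => Cmod w * exp (Cmod w)));
    try easy.
  + intros x _; apply cder_Cexp, cder_line.
  + intros x _; auto_derive; auto; ring.
  + intros x Hx; rewrite Cmod_mult, Cmod_Cexp.
    apply Rmult_le_compat_l; [apply Cmod_ge_0 |].
    apply exp_le; simpl.
    pose proof (Re_le_Cmod w); pose proof (Cmod_ge_0 w); unfold Re in *; nra.
- pose proof (Rmult_le_pos _ _ (Cmod_ge_0 w) (Rlt_le _ _ (exp_pos (Cmod w)))); nra.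
Qed.

Lemma Cexp_bound2 w :
  Cmod (Cexp w - 1 - w) <= Cmod w * Cmod w * exp (Cmod w).
Proof.
set (M := Cmod w * Cmod w * exp (Cmod w)).
replace (Cexp w - 1 - w)%C with
  ((Cexp (RtoC 1 * w) - RtoC 1 * w) - (Cexp (RtoC 0 * w) - RtoC 0 * w))%C.
2: { replace (RtoC 1 * w)%C with w by ring.
     replace (RtoC 0 * w)%C with (RtoC 0) by ring.
     replace (Cexp 0) with (RtoC 1); [ring |].
     unfold Cexp; apply C_eq; simpl; rewrite exp_0, ?cos_0, ?sin_0; ring. }
replace M with (M * 1 - M * 0) by ring.
apply (cder_incr (fun u => Cexp (RtoC u * w) - RtoC u * w)%C
  (fun u => w * Cexp (RtoC u * w) - w)%C (fun u => M * u) (fun _ => M)).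
- lra.
- intros x _; apply cder_minus; [apply cder_Cexp |]; apply cder_line.
- intros x _; auto_derive; auto; ring.
- intros x Hx.
  replace (w * Cexp (RtoC x * w) - w)%C with (w * (Cexp (RtoC x * w) - 1))%C by ring.
  rewrite Cmod_mult; unfold M; rewrite Rmult_assoc.
  apply Rmult_le_compat_l; [apply Cmod_ge_0 | now apply Cexp_bound1].
Qed.

Lemma cder_id x : cder (fun u => RtoC u) x 1.
Proof. apply (cder_real (fun u => u)), (is_derive_id (K := R_AbsRing)). Qed.

Lemma cder_ln x : 0 < x -> cder (fun u => RtoC (ln u)) x (/ RtoC x)%C.
Proof.
intros Hx; rewrite <- RtoC_inv by lra.
now apply cder_real, is_derive_ln.
Qed.

Lemma cder_Rcpow x (a : C) : 0 < x ->
  cder (fun u => Rcpow u a) x (a / RtoC x * Rcpow x a)%C.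
Proof.
intros Hx; unfold Rcpow; apply cder_Cexp.
eapply cder_eq; [apply cder_mult; [apply cder_const | now apply cder_ln] |].
unfold Cdiv; ring.
Qed.

Lemma RtoC_neq0 x : 0 < x -> RtoC x <> 0.
Proof. intros Hx H; apply RtoC_inj in H; lra. Qed.

Lemma Rcpow_plus x (a b : C) : Rcpow x (a + b) = (Rcpow x a * Rcpow x b)%C.
Proof. unfold Rcpow; rewrite <- Cexp_plus; f_equal; ring. Qed.

Lemma Rcpow_1 x : 0 < x -> Rcpow x 1 = RtoC x.
Proof.
intros Hx; unfold Rcpow, Cexp; apply C_eq; unfold Re, Im; simpl.
- replace (1 * ln x - 0 * 0) with (ln x) by ring.
  replace (1 * 0 + 0 * ln x) with 0 by ring.
  rewrite cos_0, exp_ln by easy; ring.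
- replace (1 * 0 + 0 * ln x) with 0 by ring; rewrite sin_0; ring.
Qed.

Lemma Cmod_Rcpow x (a : C) : Cmod (Rcpow x a) = exp (Re a * ln x).
Proof.
unfold Rcpow; rewrite Cmod_Cexp; f_equal; unfold Re; simpl; ring.
Qed.

(* On [[n, n + 1]] the increment of [phi s n] is that of [zeta_approx s]
   between [n] and [n + 1]; [theta] is the [s]-derivative of [phi]. *)
Definition phi (s : C) (n x : R) : C :=
  ((RtoC x - RtoC n) * Rcpow x (- s) - RtoC x * Rcpow x (- s) / (1 - s))%C.

Definition theta (s : C) (n x : R) : C :=
  (RtoC x * RtoC (ln x) * Rcpow x (- s) / (1 - s)
   - RtoC x * Rcpow x (- s) / ((1 - s) * (1 - s))
   - (RtoC x - RtoC n) * RtoC (ln x) * Rcpow x (- s))%C.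

Lemma one_minus_neq0 (s : C) : s <> 1 -> (1 - s)%C <> 0.
Proof.
intros Hs H; apply Hs.
replace s with (1 - (1 - s))%C by ring; rewrite H; ring.
Qed.

Lemma cder_phi (s : C) n x : s <> 1 -> 0 < x ->
  cder (phi s n) x (- (s * (RtoC x - RtoC n) * Rcpow x (- s) / RtoC x))%C.
Proof.
intros Hs Hx; pose proof (one_minus_neq0 s Hs); pose proof (RtoC_neq0 x Hx).
eapply cder_eq.
- unfold phi; apply cder_minus.
  + apply cder_mult; [apply cder_minus; [apply cder_id | apply cder_const] |].
    now apply cder_Rcpow.
  + unfold Cdiv; apply cder_mult; [| apply cder_const].
    apply cder_mult; [apply cder_id | now apply cder_Rcpow].
- simpl; field; auto.
Qed.

Lemma cder_theta (s : C) n x : s <> 1 -> 0 < x ->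
  cder (theta s n) x
    (- ((RtoC x - RtoC n) * Rcpow x (- s) / RtoC x * (1 - s * RtoC (ln x))))%C.
Proof.
intros Hs Hx; pose proof (one_minus_neq0 s Hs); pose proof (RtoC_neq0 x Hx).
eapply cder_eq.
- unfold theta; apply cder_minus; [apply cder_minus |].
  + unfold Cdiv; apply cder_mult; [| apply cder_const].
    apply cder_mult; [| now apply cder_Rcpow].
    apply cder_mult; [apply cder_id | now apply cder_ln].
  + unfold Cdiv; apply cder_mult; [| apply cder_const].
    apply cder_mult; [apply cder_id | now apply cder_Rcpow].
  + apply cder_mult; [| now apply cder_Rcpow].
    apply cder_mult; [apply cder_minus; [apply cder_id | apply cder_const] |].
    now apply cder_ln.
- simpl; field; auto.
Qed.

Definition zeta_approx' (s : C) (N : nat) : C :=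
  (RtoC (INR N) * RtoC (ln (INR N)) * Rcpow (INR N) (- s) / (1 - s)
   - RtoC (INR N) * Rcpow (INR N) (- s) / ((1 - s) * (1 - s))
   - sum_n_m (G := C_AbelianMonoid)
       (fun n => RtoC (ln (INR n)) * Rcpow (INR n) (- s))%C 1 N)%C.

Lemma Rcpow_1m x (s : C) : 0 < x -> Rcpow x (1 - s) = (RtoC x * Rcpow x (- s))%C.
Proof. intros Hx; unfold Cminus; now rewrite Rcpow_plus, Rcpow_1. Qed.

Lemma INR_pos N : (1 <= N)%nat -> 1 <= INR N.
Proof. intros H; apply le_INR in H; easy. Qed.

Lemma zeta_approx_step (s : C) N : s <> 1 -> (1 <= N)%nat ->
  (zeta_approx s (S N) - zeta_approx s N)%C =
  (phi s (INR N) (INR (S N)) - phi s (INR N) (INR N))%C.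
Proof.
intros Hs HN; unfold zeta_approx, phi; pose proof (INR_pos N HN).
rewrite sum_n_Sm, !Rcpow_1m by (rewrite ?S_INR; lra || lia).
replace (RtoC (INR (S N))) with (RtoC (INR N) + 1)%C
  by (now rewrite S_INR, RtoC_plus).
change (@plus C_AbelianMonoid) with Cplus.
set (u := sum_n_m _ _ _); change C in (type of u); clearbody u.
field; now apply one_minus_neq0.
Qed.

Lemma zeta_approx'_step (s : C) N : s <> 1 -> (1 <= N)%nat ->
  (zeta_approx' s (S N) - zeta_approx' s N)%C =
  (theta s (INR N) (INR (S N)) - theta s (INR N) (INR N))%C.
Proof.
intros Hs HN; unfold zeta_approx', theta; pose proof (INR_pos N HN).
rewrite sum_n_Sm by lia.
replace (RtoC (INR (S N))) with (RtoC (INR N) + 1)%C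
  by (now rewrite S_INR, RtoC_plus).
change (@plus C_AbelianMonoid) with Cplus.
set (u := sum_n_m _ _ _); change C in (type of u); clearbody u.
field; now apply one_minus_neq0.
Qed.

Lemma is_derive_tailG K r x : 0 < r -> 0 < x ->
  is_derive (fun u => - (K / r) * exp (- r * ln u)) x (K * (exp (- r * ln x) / x)).
Proof. intros Hr Hx; auto_derive; [easy | field; lra]. Qed.

Lemma telescope (U : nat -> C) (K r : R) : 0 < r -> 0 <= K ->
  (forall N, (1 <= N)%nat ->
    Cmod (U (S N) - U N) <=
    - (K / r) * exp (- r * ln (INR (S N))) + K / r * exp (- r * ln (INR N))) ->
  forall N M, (1 <= N)%nat -> (N <= M)%nat ->
    Cmod (U M - U N) <= K / r * exp (- r * ln (INR N)).
Proof.
intros Hr HK H N M HN HM.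
assert (0 <= K / r) by (apply Rdiv_le_0_compat; lra).
enough (Cmod (U M - U N) <=
  - (K / r) * exp (- r * ln (INR M)) + K / r * exp (- r * ln (INR N))).
{ pose proof (exp_pos (- r * ln (INR M))); nra. }
induction HM as [| M HM IH].
- replace (U N - U N)%C with (RtoC 0) by ring; rewrite Cmod_0; lra.
- replace (U (S M) - U N)%C with ((U (S M) - U M) + (U M - U N))%C by ring.
  eapply Rle_trans; [apply Cmod_triangle |].
  assert (HM1 : (1 <= M)%nat) by lia.
  specialize (H M HM1); lra.
Qed.

Definition clim (U : nat -> C) (l : C) : Prop :=
  is_lim_seq (fun N => Re (U N)) (Re l) /\ is_lim_seq (fun N => Im (U N)) (Im l).

Lemma exp_tail_lim r : 0 < r -> is_lim_seq (fun N => exp (- r * ln (INR N))) 0.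
Proof.
intros Hr.
assert (H : is_lim_seq (fun N => ln (INR N)) p_infty)
  by (apply (filterlim_comp _ _ _ INR ln _ _ _ is_lim_seq_INR is_lim_ln_p)).
assert (H1 : is_lim_seq (fun N => - r * ln (INR N)) m_infty).
{ apply (is_lim_seq_scal_l _ (- r)) in H.
  replace (Rbar_mult (- r) p_infty) with m_infty in H; auto.
  simpl; destruct (Rle_dec 0 (- r)); [exfalso; lra | reflexivity]. }
apply (filterlim_comp _ _ _ (fun N => - r * ln (INR N)) exp _ _ _ H1 is_lim_exp_m).
Qed.

Lemma cauchy_lim (u : nat -> R) (v : nat -> R) :
  is_lim_seq v 0 ->
  (forall N M, (1 <= N)%nat -> (N <= M)%nat -> Rabs (u M - u N) <= v N) ->
  is_lim_seq u (real (Lim_seq u)).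
Proof.
intros Hv H; apply Lim_seq_correct', ex_lim_seq_cauchy_corr; intros eps.
apply is_lim_seq_spec in Hv.
destruct (Hv (pos_div_2 eps)) as [N0 HN0].
set (N1 := S N0); exists N1; intros n m Hn Hm.
assert (Hv1 : v N1 < eps / 2).
{ specialize (HN0 N1 ltac:(unfold N1; lia)); simpl in HN0.
  rewrite Rminus_0_r in HN0; eapply Rle_lt_trans; [apply Rle_abs | easy]. }
replace (u n - u m) with ((u n - u N1) - (u m - u N1)) by ring.
eapply Rle_lt_trans; [apply Rabs_triang |]; rewrite Rabs_Ropp.
pose proof (H N1 n ltac:(unfold N1; lia) Hn).
pose proof (H N1 m ltac:(unfold N1; lia) Hm); lra.
Qed.

Lemma abs_Re_le z : Rabs (Re z) <= Cmod z.
Proof. eapply Rle_trans; [apply Rmax_l | apply Rmax_Cmod]. Qed.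

Lemma abs_Im_le z : Rabs (Im z) <= Cmod z.
Proof. eapply Rle_trans; [apply Rmax_r | apply Rmax_Cmod]. Qed.

Lemma clim_ex (U : nat -> C) (v : nat -> R) :
  is_lim_seq v 0 ->
  (forall N M, (1 <= N)%nat -> (N <= M)%nat -> Cmod (U M - U N) <= v N) ->
  clim U (real (Lim_seq (fun N => Re (U N))), real (Lim_seq (fun N => Im (U N)))).
Proof.
intros Hv H; split; apply cauchy_lim with v; auto; intros N M HN HM.
- exact (Rle_trans _ _ _ (abs_Re_le (U M - U N)) (H N M HN HM)).
- exact (Rle_trans _ _ _ (abs_Im_le (U M - U N)) (H N M HN HM)).
Qed.

Lemma clim_plus U V a b : clim U a -> clim V b ->
  clim (fun N => U N + V N)%C (a + b)%C.
Proof. intros [? ?] [? ?]; split; simpl; now apply is_lim_seq_plus'. Qed.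

Lemma clim_scal c U a : clim U a -> clim (fun N => c * U N)%C (c * a)%C.
Proof.
intros [H1 H2]; split; simpl.
- apply is_lim_seq_minus';
    [apply (is_lim_seq_scal_l _ _ _ H1) | apply (is_lim_seq_scal_l _ _ _ H2)].
- apply is_lim_seq_plus';
    [apply (is_lim_seq_scal_l _ _ _ H2) | apply (is_lim_seq_scal_l _ _ _ H1)].
Qed.

Lemma clim_minus U V a b : clim U a -> clim V b ->
  clim (fun N => U N - V N)%C (a - b)%C.
Proof. intros [? ?] [? ?]; split; simpl; now apply is_lim_seq_minus'. Qed.

Lemma clim_Cmod U a B : clim U a -> (forall N, (1 <= N)%nat -> Cmod (U N) <= B) ->
  Cmod a <= B.
Proof.
intros [H1 H2] HB.
destruct (Cmod_ge_0 a) as [Ha | Ha].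
2: { rewrite <- Ha; eapply Rle_trans; [apply Cmod_ge_0 | apply (HB 1%nat); lia]. }
assert (Haa : Cmod a * Cmod a = Re a * Re a + Im a * Im a).
{ unfold Cmod; rewrite sqrt_sqrt; [| nra]; unfold Re, Im; ring. }
assert (H : Rbar_le (Re a * Re a + Im a * Im a) (Cmod a * B)).
{ eapply is_lim_seq_le_loc.
  2: { apply is_lim_seq_plus';
       [apply (is_lim_seq_scal_l _ (Re a) _ H1)
       | apply (is_lim_seq_scal_l _ (Im a) _ H2)]. }
  2: apply is_lim_seq_const.
  exists 1%nat; intros N HN; simpl.
  eapply Rle_trans; [apply dot_le_Cmod |].
  apply Rmult_le_compat_l; [lra | now apply HB]. }
simpl in H; apply Rmult_le_reg_l with (Cmod a); lra.
Qed.

Lemma Cmod_frac n x : n <= x <= n + 1 -> Cmod (RtoC x - RtoC n) <= 1.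
Proof.
intros H; rewrite <- RtoC_minus, Cmod_R, Rabs_pos_eq; lra.
Qed.

Lemma incr_tail (f f' : R -> C) K r N : 0 < r -> 
  (forall x, 1 <= x -> INR N <= x <= INR N + 1 -> cder f x (f' x)) ->
  (forall x, 1 <= x -> INR N <= x <= INR N + 1 ->
     Cmod (f' x) <= K * (exp (- r * ln x) / x)) ->
  (1 <= N)%nat ->
  Cmod (f (INR (S N)) - f (INR N)) <=
    - (K / r) * exp (- r * ln (INR (S N))) + K / r * exp (- r * ln (INR N)).
Proof.
intros Hr Hd Hb HN; pose proof (INR_pos N HN).
replace (_ + _) with
  (- (K / r) * exp (- r * ln (INR (S N))) - - (K / r) * exp (- r * ln (INR N))) by ring.
rewrite S_INR.
apply (cder_incr f f' (fun u => - (K / r) * exp (- r * ln u))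
  (fun x => K * (exp (- r * ln x) / x))); [lra | | |]; intros x Hx.
- apply Hd; lra.
- apply is_derive_tailG; lra.
- apply Hb; lra.
Qed.

Lemma ln_nonneg x : 1 <= x -> 0 <= ln x.
Proof. intros Hx; rewrite <- ln_1; apply ln_le; lra. Qed.

Lemma Cmod_kernel (s : C) n x : 1 <= x -> n <= x <= n + 1 ->
  Cmod ((RtoC x - RtoC n) * Rcpow x (- s) / RtoC x) <= exp (- Re s * ln x) / x.
Proof.
intros Hx Hn.
assert (Hx0 : 0 < x) by lra.
rewrite Cmod_div by now apply RtoC_neq0.
rewrite Cmod_mult, Cmod_Rcpow, Cmod_R, (Rabs_pos_eq x) by lra.
apply Rmult_le_compat_r; [left; now apply Rinv_0_lt_compat |].
replace (Re (- s)%C) with (- Re s) by easy.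
pose proof (Cmod_frac n x Hn); pose proof (exp_pos (- Re s * ln x)); nra.
Qed.

Lemma zeta_approx_cauchy (s : C) : 0 < Re s -> s <> 1 ->
  forall N M, (1 <= N)%nat -> (N <= M)%nat ->
  Cmod (zeta_approx s M - zeta_approx s N) <=
  Cmod s / Re s * exp (- Re s * ln (INR N)).
Proof.
intros Hr Hs; apply telescope; [easy | apply Cmod_ge_0 |].
intros N HN; rewrite zeta_approx_step by easy.
eapply incr_tail; try easy.
- intros x Hx1 Hx; apply cder_phi; [easy | lra].
- intros x Hx1 Hx; simpl.
  replace (s * (RtoC x - RtoC (INR N)) * Rcpow x (- s) / RtoC x)%C with
    (s * ((RtoC x - RtoC (INR N)) * Rcpow x (- s) / RtoC x))%C
    by (unfold Cdiv; ring).
  rewrite Cmod_opp, Cmod_mult.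
  apply Rmult_le_compat_l; [apply Cmod_ge_0 | now apply Cmod_kernel].
Qed.

Lemma zeta_approx_lim (s : C) : 0 < Re s -> s <> 1 ->
  is_lim_seq (fun N => Re (zeta_approx s N)) (Re (zeta s)) /\
  is_lim_seq (fun N => Im (zeta_approx s N)) (Im (zeta s)).
Proof.
intros Hr Hs.
apply (clim_ex (zeta_approx s) (fun N => Cmod s / Re s * exp (- Re s * ln (INR N)))).
- replace (Finite 0) with (Rbar_mult (Cmod s / Re s) 0) by (simpl; f_equal; ring).
  now apply is_lim_seq_scal_l, exp_tail_lim.
- now apply zeta_approx_cauchy.
Qed.

Lemma zeta_dirichlet (s : C) : 1 < Re s ->
  is_lim_seq (fun N => Re (sum_n_m (G := C_AbelianMonoid)
    (fun n => Rcpow (INR n) (- s)) 1 N)) (Re (zeta s)) /\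
  is_lim_seq (fun N => Im (sum_n_m (G := C_AbelianMonoid)
    (fun n => Rcpow (INR n) (- s)) 1 N)) (Im (zeta s)).
Proof.
intros Hr.
assert (Hs : s <> 1) by (intros ->; simpl in Hr; lra).
assert (H0 : clim (fun N => Rcpow (INR N) (1 - s)) 0).
{ assert (H : is_lim_seq (fun N => Cmod (Rcpow (INR N) (1 - s))) 0).
  { eapply is_lim_seq_ext; [| apply (exp_tail_lim (Re s - 1)); lra].
    intros N; rewrite Cmod_Rcpow; f_equal; unfold Re; simpl; ring. }
  split; apply is_lim_seq_abs_0, (is_lim_seq_le_le (fun _ => 0)
    _ (fun N => Cmod (Rcpow (INR N) (1 - s)))); auto using is_lim_seq_const;
    intros N; (split; [apply Rabs_pos |]); [apply abs_Re_le | apply abs_Im_le]. }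
pose proof (zeta_approx_lim s ltac:(lra) Hs) as H1.
pose proof (clim_plus _ _ _ _ H1 (clim_scal (/ (1 - s)) _ _ H0)) as H.
replace (zeta s + / (1 - s) * 0)%C with (zeta s) in H by ring.
destruct H as [Ha Hb]; split.
- eapply is_lim_seq_ext; [| exact Ha].
  intros N; cbv beta; f_equal; unfold zeta_approx, Cdiv.
  set (u := sum_n_m _ _ _); change C in (type of u); clearbody u; ring.
- eapply is_lim_seq_ext; [| exact Hb].
  intros N; cbv beta; f_equal; unfold zeta_approx, Cdiv.
  set (u := sum_n_m _ _ _); change C in (type of u); clearbody u; ring.
Qed.

Lemma ln_le_exp r L : 0 < r -> 0 <= L -> L <= / r * exp (r * L).
Proof.
intros Hr HL; apply Rmult_le_reg_l with r; [easy |].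
rewrite <- Rmult_assoc, Rinv_r, Rmult_1_l by lra.
pose proof (exp_ineq1_le (r * L)); lra.
Qed.


Lemma kernel_remainder (s h : C) (n x r : R) :
  0 < r -> 4 * r <= Re s -> Cmod h <= r -> 1 <= x -> n <= x <= n + 1 ->
  let k s := ((RtoC x - RtoC n) * Rcpow x (- s) / RtoC x)%C in
  Cmod (- ((s + h) * k (s + h)%C) + s * k s
        + h * (k s * (1 - s * RtoC (ln x)))) <=
  (Cmod s * / r * / r + / r) * (Cmod h * Cmod h) * (exp (- r * ln x) / x).
Proof.
intros Hr Hs Hh Hx Hn k; set (L := ln x).
assert (HL : 0 <= L) by now apply ln_nonneg.
set (w := (- (h * RtoC L))%C).
assert (Hk : k (s + h)%C = (k s * Cexp w)%C).
{ unfold k; replace (- (s + h))%C with (- s + - h)%C by ring.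
  rewrite Rcpow_plus; unfold Rcpow at 2; fold L.
  replace (- h * RtoC L)%C with w by (unfold w; ring); unfold Cdiv; ring. }
rewrite Hk.
replace (_ + _ + _)%C with
  (- (k s * (s * (Cexp w - 1 - w) + h * (Cexp w - 1))))%C by (unfold w; ring).
rewrite Cmod_opp, Cmod_mult.
assert (Hw : Cmod w = Cmod h * L).
{ unfold w; rewrite Cmod_opp, Cmod_mult, Cmod_R, Rabs_pos_eq; easy. }
assert (Hew : exp (Cmod w) <= exp (r * L)) by (rewrite Hw; apply exp_le; nra).
set (E := exp (r * L)) in *.
assert (HE : 1 <= E).
{ rewrite <- exp_0; apply exp_le; nra. }
pose proof (ln_le_exp r L Hr HL) as HLE; fold E in HLE.
pose proof (Cmod_ge_0 h); pose proof (Cmod_ge_0 s).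
assert (Hir : 0 < / r) by now apply Rinv_0_lt_compat.
set (hh := Cmod h * Cmod h).
assert (Hhh : 0 <= hh) by (unfold hh; nra).
assert (Hb : Cmod (s * (Cexp w - 1 - w) + h * (Cexp w - 1)) <=
   (Cmod s * / r * / r + / r) * hh * (E * E * E)).
{ eapply Rle_trans; [apply Cmod_triangle |]; rewrite !Cmod_mult.
  assert (B2 : Cmod (Cexp w - 1 - w) <= hh * (/ r * / r) * (E * E * E)).
  { eapply Rle_trans; [apply Cexp_bound2 |]; rewrite Hw at 1 2.
    apply Rle_trans with (hh * (L * L) * E).
    - replace (Cmod h * L * (Cmod h * L)) with (hh * (L * L)) by (unfold hh; ring).
      apply Rmult_le_compat_l; [apply Rmult_le_pos; nra | easy].
    - replace (hh * (/ r * / r) * (E * E * E)) with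
        (hh * ((/ r * E) * (/ r * E)) * E) by ring.
      apply Rmult_le_compat_r; [lra |]; apply Rmult_le_compat_l; [easy |].
      apply Rmult_le_compat; lra. }
  assert (B1 : Cmod h * Cmod (Cexp w - 1) <= hh * / r * (E * E * E)).
  { pose proof (Cexp_bound1 w 1 ltac:(lra)) as B.
    replace (RtoC 1 * w)%C with w in B by ring.
    apply Rle_trans with (Cmod h * (Cmod h * L * E)).
    - apply Rmult_le_compat_l; [easy |].
      eapply Rle_trans; [exact B |]; rewrite Hw at 1.
      apply Rmult_le_compat_l; [nra | easy].
    - replace (Cmod h * (Cmod h * L * E)) with (hh * (L * E)) by (unfold hh; ring).
      rewrite Rmult_assoc; apply Rmult_le_compat_l; [easy |].
      apply Rle_trans with (/ r * E * E);
        [apply Rmult_le_compat_r; lra |].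
      rewrite (Rmult_assoc (/ r)); apply Rmult_le_compat_l; [lra | nra]. }
  apply (Rmult_le_compat_l _ _ _ (Cmod_ge_0 s)) in B2; nra. }
pose proof (Cmod_kernel s n x Hx Hn) as Hks; fold (k s) in Hks; fold L in Hks.
eapply Rle_trans; [apply Rmult_le_compat; [apply Cmod_ge_0.. | exact Hks | exact Hb] |].
set (K := _ * hh).
assert (HK : 0 <= K) by (unfold K; apply Rmult_le_pos; [nra | easy]).
replace (exp (- Re s * L) / x * (K * (E * E * E))) with
  (K * ((exp (- Re s * L) * (E * E * E)) / x)) by (unfold Rdiv; ring).
apply Rmult_le_compat_l; [easy |].
apply Rmult_le_compat_r; [left; apply Rinv_0_lt_compat; lra |].
unfold E; rewrite <- !exp_plus; apply exp_le; nra.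
Qed.

Lemma kernel_increment (s : C) (n x r : R) :
  0 < r -> 4 * r <= Re s -> 1 <= x -> n <= x <= n + 1 ->
  Cmod ((RtoC x - RtoC n) * Rcpow x (- s) / RtoC x * (1 - s * RtoC (ln x))) <=
  (1 + Cmod s * / r) * (exp (- r * ln x) / x).
Proof.
intros Hr Hs Hx Hn; rewrite Cmod_mult.
set (L := ln x); assert (HL : 0 <= L) by now apply ln_nonneg.
pose proof (Cmod_ge_0 s).
assert (Hir : 0 < / r) by now apply Rinv_0_lt_compat.
assert (HE : 1 <= exp (r * L)) by (rewrite <- exp_0; apply exp_le; nra).
assert (Hb : Cmod (1 - s * RtoC L) <= (1 + Cmod s * / r) * exp (r * L)).
{ eapply Rle_trans; [apply Cmod_triangle |].
  rewrite Cmod_1, Cmod_opp, Cmod_mult, Cmod_R, Rabs_pos_eq by easy.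
  pose proof (ln_le_exp r L Hr HL); nra. }
pose proof (Cmod_kernel s n x Hx Hn) as Hk; fold L in Hk.
eapply Rle_trans; [apply Rmult_le_compat; [apply Cmod_ge_0.. | exact Hk | exact Hb] |].
replace (exp (- Re s * L) / x * ((1 + Cmod s * / r) * exp (r * L))) with
  ((1 + Cmod s * / r) * ((exp (- Re s * L) * exp (r * L)) / x))
  by (unfold Rdiv; ring).
apply Rmult_le_compat_l; [nra |].
apply Rmult_le_compat_r; [left; apply Rinv_0_lt_compat; lra |].
rewrite <- exp_plus; apply exp_le; nra.
Qed.

Lemma zeta_approx'_lim (s : C) : 0 < Re s -> s <> 1 ->
  exists l, clim (zeta_approx' s) l.
Proof.
intros Hp Hs; set (r := Re s / 4).
assert (Hr : 0 < r) by (unfold r; lra).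
pose proof (Cmod_ge_0 s).
assert (Hir : 0 < / r) by now apply Rinv_0_lt_compat.
set (K := 1 + Cmod s * / r).
assert (HK : 0 <= K) by (unfold K; nra).
eexists; apply (clim_ex _ (fun N => K / r * exp (- r * ln (INR N)))).
- replace (Finite 0) with (Rbar_mult (K / r) 0) by (simpl; f_equal; ring).
  now apply is_lim_seq_scal_l, exp_tail_lim.
- apply telescope; auto.
  intros N HN; rewrite zeta_approx'_step by easy.
  eapply incr_tail; try easy.
  + intros x Hx1 Hx; apply cder_theta; [easy | lra].
  + intros x Hx1 Hx; simpl; rewrite Cmod_opp.
    apply kernel_increment; unfold r in *; auto; lra.
Qed.

Lemma remainder_bound (s : C) : 0 < Re s -> s <> 1 ->
  exists B d, 0 <= B /\ 0 < d /\
  forall h N, Cmod h <= d -> (1 <= N)%nat ->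
  0 < Re (s + h)%C /\ (s + h)%C <> 1 /\
  Cmod (zeta_approx (s + h) N - zeta_approx s N - h * zeta_approx' s N) <=
  B * (Cmod h * Cmod h).
Proof.
intros Hp Hs; set (r := Re s / 4).
assert (Hr : 0 < r) by (unfold r; lra).
pose proof (one_minus_neq0 s Hs) as Hs1.
set (q := Cmod (1 - s)).
assert (Hq : 0 < q) by now apply Cmod_gt_0.
pose proof (Cmod_ge_0 s).
assert (Hir : 0 < / r) by now apply Rinv_0_lt_compat.
set (K := Cmod s * / r * / r + / r).
assert (HK : 0 <= K) by (unfold K; apply Rplus_le_le_0_compat; [| lra];
  repeat apply Rmult_le_pos; lra).
assert (HKr : 0 <= K / r) by now apply Rdiv_le_0_compat.
assert (Hq3 : 0 < / (q * q * (q / 2))) by (apply Rinv_0_lt_compat, Rmult_lt_0_compat; nra).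
exists (K / r + / (q * q * (q / 2))), (Rmin r (q / 2)).
split; [apply Rplus_le_le_0_compat; [exact HKr | now left] |].
split; [apply Rmin_glb_lt; lra |].
intros h N Hh HN.
assert (Hhr : Cmod h <= r) by (eapply Rle_trans; [exact Hh | apply Rmin_l]).
assert (Hhq : Cmod h <= q / 2) by (eapply Rle_trans; [exact Hh | apply Rmin_r]).
pose proof (Cmod_ge_0 h) as Hh0.
assert (Hd : q / 2 <= Cmod (1 - (s + h))).
{ pose proof (Cmod_triangle (1 - (s + h)) h) as Ht.
  replace (1 - (s + h) + h)%C with (1 - s)%C in Ht by ring; fold q in Ht; lra. }
assert (Hsh : (s + h)%C <> 1).
{ intros E; rewrite E in Hd; replace (1 - 1)%C with (RtoC 0) in Hd by ring.
  rewrite Cmod_0 in Hd; lra. }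
assert (Hsh1 := one_minus_neq0 _ Hsh).
split; [| split; [exact Hsh |]].
{ pose proof (Re_le_Cmod (- h)) as Ht; rewrite Cmod_opp in Ht.
  unfold Re in *; simpl in *; unfold r in *; lra. }
set (U N := (zeta_approx (s + h) N - zeta_approx s N - h * zeta_approx' s N)%C).
assert (H1 : Cmod (U 1%nat) <= / (q * q * (q / 2)) * (Cmod h * Cmod h)).
{ assert (Hone : forall a, Rcpow 1 a = 1).
  { intros a; unfold Rcpow, Cexp; rewrite ln_1; apply C_eq; unfold Re, Im; simpl;
    replace (_ - _) with 0 by ring; replace (_ + _) with 0 by ring;
    rewrite ?exp_0, ?cos_0, ?sin_0; ring. }
  assert (E : U 1%nat =
    (- (h * h / ((1 - s) * (1 - s) * (1 - (s + h)))))%C).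
  { unfold U, zeta_approx, zeta_approx'; rewrite !sum_n_n; simpl INR.
    rewrite !Hone, ln_1; field; auto. }
  rewrite E, Cmod_opp.
  assert (Hss : ((1 - s) * (1 - s))%C <> 0) by now apply Cmult_neq_0.
  rewrite Cmod_div by now apply Cmult_neq_0.
  rewrite !Cmod_mult; fold q.
  unfold Rdiv at 1; rewrite Rmult_comm.
  apply Rmult_le_compat_r; [nra |].
  apply Rinv_le_contravar; [apply Rmult_lt_0_compat; nra |].
  apply Rmult_le_compat_l; [nra | easy]. }
assert (H2 : Cmod (U N - U 1%nat) <= K * (Cmod h * Cmod h) / r
   * exp (- r * ln (INR 1))).
{ apply telescope; auto; [nra |].
  clear N HN; intros N HN.
  replace (U (S N) - U N)%C with
    ((phi (s + h) (INR N) (INR (S N)) - phi s (INR N) (INR (S N))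
       - h * theta s (INR N) (INR (S N)))
     - (phi (s + h) (INR N) (INR N) - phi s (INR N) (INR N)
       - h * theta s (INR N) (INR N)))%C.
  2: { pose proof (zeta_approx_step s N Hs HN) as E1.
       pose proof (zeta_approx_step (s + h) N Hsh HN) as E2.
       pose proof (zeta_approx'_step s N Hs HN) as E3.
       transitivity
        ((phi (s + h) (INR N) (INR (S N)) - phi (s + h) (INR N) (INR N))
         - (phi s (INR N) (INR (S N)) - phi s (INR N) (INR N))
         - h * (theta s (INR N) (INR (S N)) - theta s (INR N) (INR N)))%C;
        [ring |].
       rewrite <- E1, <- E2, <- E3; unfold U; ring. }
  apply (incr_tail (fun x => phi (s + h) (INR N) x - phi s (INR N) x
    - h * theta s (INR N) x)%C
    (fun x => let k s := ((RtoC x - RtoC (INR N)) * Rcpow x (- s) / RtoC x)%C in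
      - ((s + h) * k (s + h)%C) + s * k s
        + h * (k s * (1 - s * RtoC (ln x))))%C); auto.
  - intros x Hx1 Hx; eapply cder_eq.
    + apply cder_minus; [apply cder_minus; (apply cder_phi; [easy | lra]) |].
      apply cder_mult; [apply cder_const | apply cder_theta; [easy | lra]].
    + cbv zeta beta; unfold Cdiv; ring.
  - intros x Hx1 Hx; apply kernel_remainder; auto; unfold r; lra. }
simpl INR in H2; rewrite ln_1, Rmult_0_r, exp_0, Rmult_1_r in H2.
replace (K * (Cmod h * Cmod h) / r) with (K / r * (Cmod h * Cmod h)) in H2
  by (unfold Rdiv; ring).
change (Cmod (U N) <= (K / r + / (q * q * (q / 2))) * (Cmod h * Cmod h)).
replace (U N) with ((U N - U 1%nat) + U 1%nat)%C by ring.
eapply Rle_trans; [apply Cmod_triangle | lra].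
Qed.

Lemma zeta_holomorphic (s : C) : 0 < Re s -> s <> 1 ->
  ex_derive (K := C_AbsRing) (V := C_NormedModule) zeta s.
Proof.
intros Hp Hs.
destruct (zeta_approx'_lim s Hp Hs) as [l Hl].
destruct (remainder_bound s Hp Hs) as (B & d & HB & Hd & H).
assert (Hz : forall h, Cmod h <= d ->
  Cmod (zeta (s + h) - zeta s - h * l) <= B * (Cmod h * Cmod h)).
{ intros h Hh.
  destruct (H h 1%nat Hh ltac:(lia)) as (Hp' & Hs' & _).
  apply (clim_Cmod (fun N =>
    zeta_approx (s + h) N - zeta_approx s N - h * zeta_approx' s N)%C).
  - apply clim_minus; [apply clim_minus | now apply clim_scal];
      now apply zeta_approx_lim.
  - intros N HN; now apply H. }
exists l; split; [apply is_linear_scal_l |].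
intros y Hy.
apply (is_filter_lim_locally_unique
  (K := C_AbsRing) (V := AbsRing_NormedModule C_AbsRing)) in Hy; subst y.
intros eps.
assert (He : 0 < Rmin d (eps / (B + 1))).
{ apply Rmin_glb_lt; [easy |]; apply Rdiv_lt_0_compat; [apply cond_pos | lra]. }
exists (mkposreal _ He); intros y Hy; change C in (type of y).
change (Cmod (y - s) < Rmin d (eps / (B + 1))) in Hy.
change (Cmod ((zeta y - zeta s) - (y - s) * l) <= eps * Cmod (y - s)).
assert (Hyd : Cmod (y - s) <= d)
  by (left; eapply Rlt_le_trans; [exact Hy | apply Rmin_l]).
pose proof (Hz _ Hyd) as Hb; replace (s + (y - s))%C with y in Hb by ring.
assert (Hye : Cmod (y - s) < eps / (B + 1))
  by (eapply Rlt_le_trans; [exact Hy | apply Rmin_r]).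
apply (Rmult_lt_compat_l (B + 1)) in Hye; [| lra].
replace ((B + 1) * (eps / (B + 1))) with (pos eps) in Hye by (field; lra).
pose proof (Cmod_ge_0 (y - s)); nra.
Qed.

(* Main.v *)
Require Import Defs.
From Stdlib Require Import Reals Lra Lia.
From Coquelicot Require Import Coquelicot.

Open Scope R_scope.

(** Write [kappa = ln (2 PI) - 2 gamma].  Everything rests on the second-order
    mean square of zeta on the critical line,
      [int_0^T |zeta(1/2+it)|^2 dt = T ln T - (1 + kappa) T + o(T)].
    As [T ln T - T] is a primitive of [ln T], the integral of
    [ln t - |zeta|^2] over [[A, B]] is then [kappa (B - A) + o(A + B)], so the limit
    attached to [q = (x^n + y^n) / z^n] exists and equals [N q].  It differs from
    [N] exactly when [q <> 1], that is when [x^n + y^n <> z^n], and this gives both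
    implications at once.

    The mean square is obtained from a smoothed version.  Let
    [G(T) = int_0^T 2 (T - t) |zeta(1/2+it)|^2 dt].  The partial mean is trapped
    between difference quotients of [G] because the integrand is nonnegative
    ([mean_of_fejer_moment]), so it suffices to know [G] with an error
    [o(T^2 / ln T)] ([fejer_moment_zeta]).

    With the triangular weight all transforms are explicit.  Replace zeta by
    [Z_N(s) = sum_{n <= N} n^-s - N^(1-s)/(1-s)] with [N] about [T^(7/5)]; the
    trapezoidal rule gives the error [O(N^(-1/2) + T^2 N^(-3/2))]
    ([zeta_approx_error]).  Expanding the square and integrating leaves
      [sum_{m,n} (mn)^(-1/2) K(ln n - ln m) - 2 sum_n Q(ln (N/n))],
    where [K(x) = 2 (1 - cos T x) / x^2] is the cosine transform of the weight and
    [Q] is the primitive of [e^(y/2) K(y)] vanishing at [0]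
    ([RInt_zeta_approx]).  The cross terms are [PI T] each, up to small errors
    ([cross_term_bound]).  In the double sum [m] close to [n] dominates, so
    [K(ln n - ln m)] may be replaced by [K((n - m)/n)] for [m < n]
    ([weight_cos_linearize]); the sum over [n - m] is then a Fejer mean of
    [sum_h (1 - cos h th) / h^2], whose value is a piecewise quadratic polynomial
    in [th = T/n] ([fejer_poisson]).  The term linear in [T] cancels
    against the cross terms, and what is left is
      [8 PI^2 sum_{n,k} max(0, T/(2 PI) - n k)],
    the integrated form of Dirichlet's divisor problem.  The hyperbola method
    evaluates it ([divisor_sum_asymp]), and this is where Euler's constant, doubled,
    and [ln (2 PI)] come from. *)

(** * Finite sums *)

(** Sums start at index 1, matching the Dirichlet series; the recursion on the
    upper bound makes [simpl] peel off the last term. *)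
Fixpoint psum (f : nat -> R) (N : nat) : R :=
  match N with O => 0 | S n => psum f n + f (S n) end.

Lemma psum_sum_n_m f N : psum f N = sum_n_m f 1 N.
Proof.
induction N as [|N IH]; simpl.
- now rewrite sum_n_m_zero by lia.
- rewrite sum_n_Sm by lia; rewrite IH; reflexivity.
Qed.

Lemma psum_ext f g N : (forall k, (1 <= k <= N)%nat -> f k = g k) ->
  psum f N = psum g N.
Proof.
induction N as [|N IH]; intros H; simpl; [easy|].
rewrite IH, H by (intros; try apply H; lia); easy.
Qed.

Lemma psum_le f g N : (forall k, (1 <= k <= N)%nat -> f k <= g k) ->
  psum f N <= psum g N.
Proof.
induction N as [|N IH]; intros H; simpl; [lra|].
apply Rplus_le_compat; [apply IH; intros; apply H; lia | apply H; lia].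
Qed.

Lemma psum_nonneg f N : (forall k, (1 <= k <= N)%nat -> 0 <= f k) -> 0 <= psum f N.
Proof.
induction N as [|N IH]; intros H; simpl; [lra|].
apply Rplus_le_le_0_compat; [apply IH; intros; apply H; lia | apply H; lia].
Qed.

Lemma psum_plus f g N : psum (fun k => f k + g k) N = psum f N + psum g N.
Proof. induction N as [|N IH]; simpl; [lra|]; rewrite IH; ring. Qed.

Lemma psum_minus f g N : psum (fun k => f k - g k) N = psum f N - psum g N.
Proof. induction N as [|N IH]; simpl; [lra|]; rewrite IH; ring. Qed.

Lemma psum_scal c f N : psum (fun k => c * f k) N = c * psum f N.
Proof. induction N as [|N IH]; simpl; [lra|]; rewrite IH; ring. Qed.

Lemma psum_const c N : psum (fun _ => c) N = INR N * c.
Proof. induction N as [|N IH]; [simpl; lra|]; rewrite S_INR; simpl; rewrite IH; ring. Qed.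

Lemma psum_abs f N : Rabs (psum f N) <= psum (fun k => Rabs (f k)) N.
Proof.
induction N as [|N IH]; simpl; [rewrite Rabs_R0; lra|].
eapply Rle_trans; [apply Rabs_triang|]; lra.
Qed.

Lemma psum_dist f g e N :
  (forall k, (1 <= k <= N)%nat -> Rabs (f k - g k) <= e k) ->
  Rabs (psum f N - psum g N) <= psum e N.
Proof.
intros H; rewrite <- psum_minus; eapply Rle_trans; [apply psum_abs|].
now apply psum_le.
Qed.

Lemma psum_swap (a : nat -> nat -> R) N M :
  psum (fun n => psum (fun m => a n m) M) N = psum (fun m => psum (fun n => a n m) N) M.
Proof.
induction N as [|N IH]; simpl.
- now rewrite psum_const, Rmult_0_r.
- now rewrite IH, psum_plus.
Qed.

Lemma psum_app f N M :
  psum f (N + M) = psum f N + psum (fun k => f (N + k)%nat) M.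
Proof.
induction M as [|M IH]; simpl; [rewrite Nat.add_0_r; ring|].
rewrite Nat.add_succ_r; simpl; rewrite IH; ring.
Qed.

Lemma psum_first f N : psum f (S N) = f 1%nat + psum (fun k => f (S k)) N.
Proof. change (S N) with (1 + N)%nat at 1; rewrite psum_app; simpl; ring. Qed.

Lemma psum_rev f N : psum (fun k => f (S N - k)%nat) N = psum f N.
Proof.
revert f; induction N as [|N IH]; intros f; [easy|].
rewrite psum_first.
rewrite (psum_ext _ (fun k => f (S N - k)%nat) N) by (intros; f_equal; lia).
rewrite IH; replace (S (S N) - 1)%nat with (S N) by lia; simpl; ring.
Qed.

Lemma psum_symmetric (a : nat -> nat -> R) N : (forall m n, a m n = a n m) ->
  psum (fun n => psum (fun m => a n m) N) N =
  psum (fun n => a n n + 2 * psum (fun m => a n m) (n - 1)) N.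
Proof.
intros Ha; induction N as [|N IH]; [easy|].
simpl; rewrite psum_plus, IH, Nat.sub_0_r.
rewrite (psum_ext (fun n => a n (S N)) (fun m => a (S N) m)) by (intros; apply Ha).
ring.
Qed.

Lemma psum_INR N : psum INR N = INR N * (INR N + 1) / 2.
Proof.
induction N as [|N IH]; [simpl; lra|].
change (psum INR N + INR (S N) = INR (S N) * (INR (S N) + 1) / 2); rewrite IH, S_INR; field.
Qed.

(** * Harmonic numbers and Euler's constant *)

Lemma ln_le_minus1 x : 0 < x -> ln x <= x - 1.
Proof.
intros Hx; pose proof (exp_ineq1_le (ln x)) as H; rewrite exp_ln in H; lra.
Qed.

Lemma ln_ge_1minus x : 0 < x -> 1 - / x <= ln x.
Proof.
intros Hx; pose proof (ln_le_minus1 (/ x) (Rinv_0_lt_compat _ Hx)) as H.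
rewrite ln_Rinv in H; lra.
Qed.

Definition harm (n : nat) : R := psum (fun k => / INR k) n.

Lemma harm_S n : harm (S n) = harm n + / (INR n + 1).
Proof. unfold harm; rewrite <- S_INR; reflexivity. Qed.

Lemma harm_step n : (1 <= n)%nat ->
  / (INR n + 1) <= ln (INR n + 1) - ln (INR n) <= / INR n.
Proof.
intros Hn; pose proof (Defs.INR_pos n Hn).
rewrite <- ln_div by lra; split.
- replace (/ (INR n + 1)) with (1 - / ((INR n + 1) / INR n)) by (field; lra).
  apply ln_ge_1minus, Rdiv_lt_0_compat; lra.
- replace (/ INR n) with ((INR n + 1) / INR n - 1) by (field; lra).
  apply ln_le_minus1, Rdiv_lt_0_compat; lra.
Qed.

Lemma harm_diff n m : (1 <= n)%nat -> (n <= m)%nat ->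
  0 <= (harm n - ln (INR n)) - (harm m - ln (INR m)) <= / INR n - / INR m.
Proof.
intros Hn Hm; induction Hm as [|m Hm IH]; [lra|].
pose proof (Defs.INR_pos m ltac:(lia)).
pose proof (harm_step m ltac:(lia)) as Hs.
rewrite harm_S, S_INR; split; [lra|].
assert (0 < INR m * (INR m + 1)) by nra.
replace (/ (INR m + 1)) with (/ INR m - / (INR m * (INR m + 1))) in * by (field; lra).
lra.
Qed.

Lemma harm_le n : (1 <= n)%nat -> harm n <= 1 + ln (INR n).
Proof.
intros Hn; pose proof (harm_diff 1 n ltac:(lia) Hn) as [H _].
unfold harm at 1 in H; simpl in H; rewrite ln_1, Rinv_1 in H; lra.
Qed.

(** The limit in the definition of [euler_gamma] exists because the increments
    are bounded by a telescoping sum. *)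
Lemma euler_gamma_lim : is_lim_seq (fun n => harm n - ln (INR n)) euler_gamma.
Proof.
unfold euler_gamma.
rewrite (Lim_seq_ext _ (fun n => harm n - ln (INR n)))
  by (intros n; unfold harm; now rewrite psum_sum_n_m).
apply cauchy_lim with (fun n => / INR n).
- replace (Finite 0) with (Rbar_inv p_infty) by reflexivity.
  apply is_lim_seq_inv; [apply is_lim_seq_INR | easy].
- intros N M HN HM; pose proof (harm_diff N M HN HM).
  pose proof (Defs.INR_pos M ltac:(lia)).
  assert (0 < / INR M) by (apply Rinv_0_lt_compat; lra).
  rewrite Rabs_minus_sym, Rabs_pos_eq; lra.
Qed.

Lemma harm_gamma n : (1 <= n)%nat ->
  0 <= harm n - ln (INR n) - euler_gamma <= / INR n.
Proof.
intros Hn.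
assert (H : Rbar_le 0 (harm n - ln (INR n) - euler_gamma) /\
  Rbar_le (harm n - ln (INR n) - euler_gamma) (/ INR n)).
{ assert (L : is_lim_seq (fun m => (harm n - ln (INR n)) - (harm (m + n) - ln (INR (m + n))))
    (harm n - ln (INR n) - euler_gamma)).
  { apply is_lim_seq_minus'; [apply is_lim_seq_const|].
    apply (is_lim_seq_incr_n (fun m => harm m - ln (INR m)) n), euler_gamma_lim. }
  assert (Hb : forall m, 0 <= (harm n - ln (INR n)) - (harm (m + n) - ln (INR (m + n)))
    <= / INR n).
  { intros m; pose proof (harm_diff n (m + n) Hn ltac:(lia)).
    pose proof (Defs.INR_pos (m + n) ltac:(lia)).
    assert (0 < / INR (m + n)) by (apply Rinv_0_lt_compat; lra); lra. }
  split.
  - apply (is_lim_seq_le (fun _ => 0) _ _ _ (fun m => proj1 (Hb m))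
      (is_lim_seq_const 0) L).
  - apply (is_lim_seq_le _ (fun _ => / INR n) _ _ (fun m => proj2 (Hb m)) L
      (is_lim_seq_const _)). }
exact H.
Qed.

(** * Elementary bounds for the cosine *)

Lemma sin_le_id v : 0 <= v -> sin v <= v.
Proof.
intros Hv.
assert (H : 0 - sin 0 <= v - sin v).
{ apply (mvt_nonneg (fun u => u - sin u) (fun u => 1 - cos u)); [easy|].
  intros x _; split; [auto_derive; [easy|ring]|].
  pose proof (COS_bound x); lra. }
rewrite sin_0 in H; lra.
Qed.

Lemma cos_lower2 v : 0 <= v -> 1 - v ^ 2 / 2 <= cos v.
Proof.
intros Hv.
assert (H : cos 0 - (1 - 0 ^ 2 / 2) <= cos v - (1 - v ^ 2 / 2)).
{ apply (mvt_nonneg (fun u => cos u - (1 - u ^ 2 / 2)) (fun u => u - sin u)); [easy|].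
  intros x Hx; split; [auto_derive; [easy|field]|].
  pose proof (sin_le_id x); lra. }
rewrite cos_0 in H; lra.
Qed.

Lemma sin_lower3 v : 0 <= v -> v - v ^ 3 / 6 <= sin v.
Proof.
intros Hv.
assert (H : sin 0 - (0 - 0 ^ 3 / 6) <= sin v - (v - v ^ 3 / 6)).
{ apply (mvt_nonneg (fun u => sin u - (u - u ^ 3 / 6))
    (fun u => cos u - (1 - u ^ 2 / 2))); [easy|].
  intros x Hx; split; [auto_derive; [easy|field]|].
  pose proof (cos_lower2 x); lra. }
rewrite sin_0 in H; lra.
Qed.

Lemma cos_upper4 v : 0 <= v -> cos v <= 1 - v ^ 2 / 2 + v ^ 4 / 24.
Proof.
intros Hv.
assert (H : (1 - 0 ^ 2 / 2 + 0 ^ 4 / 24) - cos 0 <= (1 - v ^ 2 / 2 + v ^ 4 / 24) - cos v).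
{ apply (mvt_nonneg (fun u => (1 - u ^ 2 / 2 + u ^ 4 / 24) - cos u)
    (fun u => sin u - (u - u ^ 3 / 6))); [easy|].
  intros x Hx; split; [auto_derive; [easy|field]|].
  pose proof (sin_lower3 x); lra. }
rewrite cos_0 in H; lra.
Qed.

(** The quartic bound already makes [cos 1.6] negative, so [PI / 2 < 1.6]. *)
Lemma PI_lt_3_2 : PI < 3.2.
Proof.
destruct (Rlt_le_dec PI 3.2) as [H|H]; [easy|exfalso].
pose proof (cos_upper4 1.6 ltac:(lra)).
pose proof (cos_ge_0 1.6 ltac:(lra) ltac:(lra)); lra.
Qed.

Lemma one_minus_cos_le v : 1 - cos v <= v ^ 2 / 2.
Proof.
destruct (Rle_dec 0 v) as [H|H]; [pose proof (cos_lower2 v H); lra|].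
pose proof (cos_lower2 (- v)) as H1; rewrite cos_neg in H1.
replace ((- v) ^ 2) with (v ^ 2) in H1 by ring; lra.
Qed.

(** A substitute for Jordan's inequality: on [[0, PI]] the quartic correction
    takes away at most [10.24 / 24] of [v^2], which leaves more than [v^2 /
    16]. *)
Lemma one_minus_cos_ge v : 0 <= v <= PI -> v ^ 2 / 16 <= 1 - cos v.
Proof.
intros Hv; pose proof (cos_upper4 v ltac:(lra)); pose proof PI_lt_3_2.
assert (0 <= v ^ 2 <= 10.24) by nra.
replace (v ^ 4) with (v ^ 2 * v ^ 2) in * by ring; nra.
Qed.

(** * Fejer means of a quadratic Fourier series *)

Lemma is_derive_psum (f : nat -> R -> R) (f' : nat -> R) x N :
  (forall k, (1 <= k <= N)%nat -> is_derive (f k) x (f' k)) ->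
  is_derive (fun u => psum (fun k => f k u) N) x (psum f' N).
Proof.
induction N as [|N IH]; intros H; simpl.
- exact (is_derive_const 0 x).
- apply @is_derive_plus; [apply IH; intros; apply H; lia | apply H; lia].
Qed.

(** The Fejer mean of order [M] of [sum_h (1 - cos (h th)) / h^2].  Fejer
    weights are used because the second derivative below is then a positive
    kernel. *)
Definition fejer (M : nat) (th : R) : R :=
  psum (fun h => (1 - INR h / INR M) * (1 - cos (INR h * th)) / INR h ^ 2) (M - 1).
Definition fejer1 (M : nat) (th : R) : R :=
  psum (fun h => (1 - INR h / INR M) * sin (INR h * th) / INR h) (M - 1).
Definition fejer2 (M : nat) (th : R) : R :=
  psum (fun h => (1 - INR h / INR M) * cos (INR h * th)) (M - 1).

Lemma is_derive_fejer M th : is_derive (fejer M) th (fejer1 M th).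
Proof.
unfold fejer, fejer1; apply is_derive_psum; intros k Hk.
pose proof (Defs.INR_pos k ltac:(lia)).
auto_derive; [easy|field; split; try lra].
pose proof (Defs.INR_pos M ltac:(lia)); lra.
Qed.

Lemma is_derive_fejer1 M th : is_derive (fejer1 M) th (fejer2 M th).
Proof.
unfold fejer1, fejer2; apply is_derive_psum; intros k Hk.
pose proof (Defs.INR_pos k ltac:(lia)).
auto_derive; [easy|field; split; try lra].
pose proof (Defs.INR_pos M ltac:(lia)); lra.
Qed.

Lemma dirichlet_kernel m th :
  (1 - cos th) * (1 + 2 * psum (fun h => cos (INR h * th)) m) =
  cos (INR m * th) - cos (INR (S m) * th).
Proof.
induction m as [|m IH].
- simpl; rewrite Rmult_0_l, cos_0, Rmult_1_l; ring.
- change (psum _ (S m)) with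
    (psum (fun h => cos (INR h * th)) m + cos (INR (S m) * th)).
  replace (_ * _) with
    ((1 - cos th) * (1 + 2 * psum (fun h => cos (INR h * th)) m)
     + 2 * cos (INR (S m) * th) - 2 * cos th * cos (INR (S m) * th)) by ring.
  rewrite IH.
  replace (INR (S (S m)) * th) with (INR (S m) * th + th) by (rewrite (S_INR (S m)); ring).
  replace (INR m * th) with (INR (S m) * th - th) by (rewrite (S_INR m); ring).
  rewrite cos_plus, cos_minus; ring.
Qed.

(** The closed form of the Fejer kernel, by summing Dirichlet kernels; written
    multiplicatively it needs no case distinction at [th = 0]. *)
Lemma fejer_kernel m th :
  (1 - cos th) *
  (INR (S m) + 2 * psum (fun h => (INR (S m) - INR h) * cos (INR h * th)) m) =
  1 - cos (INR (S m) * th).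
Proof.
induction m as [|m IH].
- simpl; rewrite Rmult_1_l; ring.
- pose proof (dirichlet_kernel (S m) th) as D.
  rewrite (psum_ext (fun h => (INR (S (S m)) - INR h) * cos (INR h * th))
    (fun h => (INR (S m) - INR h) * cos (INR h * th) + cos (INR h * th)))
    by (intros k _; rewrite (S_INR (S m)); ring).
  rewrite psum_plus.
  change (psum (fun h => (INR (S m) - INR h) * cos (INR h * th)) (S m)) with
    (psum (fun h => (INR (S m) - INR h) * cos (INR h * th)) m +
     (INR (S m) - INR (S m)) * cos (INR (S m) * th)).
  rewrite (S_INR (S m)) at 1.
  revert D IH; generalize (psum (fun h => (INR (S m) - INR h) * cos (INR h * th)) m)
    (psum (fun h => cos (INR h * th)) (S m)); intros; lra.
Qed.

(** On [[0, 2 PI]] the full series equals [th (2 PI - th) / 4]; this is the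
    deviation of its Fejer mean. *)
Definition fejer_err (M : nat) (th : R) : R := fejer M th - th * (2 * PI - th) / 4.
Definition fejer_err1 (M : nat) (th : R) : R := fejer1 M th - (PI - th) / 2.
Definition fejer_err2 (M : nat) (th : R) : R := fejer2 M th + / 2.

Lemma is_derive_fejer_err M th : is_derive (fejer_err M) th (fejer_err1 M th).
Proof.
unfold fejer_err, fejer_err1; apply @is_derive_minus; [apply is_derive_fejer|].
auto_derive; [easy|field].
Qed.

Lemma is_derive_fejer_err1 M th : is_derive (fejer_err1 M) th (fejer_err2 M th).
Proof.
unfold fejer_err1, fejer_err2.
replace (fejer2 M th + / 2) with (fejer2 M th - - / 2) by ring.
apply @is_derive_minus; [apply is_derive_fejer1|].
auto_derive; [easy|field].
Qed.

Lemma fejer_err2_kernel M th : (1 <= M)%nat ->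
  (1 - cos th) * (2 * INR M * fejer_err2 M th) = 1 - cos (INR M * th).
Proof.
destruct M as [|m]; [lia|intros _].
rewrite <- fejer_kernel; f_equal.
unfold fejer_err2, fejer2; replace (S m - 1)%nat with m by lia.
pose proof (Defs.INR_pos (S m) ltac:(lia)).
rewrite Rmult_plus_distr_l, <- psum_scal.
rewrite (psum_ext _ (fun h => 2 * ((INR (S m) - INR h) * cos (INR h * th))))
  by (intros; cbv beta; field; lra).
rewrite psum_scal; field.
Qed.

Lemma fejer_err2_bound M th : (1 <= M)%nat -> 0 < th <= PI ->
  0 <= fejer_err2 M th <= 16 / (INR M * th ^ 2).
Proof.
intros HM Hth; pose proof (fejer_err2_kernel M th HM) as E.
pose proof (Defs.INR_pos M HM).
pose proof (COS_bound (INR M * th)) as Hc.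
pose proof (one_minus_cos_ge th ltac:(lra)) as Hl.
assert (Hth2 : 0 < th ^ 2) by (apply pow_lt; lra).
assert (0 < 1 - cos th) by lra.
assert (Hp : 0 <= 2 * INR M * fejer_err2 M th).
{ apply Rmult_le_reg_l with (1 - cos th); [easy|]; rewrite E; lra. }
split; [nra|].
apply Rmult_le_reg_l with (INR M * th ^ 2); [nra|].
replace (INR M * th ^ 2 * (16 / (INR M * th ^ 2))) with 16 by (field; lra).
nra.
Qed.

Lemma fejer_err2_0 M : (1 <= M)%nat -> fejer_err2 M 0 = INR M / 2.
Proof.
intros HM; unfold fejer_err2, fejer2; pose proof (Defs.INR_pos M HM).
rewrite (psum_ext _ (fun h => 1 - / INR M * INR h))
  by (intros; cbv beta; rewrite Rmult_0_r, cos_0; unfold Rdiv; ring).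
rewrite psum_minus, psum_const, psum_scal, psum_INR, minus_INR by lia.
change (INR 1) with 1. field. lra.
Qed.

Lemma fejer_err1_0 M : fejer_err1 M 0 = - (PI / 2).
Proof.
unfold fejer_err1, fejer1.
rewrite (psum_ext _ (fun _ => 0)).
- rewrite psum_const; field.
- intros k Hk; rewrite Rmult_0_r, sin_0; unfold Rdiv; ring.
Qed.

Lemma sin_INR_PI k : sin (INR k * PI) = 0.
Proof. rewrite INR_IZR_INZ; apply sin_eq_0_1; eauto. Qed.

Lemma fejer_err1_PI M : fejer_err1 M PI = 0.
Proof.
unfold fejer_err1, fejer1.
rewrite (psum_ext _ (fun _ => 0)).
- rewrite psum_const; field.
- intros k Hk; rewrite sin_INR_PI; unfold Rdiv; ring.
Qed.

(** The derivative vanishes at [PI] and its own derivative is a nonnegative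
    kernel bounded by [16 / (M th^2)], which integrates to [16 / (M th)]. *)
Lemma fejer_err1_bound M th : (1 <= M)%nat -> 0 < th <= PI ->
  0 <= - fejer_err1 M th <= 16 / (INR M * th).
Proof.
intros HM Hth; pose proof (Defs.INR_pos M HM).
assert (H0 : fejer_err1 M th <= fejer_err1 M PI).
{ apply (mvt_nonneg (fejer_err1 M) (fejer_err2 M)); [lra|].
  intros x Hx; split; [apply is_derive_fejer_err1 | apply fejer_err2_bound; [easy|lra]]. }
assert (H1 : (- (16 / (INR M * th))) - fejer_err1 M th <= (- (16 / (INR M * PI))) - fejer_err1 M PI).
{ apply (mvt_nonneg (fun u => (- (16 / (INR M * u))) - fejer_err1 M u)
    (fun u => 16 / (INR M * u ^ 2) - fejer_err2 M u)); [lra|].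
  intros x Hx; split.
  - apply @is_derive_minus; [|apply is_derive_fejer_err1].
    auto_derive; [nra|field; nra].
  - pose proof (fejer_err2_bound M x HM ltac:(lra)); lra. }
rewrite fejer_err1_PI in *.
assert (0 < 16 / (INR M * PI)) by (apply Rdiv_lt_0_compat; [lra|]; pose proof PI_RGT_0; nra).
lra.
Qed.

Lemma fejer_err1_ge M th : (1 <= M)%nat -> 0 <= th <= PI -> - (PI / 2) <= fejer_err1 M th.
Proof.
intros HM Hth; pose proof (Defs.INR_pos M HM); rewrite <- (fejer_err1_0 M).
apply (mvt_nonneg (fejer_err1 M) (fejer_err2 M)); [lra|].
intros x Hx; split; [apply is_derive_fejer_err1|].
destruct (Req_dec x 0) as [->|Hx0]; [rewrite fejer_err2_0 by easy; lra|].
apply fejer_err2_bound; [easy|lra].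
Qed.

Lemma fejer_err_0 M : fejer_err M 0 = 0.
Proof.
unfold fejer_err, fejer.
rewrite (psum_ext _ (fun _ => 0)).
- rewrite psum_const; field.
- intros k Hk; rewrite Rmult_0_r, cos_0; unfold Rdiv; ring.
Qed.

(** A lower bound for [exp (6/5)] by repeated squaring, starting from [exp
    (3/80) >= 1 + 3/80]. *)
Lemma ln_PI_le : ln PI <= 6 / 5.
Proof.
rewrite <- (ln_exp (6 / 5)); apply ln_le; [apply PI_RGT_0|].
pose proof PI_lt_3_2.
assert (1.8 <= exp (3 / 5)).
{ replace (3 / 5) with (3/10 + 3/10) by field; rewrite exp_plus.
  assert (1.3418 <= exp (3/10)); [|nra].
  replace (3 / 10) with (3/20 + 3/20) by field; rewrite exp_plus.
  assert (1.1584 <= exp (3/20)); [|nra].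
  replace (3 / 20) with (3/40 + 3/40) by field; rewrite exp_plus.
  assert (1.0763 <= exp (3/40)); [|nra].
  replace (3 / 40) with (3/80 + 3/80) by field; rewrite exp_plus.
  pose proof (exp_ineq1_le (3/80)); nra. }
replace (6 / 5) with (3/5 + 3/5) by field; rewrite exp_plus; nra.
Qed.

(** The deviation starts at [0] and decreases on [[0, PI]], so it suffices to
    bound its drop.  Its slope is at least [- PI / 2] near [0] and at least [-
    16 / (M th)] away from [0]; cutting at [th = 1 / M] gives [O((1 + ln M) /
    M)]. *)
Lemma fejer_err_bound M th : (1 <= M)%nat -> 0 <= th <= PI ->
  Rabs (fejer_err M th) <= 21 * (1 + ln (INR M)) / INR M.
Proof.
intros HM Hth; pose proof (Defs.INR_pos M HM) as HM1.
assert (HlnM : 0 <= ln (INR M)) by now apply ln_nonneg.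
pose proof PI_RGT_0; pose proof PI_lt_3_2; pose proof ln_PI_le.
pose proof PI2_3_2.
(* The cut between the two bounds for the slope. *)
set (d := / INR M).
assert (Hd : 0 < d) by (apply Rinv_0_lt_compat; lra).
assert (Hd1 : d <= 1) by (unfold d; rewrite <- Rinv_1; apply Rinv_le_contravar; lra).
assert (Hneg : forall x, 0 <= x <= PI -> fejer_err1 M x <= 0).
{ intros x Hx; destruct (Req_dec x 0) as [->|Hx0]; [rewrite fejer_err1_0; lra|].
  pose proof (fejer_err1_bound M x HM ltac:(lra)); lra. }
assert (Hdec : forall x y, 0 <= x -> x <= y -> y <= PI -> fejer_err M y <= fejer_err M x).
{ intros x y Hx Hxy Hy.
  apply Ropp_le_cancel, (mvt_nonneg (fun u => - fejer_err M u) (fun u => - fejer_err1 M u)); [lra|].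
  intros u Hu; split; [apply @is_derive_opp, is_derive_fejer_err|].
  pose proof (Hneg u ltac:(lra)); lra. }
assert (HA : fejer_err M 0 + PI / 2 * 0 <= fejer_err M d + PI / 2 * d).
{ apply (mvt_nonneg (fun u => fejer_err M u + PI / 2 * u) (fun u => fejer_err1 M u + PI / 2)); [lra|].
  intros u Hu; split.
  - apply @is_derive_plus; [apply is_derive_fejer_err|auto_derive; [easy|ring]].
  - pose proof (fejer_err1_ge M u HM ltac:(lra)); lra. }
assert (HB : fejer_err M d + 16 * d * ln d <= fejer_err M PI + 16 * d * ln PI).
{ apply (mvt_nonneg (fun u => fejer_err M u + 16 * d * ln u) (fun u => fejer_err1 M u + 16 * d / u)); [lra|].
  intros u Hu; split.
  - apply @is_derive_plus; [apply is_derive_fejer_err|auto_derive; [lra|field; lra]].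
  - pose proof (fejer_err1_bound M u HM ltac:(lra)) as Hb.
    replace (16 / (INR M * u)) with (16 * d / u) in Hb by (unfold d; field; lra); lra. }
rewrite fejer_err_0 in HA.
pose proof (Hdec 0 th ltac:(lra) ltac:(lra) ltac:(lra)) as HC; rewrite fejer_err_0 in HC.
pose proof (Hdec th PI ltac:(lra) ltac:(lra) ltac:(lra)) as HD.
assert (Hln : ln d = - ln (INR M)) by (unfold d; apply ln_Rinv; lra).
rewrite Hln in HB.
rewrite Rabs_left1 by lra.
replace (21 * (1 + ln (INR M)) / INR M) with (21 * (1 + ln (INR M)) * d) by (unfold d; field; lra).
nra.
Qed.

Lemma fejer_periodic M th k : fejer M (th + 2 * PI * INR k) = fejer M th.
Proof.
unfold fejer; apply psum_ext; intros h _.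
replace (INR h * (th + 2 * PI * INR k)) with (INR h * th + 2 * INR (h * k) * PI)
  by (rewrite mult_INR; ring).
now rewrite cos_period.
Qed.

Lemma fejer_reflect M th : fejer M (2 * PI - th) = fejer M th.
Proof.
unfold fejer; apply psum_ext; intros h _.
replace (INR h * (2 * PI - th)) with (- (INR h * th) + 2 * INR h * PI) by ring.
now rewrite cos_period, cos_neg.
Qed.

Lemma fejer_err_bound_period M th : (1 <= M)%nat -> 0 <= th <= 2 * PI ->
  Rabs (fejer_err M th) <= 21 * (1 + ln (INR M)) / INR M.
Proof.
intros HM Hth; destruct (Rle_dec th PI); [apply fejer_err_bound; [easy|lra]|].
replace (fejer_err M th) with (fejer_err M (2 * PI - th)); [apply fejer_err_bound; [easy|lra]|].
unfold fejer_err; rewrite fejer_reflect; field.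
Qed.

Lemma psum_ramp y k K : (k <= K)%nat -> INR k <= y <= INR k + 1 ->
  psum (fun j => Rmax 0 (y - INR j)) K = INR k * y - INR k * (INR k + 1) / 2.
Proof.
intros Hk Hy; replace K with (k + (K - k))%nat by lia; rewrite psum_app.
rewrite (psum_ext _ (fun j => y - INR j) k).
2: { intros j Hj; apply Rmax_right; pose proof (le_INR j k ltac:(lia)); lra. }
rewrite (psum_ext _ (fun _ => 0) (K - k)).
2: { intros j Hj; apply Rmax_left; rewrite plus_INR.
     pose proof (Defs.INR_pos j ltac:(lia)); lra. }
rewrite psum_minus, !psum_const, psum_INR; field.
Qed.

(** Poisson summation in disguise: [PI th + 2 PI sum_k max(0, th - 2 PI k) -
    th^2 / 2] is the [2 PI]-periodic function equal to twice [th (2 PI - th) /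
    4] on one period.  Each ramp restores the slope at the start of a new
    period. *)
Lemma fejer_poisson M K th : (1 <= M)%nat -> 0 <= th -> th <= 2 * PI * INR K ->
  Rabs (2 * fejer M th + th ^ 2 / 2
        - (PI * th + 2 * PI * psum (fun k => Rmax 0 (th - 2 * PI * INR k)) K))
  <= 42 * (1 + ln (INR M)) / INR M.
Proof.
intros HM H0 HK; pose proof PI_RGT_0.
set (y := th / (2 * PI)).
assert (Hy : 0 <= y) by (apply Rdiv_le_0_compat; lra).
assert (Hth : th = 2 * PI * y) by (unfold y; field; lra).
destruct (nfloor_ex y Hy) as [k [Hk1 Hk2]].
assert (Hyk : y <= INR K) by nra.
assert (HkK : (k <= K)%nat) by (apply INR_le; lra).
rewrite (psum_ext _ (fun j => 2 * PI * Rmax 0 (y - INR j))).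
2: { intros j _; rewrite <- RmaxRmult by lra; f_equal; [ring | rewrite Hth; ring]. }
rewrite psum_scal, (psum_ramp y k K HkK) by lra.
pose proof (fejer_err_bound_period M (2 * PI * (y - INR k)) HM ltac:(nra)) as HB.
unfold fejer_err in HB.
replace (fejer M th) with (fejer M (2 * PI * (y - INR k))).
2: { rewrite <- (fejer_periodic M _ k); f_equal; rewrite Hth; ring. }
replace (42 * (1 + ln (INR M)) / INR M) with (2 * (21 * (1 + ln (INR M)) / INR M))
  by (unfold Rdiv; ring).
eapply Rle_trans; [|apply Rmult_le_compat_l; [lra|exact HB]].
replace (2 * Rabs _) with (Rabs (2 * (fejer M (2 * PI * (y - INR k))
  - 2 * PI * (y - INR k) * (2 * PI - 2 * PI * (y - INR k)) / 4)))
  by (rewrite Rabs_mult, (Rabs_pos_eq 2) by lra; easy).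
right; f_equal; rewrite Hth; field.
Qed.

(** * The integrated divisor problem *)

Definition divisor_sum (N K : nat) (x : R) : R :=
  psum (fun n => psum (fun k => Rmax 0 (x - INR n * INR k)) K) N.

(** Dirichlet's hyperbola method: if the array vanishes when both indices
    exceed [r], its sum is that of [r] full rows and [r] full columns, the
    square counted twice being removed. *)
Lemma hyperbola_split (a : nat -> nat -> R) r N K :
  (forall n k, (r < n)%nat -> (r < k)%nat -> a n k = 0) ->
  (r <= N)%nat -> (r <= K)%nat ->
  psum (fun n => psum (fun k => a n k) K) N =
  psum (fun n => psum (fun k => a n k) K) r
  + psum (fun k => psum (fun n => a n k) N) r
  - psum (fun n => psum (fun k => a n k) r) r.
Proof.
intros H0 HN HK.
replace N with (r + (N - r))%nat at 1 by lia; rewrite psum_app.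
rewrite (psum_ext (fun j => psum (fun k => a (r + j)%nat k) K)
  (fun j => psum (fun k => a (r + j)%nat k) r)).
2: { intros j Hj; replace K with (r + (K - r))%nat by lia; rewrite psum_app.
     rewrite (psum_ext (fun k => a (r + j)%nat (r + k)%nat) (fun _ => 0))
       by (intros; apply H0; lia).
     rewrite psum_const; ring. }
rewrite (psum_swap (fun j k => a (r + j)%nat k) (N - r) r).
rewrite (psum_ext (fun k => psum (fun n => a n k) N)
  (fun k => psum (fun n => a n k) r + psum (fun j => a (r + j)%nat k) (N - r))).
2: { intros k _; replace N with (r + (N - r))%nat at 1 by lia; apply psum_app. }
rewrite psum_plus, (psum_swap a r r); ring.
Qed.

(** With [y = x / n] and [f] its fractional part, a row sums to [n (y^2 - y +
    f (1 - f)) / 2], and [f (1 - f) <= 1/4]. *)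
Lemma ramp_row (x : R) n K : (1 <= n)%nat -> 0 <= x -> x <= INR K ->
  Rabs (psum (fun k => Rmax 0 (x - INR n * INR k)) K - (x ^ 2 / 2 * / INR n - x / 2))
  <= INR n / 8.
Proof.
intros Hn Hx HK; pose proof (Defs.INR_pos n Hn).
set (y := x / INR n).
assert (Hy : 0 <= y) by (apply Rdiv_le_0_compat; lra).
assert (Hxy : x = INR n * y) by (unfold y; field; lra).
destruct (nfloor_ex y Hy) as [k [Hk1 Hk2]].
assert (HkK : (k <= K)%nat) by (apply INR_le; nra).
rewrite (psum_ext _ (fun k => INR n * Rmax 0 (y - INR k))).
2: { intros j _; rewrite <- RmaxRmult by lra; f_equal; [ring|rewrite Hxy; ring]. }
rewrite psum_scal, (psum_ramp y k K HkK) by lra.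
replace (_ - _) with (INR n * ((y - INR k) * (1 - (y - INR k)) / 2))
  by (rewrite Hxy; field; lra).
set (f := y - INR k); assert (0 <= f <= 1) by (unfold f; lra).
assert (0 <= (1 - 2 * f) ^ 2) by apply pow2_ge_0.
assert (0 <= f * (1 - f)) by nra.
rewrite Rabs_pos_eq by nra; nra.
Qed.

(** The hyperbola method at [r], the integer part of [sqrt x].  Rows give [x^2
    H_r - x r], the square gives [x r^2 - r^2 (r+1)^2 / 4], and [H_r] brings
    in Euler's constant. *)
Lemma divisor_sum_asymp (x : R) N K : 1 <= x -> x <= INR N -> x <= INR K ->
  Rabs (divisor_sum N K x - x ^ 2 * (ln x / 2 + euler_gamma - 3 / 4))
  <= 6 * (x * sqrt x).
Proof.
intros Hx HN HK.
set (s := sqrt x).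
assert (Hs1 : 1 <= s) by (unfold s; rewrite <- sqrt_1; apply sqrt_le_1_alt; lra).
assert (Hss : x = s * s) by (unfold s; now rewrite sqrt_sqrt by lra).
destruct (nfloor_ex s ltac:(lra)) as [r [Hr1 Hr2]].
assert (Hr0 : (1 <= r)%nat).
{ destruct r; [simpl in *; lra|lia]. }
pose proof (Defs.INR_pos r Hr0) as Hr.
assert (HrN : (r <= N)%nat) by (apply INR_le; nra).
assert (HrK : (r <= K)%nat) by (apply INR_le; nra).
unfold divisor_sum; rewrite (hyperbola_split _ r); try easy.
2: { intros n k Hn Hk; apply Rmax_left.
     apply le_INR in Hn, Hk; rewrite S_INR in Hn, Hk; nra. }
assert (Hrow : forall L, x <= INR L ->
  Rabs (psum (fun n => psum (fun k => Rmax 0 (x - INR n * INR k)) L) r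
    - (x ^ 2 / 2 * harm r - INR r * (x / 2))) <= INR r * (INR r + 1) / 16).
{ intros L HL.
  replace (x ^ 2 / 2 * harm r - INR r * (x / 2)) with
    (psum (fun n => x ^ 2 / 2 * / INR n - x / 2) r)
    by (rewrite psum_minus, psum_scal, psum_const; easy).
  replace (INR r * (INR r + 1) / 16) with (psum (fun n => / 8 * INR n) r)
    by (rewrite psum_scal, psum_INR; field).
  apply psum_dist; intros n Hn.
  replace (/ 8 * INR n) with (INR n / 8) by field.
  apply ramp_row; [lia|lra|easy]. }
pose proof (Hrow K HK) as H1; pose proof (Hrow N HN) as H2.
rewrite (psum_ext (fun k => psum (fun n => Rmax 0 (x - INR n * INR k)) N)
  (fun n => psum (fun k => Rmax 0 (x - INR n * INR k)) N)).
2: { intros k _; apply psum_ext; intros; f_equal; ring. }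
replace (psum (fun n => psum (fun k => Rmax 0 (x - INR n * INR k)) r) r) with
  (x * INR r * INR r - (INR r * (INR r + 1) / 2) * (INR r * (INR r + 1) / 2)).
2: { rewrite (psum_ext (fun n => psum (fun k => Rmax 0 (x - INR n * INR k)) r)
       (fun n => INR r * x - INR r * (INR r + 1) / 2 * INR n)).
     - rewrite psum_minus, psum_const, psum_scal, psum_INR; ring.
     - intros n Hn; rewrite (psum_ext _ (fun k => x - INR n * INR k)).
       + rewrite psum_minus, psum_const, psum_scal, psum_INR; ring.
       + intros k Hk; apply Rmax_right.
         pose proof (le_INR n r ltac:(lia)); pose proof (le_INR k r ltac:(lia)).
         pose proof (Defs.INR_pos n ltac:(lia)); pose proof (Defs.INR_pos k ltac:(lia)); nra. }
revert H1 H2; generalize (psum (fun n => psum (fun k => Rmax 0 (x - INR n * INR k)) N) r)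
  (psum (fun n => psum (fun k => Rmax 0 (x - INR n * INR k)) K) r).
intros u v H1 H2.
assert (Hlnx : ln x / 2 = ln s) by (rewrite Hss, ln_mult by lra; field).
rewrite Hlnx.
assert (Hh : Rabs (harm r - ln s - euler_gamma) <= 2 / s).
{ pose proof (harm_gamma r Hr0).
  assert (ln (INR r) <= ln s) by (apply ln_le; lra).
  assert (ln s - ln (INR r) <= / INR r).
  { rewrite <- ln_div by lra.
    eapply Rle_trans; [apply ln_le_minus1, Rdiv_lt_0_compat; lra|].
    replace (s / INR r - 1) with ((s - INR r) * / INR r) by (field; lra).
    assert (0 < / INR r) by (apply Rinv_0_lt_compat; lra); nra. }
  assert (/ INR r <= 2 / s).
  { apply Rmult_le_reg_l with (INR r * s); [nra|].
    replace (INR r * s * / INR r) with s by (field; lra).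
    replace (INR r * s * (2 / s)) with (2 * INR r) by (field; lra); lra. }
  apply Rabs_le; lra. }
assert (Hmain : Rabs (x ^ 2 * (harm r - ln s - euler_gamma)) <= 2 * (x * s)).
{ rewrite Rabs_mult, Rabs_pos_eq by nra.
  apply Rle_trans with (x ^ 2 * (2 / s)); [apply Rmult_le_compat_l; nra|].
  right; rewrite Hss; field; lra. }
set (q := INR r * (INR r + 1)) in *.
assert (Hq : s * (s - 1) <= q <= s * (s + 1)) by (unfold q; nra).
assert (Hr2s : 0 <= s * s - INR r * INR r <= 2 * s) by nra.
assert (Hxs : 0 <= x * s) by nra.
assert (Hx2 : - (2 * (x * s)) <= x * (INR r * INR r) - x * x <= 0) by nra.
assert (Hxr : 0 <= x * INR r <= x * s) by nra.
assert (Hq2 : - (3 * (x * s)) <= q * q - x * x <= 3 * (x * s)).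
{ rewrite Hss; assert (0 <= q) by (unfold q; nra).
  assert (Rabs (q - s * s) <= s) by (apply Rabs_le; nra).
  replace (q * q - s * s * (s * s)) with ((q - s * s) * (q + s * s)) by ring.
  apply Rabs_le_between; rewrite Rabs_mult.
  assert (Rabs (q + s * s) <= 3 * (s * s)) by (rewrite Rabs_pos_eq; nra).
  replace (3 * (s * s * s)) with (s * (3 * (s * s))) by ring.
  apply Rmult_le_compat; try apply Rabs_pos; easy. }
assert (Hq3 : q <= 2 * (x * s)) by (rewrite Hss; nra).
apply Rabs_le_between in H1, H2, Hmain.
apply Rabs_le.
replace (x ^ 2) with (x * x) in * by ring.
nra.
Qed.

(** * Integrals of continuous functions *)

Definition cont (f : R -> R) : Prop := forall x, continuous f x.

Lemma cont_derivable (f : R -> R) : (forall x, ex_derive f x) -> cont f.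
Proof. intros H x; now apply (@ex_derive_continuous R_AbsRing R_NormedModule). Qed.

Lemma cont_ex_RInt f a b : cont f -> ex_RInt f a b.
Proof. intros H; apply (@ex_RInt_continuous R_CompleteNormedModule); intros; apply H. Qed.

Lemma cont_const c : cont (fun _ => c).
Proof. intros x; apply continuous_const. Qed.

Lemma cont_plus f g : cont f -> cont g -> cont (fun t => f t + g t).
Proof. intros Hf Hg x; now apply (@continuous_plus R_UniformSpace R_AbsRing R_NormedModule). Qed.

Lemma cont_minus f g : cont f -> cont g -> cont (fun t => f t - g t).
Proof. intros Hf Hg x; now apply (@continuous_minus R_UniformSpace R_AbsRing R_NormedModule). Qed.

Lemma cont_mult f g : cont f -> cont g -> cont (fun t => f t * g t).
Proof. intros Hf Hg x; now apply (@continuous_mult R_UniformSpace R_AbsRing). Qed.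

Lemma cont_psum (f : nat -> R -> R) N : (forall k, (1 <= k <= N)%nat -> cont (f k)) ->
  cont (fun t => psum (fun k => f k t) N).
Proof.
induction N as [|N IH]; intros H; simpl; [apply cont_const|].
apply cont_plus; [apply IH; intros; apply H; lia | apply H; lia].
Qed.

Lemma RInt_add f g a b : cont f -> cont g ->
  RInt (fun t => f t + g t) a b = RInt f a b + RInt g a b.
Proof. intros; apply @RInt_plus; now apply cont_ex_RInt. Qed.

Lemma RInt_sub f g a b : cont f -> cont g ->
  RInt (fun t => f t - g t) a b = RInt f a b - RInt g a b.
Proof. intros; apply @RInt_minus; now apply cont_ex_RInt. Qed.

Lemma RInt_mul c f a b : cont f -> RInt (fun t => c * f t) a b = c * RInt f a b.
Proof. intros; apply @RInt_scal; now apply cont_ex_RInt. Qed.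

Lemma RInt_psum (f : nat -> R -> R) N a b :
  (forall k, (1 <= k <= N)%nat -> cont (f k)) ->
  RInt (fun t => psum (fun k => f k t) N) a b = psum (fun k => RInt (f k) a b) N.
Proof.
induction N as [|N IH]; intros H; simpl.
- rewrite RInt_const; apply Rmult_0_r.
- rewrite RInt_add, IH; [easy| | |apply H; lia].
  + intros; apply H; lia.
  + apply cont_psum; intros; apply H; lia.
Qed.

Lemma RInt_mono f g a b : a <= b -> cont f -> cont g ->
  (forall t, a <= t <= b -> f t <= g t) -> RInt f a b <= RInt g a b.
Proof.
intros Hab Hf Hg H; apply RInt_le; try easy; try now apply cont_ex_RInt.
intros; apply H; lra.
Qed.

Lemma RInt_congr (f g : R -> R) a b : (forall t, f t = g t) -> RInt f a b = RInt g a b.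
Proof. intros H; apply RInt_ext; intros; apply H. Qed.

Lemma RInt_antiderivative (f f' : R -> R) a b :
  (forall t, is_derive f t (f' t)) -> cont f' -> RInt f' a b = f b - f a.
Proof. intros Hf Hc; apply is_RInt_unique, @is_RInt_derive; intros; auto; apply Hc. Qed.

(** * The transforms of the triangular weight *)

(** The cosine transform on [[0, T]] of the weight [2 (T - t)]; it is the
    Fejer kernel of the line. *)
Definition weight_cos (T x : R) : R := RInt (fun t => 2 * (T - t) * cos (t * x)) 0 T.

Lemma weight_cos_0 T : weight_cos T 0 = T ^ 2.
Proof.
unfold weight_cos.
rewrite (RInt_congr _ (fun t => 2 * (T - t)))
  by (intros; rewrite Rmult_0_r, cos_0; ring).
rewrite (RInt_antiderivative (fun t => - (T - t) ^ 2)).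
- ring.
- intros t; auto_derive; [easy|ring].
- apply cont_derivable; intros; auto_derive; easy.
Qed.

Lemma weight_cos_closed T x : x <> 0 -> weight_cos T x = 2 * (1 - cos (T * x)) / x ^ 2.
Proof.
intros Hx; unfold weight_cos.
rewrite (RInt_antiderivative
  (fun t => 2 * (T - t) * sin (t * x) / x - 2 * cos (t * x) / x ^ 2)).
- rewrite Rmult_0_l, sin_0, cos_0; field; easy.
- intros t; auto_derive; [easy|field; easy].
- apply cont_derivable; intros; auto_derive; easy.
Qed.

Lemma weight_cos_sym T x : weight_cos T (- x) = weight_cos T x.
Proof.
unfold weight_cos; apply RInt_congr; intros t.
now replace (t * - x) with (- (t * x)) by ring; rewrite cos_neg.
Qed.

Lemma weight_cos_pos T x : 0 <= weight_cos T x.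
Proof.
destruct (Req_dec x 0) as [->|Hx]; [rewrite weight_cos_0; nra|].
rewrite weight_cos_closed by easy; pose proof (COS_bound (T * x)).
apply Rmult_le_pos; [lra|]; left; apply Rinv_0_lt_compat, pow2_gt_0; easy.
Qed.

Lemma weight_cos_le_inv T x : x <> 0 -> weight_cos T x <= 4 / x ^ 2.
Proof.
intros Hx; rewrite weight_cos_closed by easy; pose proof (COS_bound (T * x)).
apply Rmult_le_compat_r; [left; apply Rinv_0_lt_compat, pow2_gt_0; easy|lra].
Qed.

Lemma weight_cos_le_T2 T x : weight_cos T x <= T ^ 2.
Proof.
destruct (Req_dec x 0) as [->|Hx]; [rewrite weight_cos_0; lra|].
rewrite weight_cos_closed by easy; pose proof (one_minus_cos_le (T * x)).
assert (0 < x ^ 2) by (apply pow2_gt_0; easy).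
apply Rmult_le_reg_r with (x ^ 2); [easy|].
replace (2 * (1 - cos (T * x)) / x ^ 2 * x ^ 2) with (2 * (1 - cos (T * x)))
  by (field; easy).
nra.
Qed.

(** The harmonic mean interpolates between the bounds [T^2] and [4 / x^2],
    and, multiplied by [x], has the elementary primitive used in
    [cross_term_small]. *)
Lemma weight_cos_le_harmonic T x : 0 < T -> weight_cos T x <= 8 * T ^ 2 / (4 + T ^ 2 * x ^ 2).
Proof.
intros HT.
assert (H0 : 0 <= T ^ 2 * x ^ 2) by (apply Rmult_le_pos; apply pow2_ge_0).
apply Rmult_le_reg_r with (4 + T ^ 2 * x ^ 2); [lra|].
replace (8 * T ^ 2 / (4 + T ^ 2 * x ^ 2) * (4 + T ^ 2 * x ^ 2)) with (8 * T ^ 2)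
  by (field; lra).
pose proof (weight_cos_le_T2 T x) as H1.
assert (H2 : weight_cos T x * x ^ 2 <= 4).
{ destruct (Req_dec x 0) as [->|Hx].
  - replace (0 ^ 2) with 0 by ring; lra.
  - pose proof (weight_cos_le_inv T x Hx) as H.
    assert (0 < x ^ 2) by (apply pow2_gt_0; easy).
    apply Rmult_le_compat_r with (r := x ^ 2) in H; [|lra].
    replace (4 / x ^ 2 * x ^ 2) with 4 in H by (field; easy); lra. }
assert (0 < T ^ 2) by (apply pow_lt; lra); nra.
Qed.

(** The weight times [e^(y/2) Re (e^(-ity) / (1/2 - it))], which, for [y = ln
    (N/n)], is the real part of the product of [N^(1-s)/(1-s)] with the
    conjugate of [n^-s]. *)
Definition cross_integrand (T y t : R) : R :=
  2 * (T - t) * (exp (y / 2) * ((/ 2 * cos (t * y) + t * sin (t * y)) / (/ 4 + t ^ 2))).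
(** The values at [y = 0], summed over [n <= N] with the factor [2] of the
    cross terms, are exactly what the square of [N^(1-s)/(1-s)] contributes;
    subtracting them here disposes of that square. *)
Definition cross_term (T y : R) : R := RInt (cross_integrand T y) 0 T - RInt (cross_integrand T 0) 0 T.

Lemma quarter_plus_pos t : 0 < / 4 + t ^ 2.
Proof. pose proof (pow2_ge_0 t); lra. Qed.

Lemma cont_cross T y : cont (cross_integrand T y).
Proof.
apply cont_derivable; intros t; unfold cross_integrand; auto_derive.
pose proof (quarter_plus_pos t); simpl in *; lra.
Qed.

Lemma is_derive_cross T y t :
  is_derive (fun u => cross_integrand T u t) y (exp (y / 2) * (2 * (T - t) * cos (t * y))).
Proof.
pose proof (quarter_plus_pos t).
unfold cross_integrand; auto_derive; [simpl in *; lra|].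
change (y * / 2) with (y / 2); field; simpl in *; lra.
Qed.

(** Differentiating in [y] cancels the denominator [1/4 + t^2], so that only
    the transform of the weight remains. *)
Lemma is_derive_cross_term T y : is_derive (cross_term T) y (exp (y / 2) * weight_cos T y).
Proof.
unfold cross_term.
replace (exp (y / 2) * weight_cos T y) with (exp (y / 2) * weight_cos T y - 0) by ring.
apply @is_derive_minus; [|exact (is_derive_const _ y)].
replace (exp (y / 2) * weight_cos T y) with
  (RInt (fun t => Derive (fun u => cross_integrand T u t) y) 0 T).
2: { unfold weight_cos; rewrite <- RInt_mul.
     - apply RInt_congr; intros t; apply is_derive_unique, is_derive_cross.
     - apply cont_derivable; intros; auto_derive; easy. }
apply is_derive_RInt_param.
- apply filter_forall; intros u t _; eexists; apply is_derive_cross.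
- intros t _.
  apply continuity_2d_pt_ext with (fun u v => exp (u / 2) * (2 * (T - v) * cos (v * u))).
  { intros u v; symmetry; apply is_derive_unique, is_derive_cross. }
  apply continuity_2d_pt_mult.
  + apply (continuity_1d_2d_pt_comp exp (fun u v => u / 2)).
    * apply derivable_continuous, derivable_exp.
    * apply continuity_2d_pt_mult; [apply continuity_2d_pt_id1|apply continuity_2d_pt_const].
  + apply continuity_2d_pt_mult; [apply continuity_2d_pt_mult|].
    * apply continuity_2d_pt_const.
    * apply continuity_2d_pt_minus; [apply continuity_2d_pt_const|apply continuity_2d_pt_id2].
    * apply (continuity_1d_2d_pt_comp cos (fun u v => v * u)).
      -- apply continuity_cos.
      -- apply continuity_2d_pt_mult; [apply continuity_2d_pt_id2|apply continuity_2d_pt_id1].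
- apply filter_forall; intros u; apply cont_ex_RInt, cont_cross.
Qed.

Lemma cross_term_0 T : cross_term T 0 = 0.
Proof. unfold cross_term; ring. Qed.

(** Both sides have the numerator [1 - cos (T v)]; they differ by the bounded
    function [2 / v^2 - 1 / (1 - cos v)]. *)
Lemma weight_cos_fejer_err2 T v : (1 <= T)%nat -> 0 <= v <= PI ->
  Rabs (weight_cos (INR T) v - 2 * INR T * fejer_err2 T v) <= 3.
Proof.
intros HT Hv; pose proof (Defs.INR_pos T HT).
destruct (Req_dec v 0) as [->|Hv0].
{ rewrite weight_cos_0, fejer_err2_0 by easy.
  replace (INR T ^ 2 - 2 * INR T * (INR T / 2)) with 0 by field; rewrite Rabs_R0; lra. }
rewrite weight_cos_closed by easy.
pose proof (fejer_err2_kernel T v HT) as E.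
pose proof (one_minus_cos_ge v Hv) as Hl; pose proof (one_minus_cos_le v) as Hu.
pose proof (cos_upper4 v ltac:(lra)) as Hu4.
assert (Hv2 : 0 < v ^ 2) by (apply pow2_gt_0; easy).
assert (Hc : 0 < 1 - cos v) by lra.
replace (2 * INR T * fejer_err2 T v) with ((1 - cos (INR T * v)) / (1 - cos v))
  by (rewrite <- E; field; lra).
replace (2 * (1 - cos (INR T * v)) / v ^ 2 - (1 - cos (INR T * v)) / (1 - cos v)) with
  (- ((1 - cos (INR T * v)) * ((v ^ 2 - 2 * (1 - cos v)) / (v ^ 2 * (1 - cos v)))))
  by (field; lra).
rewrite Rabs_Ropp, Rabs_mult.
pose proof (COS_bound (INR T * v)).
rewrite (Rabs_pos_eq (1 - _)) by lra.
assert (Hfrac : 0 <= (v ^ 2 - 2 * (1 - cos v)) / (v ^ 2 * (1 - cos v)) <= 3 / 2).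
{ split.
  - apply Rdiv_le_0_compat; nra.
  - apply Rmult_le_reg_r with (v ^ 2 * (1 - cos v)); [nra|].
    unfold Rdiv at 1; rewrite Rmult_assoc, Rinv_l by nra.
    replace (v ^ 4) with (v ^ 2 * v ^ 2) in Hu4 by ring; nra. }
rewrite Rabs_pos_eq by easy; nra.
Qed.

Lemma is_derive_exp_half v : is_derive (fun u => exp (u / 2)) v (exp (v / 2) / 2).
Proof. auto_derive; [easy|]; unfold Rdiv; ring. Qed.

Lemma exp_half_minus1 v y : 0 <= v <= y -> 0 <= exp (v / 2) - 1 <= v / 2 * exp (y / 2).
Proof.
intros Hv.
pose proof (exp_ineq1_le (v / 2)); pose proof (exp_ineq1_le (- (v / 2))) as H1.
assert (H2 : exp (v / 2) <= exp (y / 2)) by (apply exp_le; lra).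
assert (H3 : exp (- (v / 2)) * exp (v / 2) = 1)
  by (rewrite <- exp_plus; replace (- (v / 2) + v / 2) with 0 by ring; apply exp_0).
pose proof (exp_pos (v / 2)).
split; [lra|].
apply Rle_trans with (v / 2 * exp (v / 2)); nra.
Qed.

Lemma mvt_abs (f f' g g' : R -> R) a b : a <= b ->
  (forall x, a <= x <= b -> is_derive f x (f' x)) ->
  (forall x, a <= x <= b -> is_derive g x (g' x)) ->
  (forall x, a <= x <= b -> Rabs (f' x) <= g' x) ->
  Rabs (f b - f a) <= g b - g a.
Proof.
intros Hab Hf Hg H.
assert (H1 : g a - f a <= g b - f b).
{ apply (mvt_nonneg (fun x => g x - f x) (fun x => g' x - f' x)); [easy|].
  intros x Hx; split; [apply @is_derive_minus; auto|].
  pose proof (Rle_abs (f' x)); specialize (H x Hx); lra. }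
assert (H2 : g a + f a <= g b + f b).
{ apply (mvt_nonneg (fun x => g x + f x) (fun x => g' x + f' x)); [easy|].
  intros x Hx; split; [apply @is_derive_plus; auto|].
  pose proof (Rle_abs (- f' x)); rewrite Rabs_Ropp in *; specialize (H x Hx); lra. }
apply Rabs_le; lra.
Qed.

(** Compare with the Fejer kernel: the derivative [e^(v/2) K(v)] of the cross
    term is [2 T] times [fejer_err2] up to [O(1)] and [(e^(v/2) - 1) K(v)],
    and the primitive [2 T fejer_err1] rises by [PI T - O(1/y)].  The value
    [PI] of the Dirichlet integral thus comes from [fejer_err1] at [0]. *)
Lemma cross_term_small T y : (1 <= T)%nat -> 0 < y <= PI ->
  Rabs (cross_term (INR T) y - PI * INR T) <=
  32 / y + 3 * y + exp (y / 2) * (2 * ln (4 + INR T ^ 2 * y ^ 2) - 2 * ln 4).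
Proof.
intros HT Hy; pose proof (Defs.INR_pos T HT).
assert (HT2 : 0 < INR T ^ 2) by (apply pow_lt; lra).
assert (H1 := mvt_abs
  (fun v => cross_term (INR T) v - 2 * INR T * fejer_err1 T v)
  (fun v => exp (v / 2) * weight_cos (INR T) v - 2 * INR T * fejer_err2 T v)
  (fun v => 3 * v + exp (y / 2) * (2 * ln (4 + INR T ^ 2 * v ^ 2)))
  (fun v => 3 + exp (y / 2) * (4 * INR T ^ 2 * v / (4 + INR T ^ 2 * v ^ 2)))
  0 y ltac:(lra)).
assert (Hpos : forall v, 0 < 4 + INR T ^ 2 * v ^ 2).
{ intros v; pose proof (pow2_ge_0 v); nra. }
cbv beta in H1.
rewrite cross_term_0, fejer_err1_0 in H1.
replace (4 + INR T ^ 2 * 0 ^ 2) with 4 in H1 by ring.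
assert (H2 := H1 ltac:(intros v Hv; apply @is_derive_minus;
  [apply is_derive_cross_term | apply is_derive_scal, is_derive_fejer_err1])); clear H1.
assert (H1 := H2 ltac:(intros v Hv; auto_derive;
  [ specialize (Hpos v); simpl in *; lra
  | field; specialize (Hpos v); simpl in *; lra ])); clear H2.
assert (H2 : forall v, 0 <= v <= y ->
  Rabs (exp (v / 2) * weight_cos (INR T) v - 2 * INR T * fejer_err2 T v) <=
  3 + exp (y / 2) * (4 * INR T ^ 2 * v / (4 + INR T ^ 2 * v ^ 2))).
{ intros v Hv.
  replace (_ - _) with ((weight_cos (INR T) v - 2 * INR T * fejer_err2 T v)
    + (exp (v / 2) - 1) * weight_cos (INR T) v) by ring.
  eapply Rle_trans; [apply Rabs_triang|].
  apply Rplus_le_compat; [apply weight_cos_fejer_err2; [easy|lra]|].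
  destruct (exp_half_minus1 v y Hv) as [Ha Hb].
  rewrite Rabs_pos_eq by (apply Rmult_le_pos; [lra|apply weight_cos_pos]).
  apply Rle_trans with ((v / 2 * exp (y / 2)) * (8 * INR T ^ 2 / (4 + INR T ^ 2 * v ^ 2))).
  - apply Rmult_le_compat; [lra|apply weight_cos_pos|lra|apply weight_cos_le_harmonic; lra].
  - right; field; specialize (Hpos v); lra. }
specialize (H1 H2); clear H2.
destruct (fejer_err1_bound T y HT Hy) as [Hr1 Hr2].
assert (Hr3 : 0 <= 2 * INR T * - fejer_err1 T y <= 32 / y).
{ split; [apply Rmult_le_pos; lra|].
  replace (32 / y) with (2 * INR T * (16 / (INR T * y))) by (field; lra).
  apply Rmult_le_compat_l; lra. }
apply Rabs_le_between in H1; apply Rabs_le; lra.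
Qed.

Lemma ln_4_T2 T y : 1 <= T -> 0 <= y <= PI ->
  2 * ln (4 + T ^ 2 * y ^ 2) - 2 * ln 4 <= 3 + 4 * ln T.
Proof.
intros HT Hy; pose proof PI_lt_3_2.
assert (Hy2 : 0 <= y ^ 2 <= 10.24) by nra.
assert (HT2 : 1 <= T ^ 2) by nra.
assert (H1 : ln (4 + T ^ 2 * y ^ 2) <= ln (4 * (4 * T ^ 2))) by (apply ln_le; nra).
rewrite ln_mult, ln_mult in H1 by nra.
replace (T ^ 2) with (T * T) in H1 at 2 by ring; rewrite ln_mult in H1 by lra.
assert (ln 4 <= 3 / 2).
{ rewrite <- (ln_exp (3/2)); apply ln_le; [lra|].
  replace (3 / 2) with (3/4+3/4) by field; rewrite exp_plus.
  assert (2 <= exp (3/4)); [|nra].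
  replace (3 / 4) with (3/8+3/8) by field; rewrite exp_plus.
  assert (1.4143 <= exp (3/8)); [|nra].
  replace (3 / 8) with (3/16+3/16) by field; rewrite exp_plus.
  pose proof (exp_ineq1_le (3/16)).
  assert (1.1893 <= exp (3/16)); [|nra].
  replace (3 / 16) with (3/32+3/32) by field; rewrite exp_plus.
  pose proof (exp_ineq1_le (3/32)); nra. }
lra.
Qed.

(** Beyond [PI] the derivative is at most [e^(v/2) / 2], so the bound at [PI]
    propagates. *)
Lemma cross_term_bound T y : (1 <= T)%nat -> 0 < y ->
  Rabs (cross_term (INR T) y - PI * INR T) <= 32 / y + exp (y / 2) * (24 + 4 * ln (INR T)).
Proof.
intros HT Hy; pose proof (Defs.INR_pos T HT) as HT1.
pose proof PI_lt_3_2; pose proof PI_RGT_0; pose proof PI2_3_2.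
assert (HlnT : 0 <= ln (INR T)) by now apply ln_nonneg.
assert (Hsmall : forall z, 0 < z <= PI -> Rabs (cross_term (INR T) z - PI * INR T) <=
   32 / z + exp (z / 2) * (13 + 4 * ln (INR T))).
{ intros z Hz; eapply Rle_trans; [apply cross_term_small; easy|].
  pose proof (ln_4_T2 (INR T) z HT1 ltac:(lra)).
  assert (1 <= exp (z / 2)) by (rewrite <- exp_0; apply exp_le; lra).
  nra. }
destruct (Rle_dec y PI) as [Hle|Hgt].
{ eapply Rle_trans; [apply Hsmall; lra|]; pose proof (exp_pos (y / 2)); nra. }
pose proof (Hsmall PI ltac:(lra)) as HPI.
assert (Hinc := mvt_abs (cross_term (INR T)) (fun v => exp (v / 2) * weight_cos (INR T) v)
  (fun v => exp (v / 2)) (fun v => exp (v / 2) / 2) PI y ltac:(lra)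
  ltac:(intros; apply is_derive_cross_term) ltac:(intros; apply is_derive_exp_half)).
assert (Hstep : Rabs (cross_term (INR T) y - cross_term (INR T) PI) <= exp (y / 2) - exp (PI / 2)).
{ apply Hinc; intros v Hv; pose proof (exp_pos (v / 2)).
  rewrite Rabs_pos_eq by (apply Rmult_le_pos; [lra|apply weight_cos_pos]).
  apply Rmult_le_compat_l; [lra|].
  eapply Rle_trans; [apply weight_cos_le_inv; lra|].
  apply Rmult_le_reg_r with (v ^ 2); [apply pow_lt; lra|].
  replace (4 / v ^ 2 * v ^ 2) with 4 by (field; lra); nra. }
assert (He : exp (PI / 2) <= exp (y / 2)) by (apply exp_le; lra).
assert (1 <= exp (PI / 2)) by (rewrite <- exp_0; apply exp_le; lra).
assert (H32 : 32 / PI <= 32 / 3).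
{ apply Rmult_le_compat_l; [lra|]; apply Rinv_le_contravar; lra. }
assert (0 < 32 / y) by (apply Rdiv_lt_0_compat; lra).
replace (cross_term (INR T) y - PI * INR T) with
  ((cross_term (INR T) y - cross_term (INR T) PI) + (cross_term (INR T) PI - PI * INR T)) by ring.
eapply Rle_trans; [apply Rabs_triang|].
assert (4 * ln (INR T) * exp (PI / 2) <= 4 * ln (INR T) * exp (y / 2)) by nra.
nra.
Qed.

(** * The quadratic form of the Dirichlet polynomial *)

Lemma cos_lipschitz a b : Rabs (cos a - cos b) <= Rabs (a - b).
Proof.
assert (H : forall a b, a <= b -> Rabs (cos b - cos a) <= b - a).
{ intros u v Huv.
  apply (mvt_abs cos (fun x => - sin x) (fun x => x) (fun _ => 1)); [easy| | |].
  - intros; apply is_derive_cos.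
  - intros; apply @is_derive_id.
  - intros; rewrite Rabs_Ropp; apply Rabs_le, SIN_bound. }
destruct (Rle_dec a b) as [Hab|Hab].
- rewrite Rabs_minus_sym, (Rabs_minus_sym a), (Rabs_pos_eq (b - a)) by lra; auto.
- rewrite (Rabs_pos_eq (a - b)) by lra; apply H; lra.
Qed.

(** With [u = e^-x = m/n] and [w = 1 - u], one has [w <= x <= w/u].  Replacing
    [e^(x/2)/x^2] by [1/w^2] costs [O(1/(w u))].  For the cosines, [|cos (T x)
    - cos (T w)|] is at most both [2] and [T (x - w)]; their geometric mean
    yields the factor [sqrt T] and keeps the bound summable over all [m < n].
    *)
Lemma weight_cos_linearize T x : 1 <= T -> 0 < x ->
  Rabs (exp (x / 2) * weight_cos T x - weight_cos T (1 - exp (- x)))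
  <= 11 * sqrt T / ((1 - exp (- x)) * exp (- x)).
Proof.
intros HT Hx.
set (u := exp (- x)); set (w := 1 - u); set (E := exp (x / 2)).
assert (Hu0 : 0 < u) by apply exp_pos.
assert (Hu1 : u < 1) by (unfold u; rewrite <- exp_0; apply exp_increasing; lra).
assert (Hw0 : 0 < w < 1) by (unfold w; lra).
assert (Hwx : w <= x) by (unfold w, u; pose proof (exp_ineq1_le (- x)); lra).
assert (Hexu : exp x * u = 1) by (unfold u; rewrite <- exp_plus, Rplus_opp_r; apply exp_0).
assert (Hxw : x * u <= w) by (unfold w; pose proof (exp_ineq1_le x); nra).
assert (HE1 : 1 <= E) by (unfold E; rewrite <- exp_0; apply exp_le; lra).
assert (HEu : E * u <= 1).
{ rewrite <- Hexu; apply Rmult_le_compat_r; [lra|]; apply exp_le; lra. }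
rewrite !weight_cos_closed by lra.
pose proof (COS_bound (T * x)) as Hc1.
pose proof (COS_bound (T * w)) as Hc2.
pose proof (cos_lipschitz (T * w) (T * x)) as Hl.
(* The difference of the two kernels is [2 (1 - c1) (E/x^2 - 1/w^2) + 2 (c2 -
   c1) / w^2]. *)
set (c1 := cos (T * x)) in *; set (c2 := cos (T * w)) in *.
assert (Hsq : sqrt T * sqrt T = T) by (apply sqrt_sqrt; lra).
assert (Hs1 : 1 <= sqrt T) by (rewrite <- sqrt_1; apply sqrt_le_1_alt; lra).
assert (HA : Rabs (E / x ^ 2 - / w ^ 2) <= 2 / (w * u)).
{ assert (Hx2 : 0 < x ^ 2) by (apply pow_lt; lra).
  assert (Hw2 : 0 < w ^ 2) by (apply pow_lt; lra).
  assert (Hup : E / x ^ 2 <= / (u * w ^ 2)).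
  { replace (E / x ^ 2) with ((E * u) * / (u * x ^ 2)) by (field; lra).
    rewrite <- (Rmult_1_l (/ (u * w ^ 2))).
    apply Rmult_le_compat; [nra| |lra|].
    - left; apply Rinv_0_lt_compat; nra.
    - apply Rinv_le_contravar; [nra|]; apply Rmult_le_compat_l; [lra|].
      apply pow_incr; lra. }
  assert (Hlo : u ^ 2 / w ^ 2 <= E / x ^ 2).
  { apply Rmult_le_reg_r with (w ^ 2 * x ^ 2); [nra|].
    replace (u ^ 2 / w ^ 2 * (w ^ 2 * x ^ 2)) with ((x * u) ^ 2) by (field; lra).
    replace (E / x ^ 2 * (w ^ 2 * x ^ 2)) with (E * w ^ 2) by (field; lra).
    apply Rle_trans with (w ^ 2); [apply pow_incr; nra|nra]. }
  assert (Hup2 : / (u * w ^ 2) - / w ^ 2 = / (w * u)).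
  { unfold w; field; unfold w in *; split; lra. }
  assert (Hlo2 : / w ^ 2 - u ^ 2 / w ^ 2 <= 2 / (w * u)).
  { replace (/ w ^ 2 - u ^ 2 / w ^ 2) with ((1 + u) * / w)
      by (unfold w; field; unfold w in *; lra).
    replace (2 / (w * u)) with (2 * / u * / w) by (field; lra).
    apply Rmult_le_compat_r; [left; apply Rinv_0_lt_compat; lra|].
    apply Rmult_le_reg_r with u; [easy|]; replace (2 * / u * u) with 2 by (field; lra); nra. }
  assert (0 < / (w * u)) by (apply Rinv_0_lt_compat; nra).
  unfold Rdiv at 2; apply Rabs_le; unfold Rdiv in Hlo2 at 2; lra. }
assert (HB : Rabs (c2 - c1) <= 3 / 2 * sqrt T * (w / u)).
{ assert (Hwu : 0 < w / u) by (apply Rdiv_lt_0_compat; lra).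
  apply Rsqr_incr_0_var; [|nra]; rewrite <- Rsqr_abs.
  replace (T * w - T * x) with (- (T * (x - w))) in Hl by ring.
  rewrite Rabs_Ropp, (Rabs_pos_eq (T * _)) in Hl by nra.
  assert (H2 : Rabs (c2 - c1) <= 2) by (apply Rabs_le; lra).
  apply Rle_trans with (2 * (T * (x - w))).
  - rewrite (Rsqr_abs (c2 - c1)); unfold Rsqr.
    apply Rmult_le_compat; try apply Rabs_pos; easy.
  - assert (Hxw2 : x - w <= w * (w / u)).
    { apply Rmult_le_reg_r with u; [easy|].
      replace (w * (w / u) * u) with (w * w) by (field; lra); unfold w in *; nra. }
    assert (Hww : w <= w / u).
    { apply Rmult_le_reg_r with u; [easy|].
      replace (w / u * u) with w by (field; lra); nra. }
    unfold Rsqr.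
    replace (3 / 2 * sqrt T * (w / u) * (3 / 2 * sqrt T * (w / u)))
      with (9 / 4 * (sqrt T * sqrt T) * ((w / u) * (w / u))) by (field; lra).
    rewrite Hsq.
    assert (x - w <= w / u * (w / u)) by nra.
    assert (0 <= T * (w / u * (w / u) - (x - w))) by (apply Rmult_le_pos; lra).
    assert (0 <= T * (w / u * (w / u))) by (apply Rmult_le_pos; nra).
    nra. }
replace (E * (2 * (1 - c1) / x ^ 2) - 2 * (1 - c2) / w ^ 2) with
  (2 * (1 - c1) * (E / x ^ 2 - / w ^ 2) + 2 * / w ^ 2 * (c2 - c1))
  by (field; lra).
eapply Rle_trans; [apply Rabs_triang|].
rewrite !Rabs_mult, (Rabs_pos_eq 2), (Rabs_pos_eq (1 - c1)), (Rabs_pos_eq (/ w ^ 2))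
  by (try (left; apply Rinv_0_lt_compat, pow_lt); lra).
assert (Hwu : 0 < / (w * u)) by (apply Rinv_0_lt_compat; nra).
apply Rle_trans with (8 * / (w * u) + 3 * sqrt T * / (w * u)).
- apply Rplus_le_compat.
  + apply Rle_trans with (4 * (2 / (w * u))); [|right; unfold Rdiv; ring].
    apply Rmult_le_compat; [lra|apply Rabs_pos|lra|easy].
  + apply Rle_trans with (2 * / w ^ 2 * (3 / 2 * sqrt T * (w / u))).
    * apply Rmult_le_compat_l; [|easy].
      assert (0 < / w ^ 2) by (apply Rinv_0_lt_compat, pow_lt; lra); lra.
    * right; field; lra.
- unfold Rdiv; nra.
Qed.

Definition lnat (n : nat) : R := ln (INR n).

Lemma exp_lnat n : (1 <= n)%nat -> exp (lnat n) = INR n.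
Proof. intros Hn; apply exp_ln; pose proof (Defs.INR_pos n Hn); lra. Qed.

(** The coefficient of the pair [(n, m)] after integrating [|sum_n
    n^(-1/2-it)|^2] against the weight. *)
Definition gram (T : R) (n m : nat) : R :=
  exp (- (lnat n + lnat m) / 2) * weight_cos T (lnat n - lnat m).

Lemma gram_sym T n m : gram T n m = gram T m n.
Proof.
unfold gram; f_equal; [f_equal; f_equal; ring|].
rewrite <- weight_cos_sym; f_equal; ring.
Qed.

Lemma gram_diag T n : (1 <= n)%nat -> gram T n n = T ^ 2 / INR n.
Proof.
intros Hn; unfold gram; rewrite Rminus_diag, weight_cos_0.
replace (- (lnat n + lnat n) / 2) with (- lnat n) by field.
rewrite exp_Ropp, exp_lnat by easy; unfold Rdiv; ring.
Qed.

Lemma harm_nonneg_mono n N : (n <= N)%nat -> 0 <= harm n <= harm N.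
Proof.
intros H; split.
- apply psum_nonneg; intros k Hk; left; apply Rinv_0_lt_compat.
  pose proof (Defs.INR_pos k ltac:(lia)); lra.
- induction H as [|N H IH]; [lra|]; rewrite harm_S.
  assert (0 < / (INR N + 1)) by (apply Rinv_0_lt_compat; pose proof (pos_INR N); lra); lra.
Qed.

Lemma gram_linearize (T : R) n m : 1 <= T -> (1 <= m)%nat -> (m < n)%nat ->
  Rabs (gram T n m - / INR n * weight_cos T (INR (n - m) / INR n)) <=
  11 * sqrt T * (/ INR m + / INR (n - m)).
Proof.
intros HT Hm Hn.
pose proof (Defs.INR_pos m Hm) as Hm1; pose proof (Defs.INR_pos n ltac:(lia)) as Hn1.
pose proof (Defs.INR_pos (n - m) ltac:(lia)) as Hnm1.
assert (Hx : 0 < lnat n - lnat m).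
{ pose proof (ln_increasing (INR m) (INR n) ltac:(lra) ltac:(now apply lt_INR)).
  unfold lnat; lra. }
pose proof (weight_cos_linearize T _ HT Hx) as H.
assert (Eu : exp (- (lnat n - lnat m)) = INR m / INR n).
{ replace (- (lnat n - lnat m)) with (lnat m + - lnat n) by ring.
  rewrite exp_plus, exp_Ropp, !exp_lnat by lia; easy. }
rewrite Eu in H.
rewrite minus_INR in * by lia.
replace (1 - INR m / INR n) with ((INR n - INR m) / INR n) in H by (field; lra).
unfold gram.
replace (- (lnat n + lnat m) / 2) with (- lnat n + (lnat n - lnat m) / 2) by field.
rewrite exp_plus, exp_Ropp, exp_lnat by lia.
replace (_ - _) with (/ INR n * (exp ((lnat n - lnat m) / 2) * weight_cos T (lnat n - lnat m)
  - weight_cos T ((INR n - INR m) / INR n))) by ring.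
rewrite Rabs_mult, Rabs_pos_eq by (left; apply Rinv_0_lt_compat; lra).
eapply Rle_trans; [apply Rmult_le_compat_l; [left; apply Rinv_0_lt_compat; lra|exact H]|].
right; field; lra.
Qed.

(** Below the diagonal, linearize, reverse the order of summation to [h = n -
    m], and insert the Fejer weights [1 - h/n]; the last step costs [sum_h
    (h/n^2) (4 n^2/h^2)]. *)
Lemma gram_row (T : R) n : 1 <= T -> (1 <= n)%nat ->
  Rabs (psum (gram T n) (n - 1) - 2 * INR n * fejer n (T / INR n)) <=
  (22 * sqrt T + 4) * harm (n - 1).
Proof.
intros HT Hn; pose proof (Defs.INR_pos n Hn) as Hn1.
set (g h := / INR n * weight_cos T (INR h / INR n)).
assert (H1 : Rabs (psum (gram T n) (n - 1) - psum g (n - 1)) <= 22 * sqrt T * harm (n - 1)).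
{ rewrite <- (psum_rev g).
  replace (22 * sqrt T * harm (n - 1)) with
    (psum (fun m => 11 * sqrt T * (/ INR m + / INR (S (n - 1) - m))) (n - 1)).
  2: { rewrite psum_scal, psum_plus, (psum_rev (fun k => / INR k)); unfold harm; ring. }
  apply psum_dist; intros m Hm; unfold g.
  replace (S (n - 1) - m)%nat with (n - m)%nat by lia.
  apply gram_linearize; [easy|lia|lia]. }
assert (H2 : Rabs (psum g (n - 1) - 2 * INR n * fejer n (T / INR n)) <= 4 * harm (n - 1)).
{ unfold fejer, harm; rewrite <- !psum_scal; apply psum_dist; intros h Hh.
  pose proof (Defs.INR_pos h ltac:(lia)).
  replace (2 * INR n * ((1 - INR h / INR n) * (1 - cos (INR h * (T / INR n))) / INR h ^ 2))
    with ((1 - INR h / INR n) * g h).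
  2: { unfold g; rewrite weight_cos_closed.
       - replace (T * (INR h / INR n)) with (INR h * (T / INR n)) by (unfold Rdiv; ring).
         field; lra.
       - assert (0 < INR h / INR n) by (apply Rdiv_lt_0_compat; lra); lra. }
  replace (g h - (1 - INR h / INR n) * g h) with (INR h / INR n ^ 2 * weight_cos T (INR h / INR n))
    by (unfold g; field; lra).
  assert (0 < INR h / INR n) by (apply Rdiv_lt_0_compat; lra).
  assert (0 < INR h / INR n ^ 2) by (apply Rdiv_lt_0_compat; [lra|apply pow_lt; lra]).
  rewrite Rabs_pos_eq by (apply Rmult_le_pos; [lra|apply weight_cos_pos]).
  eapply Rle_trans; [apply Rmult_le_compat_l; [lra|apply weight_cos_le_inv; lra]|].
  right; field; lra. }
replace (_ - _) with ((psum (gram T n) (n - 1) - psum g (n - 1)) +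
  (psum g (n - 1) - 2 * INR n * fejer n (T / INR n))) by ring.
eapply Rle_trans; [apply Rabs_triang|]; lra.
Qed.

(** [fejer_poisson] at [th = T/n], multiplied by [2 n]: the quadratic term of
    the series absorbs the diagonal [T^2/n]. *)
Lemma gram_row_divisors (T N n : nat) : (1 <= T)%nat -> (1 <= n <= N)%nat ->
  Rabs (gram (INR T) n n + 2 * psum (gram (INR T) n) (n - 1)
    - (2 * PI * INR T
       + 8 * PI ^ 2 * psum (fun k => Rmax 0 (INR T / (2 * PI) - INR n * INR k)) T))
  <= 136 * sqrt (INR T) * (1 + ln (INR N)).
Proof.
intros HT Hn; pose proof (Defs.INR_pos T HT) as HT1; pose proof (Defs.INR_pos n ltac:(lia)) as Hn1.
pose proof PI_RGT_0; pose proof PI2_3_2.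
set (th := INR T / INR n).
assert (Hth : 0 <= th) by (apply Rdiv_le_0_compat; lra).
assert (HthT : th <= 2 * PI * INR T).
{ apply Rmult_le_reg_r with (INR n); [lra|]; unfold th.
  replace (INR T / INR n * INR n) with (INR T) by (field; lra).
  assert (INR T <= 2 * PI * INR T) by nra.
  assert (0 <= 2 * PI * INR T * (INR n - 1)) by (apply Rmult_le_pos; nra); lra. }
pose proof (gram_row (INR T) n HT1 ltac:(lia)) as H1; fold th in H1.
pose proof (fejer_poisson n T th ltac:(lia) Hth HthT) as H2.
assert (H3 : Rabs (INR T ^ 2 / INR n + 4 * INR n * fejer n th -
   (2 * PI * INR T
       + 8 * PI ^ 2 * psum (fun k => Rmax 0 (INR T / (2 * PI) - INR n * INR k)) T))
   <= 84 * (1 + ln (INR n))).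
{ replace (84 * (1 + ln (INR n))) with (2 * INR n * (42 * (1 + ln (INR n)) / INR n))
    by (field; lra).
  eapply Rle_trans; [|apply Rmult_le_compat_l; [lra|exact H2]].
  rewrite <- (Rabs_pos_eq (2 * INR n)) at 1 by lra; rewrite <- Rabs_mult.
  right; f_equal.
  rewrite (psum_ext (fun k => Rmax 0 (th - 2 * PI * INR k))
    (fun k => 2 * PI / INR n * Rmax 0 (INR T / (2 * PI) - INR n * INR k))).
  - rewrite psum_scal; unfold th; field; lra.
  - intros k _.
    assert (0 < 2 * PI / INR n) by (apply Rdiv_lt_0_compat; lra).
    rewrite <- RmaxRmult by lra; f_equal; [ring|unfold th; field; lra]. }
rewrite gram_diag by lia.
assert (Hln : ln (INR n) <= ln (INR N)) by (apply ln_le; [lra|apply le_INR; lia]).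
assert (Hh : 0 <= harm (n - 1) <= 1 + ln (INR N)).
{ pose proof (harm_nonneg_mono (n - 1) N ltac:(lia)).
  pose proof (harm_le N ltac:(lia)); lra. }
assert (Hs1 : 1 <= sqrt (INR T)) by (rewrite <- sqrt_1; apply sqrt_le_1_alt; lra).
assert (H4 : (22 * sqrt (INR T) + 4) * harm (n - 1) <= (22 * sqrt (INR T) + 4) * (1 + ln (INR N)))
  by (apply Rmult_le_compat_l; lra).
apply Rabs_le_between in H1, H3; apply Rabs_le; nra.
Qed.

Lemma gram_total (T N : nat) : (1 <= T)%nat -> (1 <= N)%nat ->
  Rabs (psum (fun n => psum (gram (INR T) n) N) N
    - (2 * PI * INR T * INR N
       + 8 * PI ^ 2 * divisor_sum N T (INR T / (2 * PI))))
  <= 136 * sqrt (INR T) * (INR N * (1 + ln (INR N))).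
Proof.
intros HT HN.
rewrite (psum_symmetric (gram (INR T))) by (intros; apply gram_sym).
replace (2 * PI * INR T * INR N + _) with
  (psum (fun n => 2 * PI * INR T
       + 8 * PI ^ 2 * psum (fun k => Rmax 0 (INR T / (2 * PI) - INR n * INR k)) T) N)
  by (rewrite psum_plus, psum_const, psum_scal; unfold divisor_sum; ring).
replace (136 * sqrt (INR T) * (INR N * (1 + ln (INR N)))) with
  (psum (fun _ => 136 * sqrt (INR T) * (1 + ln (INR N))) N)
  by (rewrite psum_const; ring).
apply psum_dist; intros n Hn; now apply gram_row_divisors.
Qed.

Lemma psum_inv_sqrt N : (1 <= N)%nat ->
  psum (fun n => exp ((lnat N - lnat n) / 2)) N <= 2 * INR N.
Proof.
intros HN.
assert (H : forall n, (1 <= n)%nat -> psum (fun k => exp (- lnat k / 2)) n <= 2 * exp (lnat n / 2)).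
{ intros n Hn; induction Hn as [|n Hn IH].
  - simpl; unfold lnat; simpl; rewrite ln_1.
    replace (- 0 / 2) with 0 by field; replace (0 / 2) with 0 by field; rewrite exp_0; lra.
  - change (psum (fun k => exp (- lnat k / 2)) n + exp (- lnat (S n) / 2)
      <= 2 * exp (lnat (S n) / 2)).
    pose proof (Defs.INR_pos n Hn).
    set (a := exp (lnat n / 2)) in *; set (b := exp (lnat (S n) / 2)).
    assert (Ha : a * a = INR n).
    { unfold a; rewrite <- exp_plus, <- exp_lnat by lia; f_equal; field. }
    assert (Hb : b * b = INR n + 1).
    { unfold b; rewrite <- exp_plus, <- S_INR, <- exp_lnat by lia; f_equal; field. }
    assert (0 < a) by apply exp_pos; assert (0 < b) by apply exp_pos.
    replace (exp (- lnat (S n) / 2)) with (/ b)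
      by (unfold b; rewrite <- exp_Ropp; f_equal; field).
    assert (/ b <= 2 * (b - a)); [|lra].
    assert (a <= b) by nra.
    apply Rmult_le_reg_l with b; [easy|]; rewrite Rinv_r by lra; nra. }
rewrite (psum_ext _ (fun n => exp (lnat N / 2) * exp (- lnat n / 2)))
  by (intros; rewrite <- exp_plus; f_equal; field).
rewrite psum_scal.
replace (2 * INR N) with (exp (lnat N / 2) * (2 * exp (lnat N / 2))).
- apply Rmult_le_compat_l; [left; apply exp_pos|now apply H].
- rewrite <- (exp_lnat N) by easy; replace (lnat N) with (lnat N / 2 + lnat N / 2) at 3 by field.
  rewrite exp_plus; ring.
Qed.

(** The terms are [PI T] up to [32/y] with [y = ln (N/n) >= (N - n)/N], and up
    to multiples of [sqrt (N/n)]; both sum to [O(N ln N)].  The term [n = N],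
    where [y = 0], is treated apart. *)
Lemma cross_total (T N : nat) : (1 <= T)%nat -> (T <= N)%nat ->
  Rabs (psum (fun n => cross_term (INR T) (lnat N - lnat n)) N - PI * INR T * INR N)
  <= 84 * (INR N * (1 + ln (INR N))).
Proof.
intros HT HN; pose proof (Defs.INR_pos T HT) as HT1; pose proof (Defs.INR_pos N ltac:(lia)) as HN1.
pose proof PI_RGT_0; pose proof PI_lt_3_2.
assert (HTN : INR T <= INR N) by now apply le_INR.
assert (Hln : 0 <= ln (INR T) <= ln (INR N)) by (split; [now apply ln_nonneg|apply ln_le; lra]).
destruct N as [|M]; [lia|].
set (N := S M) in *.
change (psum (fun n => cross_term (INR T) (lnat N - lnat n)) N) with
  (psum (fun n => cross_term (INR T) (lnat N - lnat n)) M + cross_term (INR T) (lnat N - lnat N)).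
rewrite Rminus_diag, cross_term_0.
assert (H1 : Rabs (psum (fun n => cross_term (INR T) (lnat N - lnat n)) M - psum (fun _ => PI * INR T) M)
  <= psum (fun n => 32 * INR N * / INR (N - n)
       + (24 + 4 * ln (INR T)) * exp ((lnat N - lnat n) / 2)) M).
{ apply psum_dist; intros n Hn.
  pose proof (Defs.INR_pos n ltac:(lia)) as Hn1; pose proof (Defs.INR_pos (N - n) ltac:(unfold N; lia)) as Hnn.
  assert (Hge : INR (N - n) / INR N <= lnat N - lnat n).
  { rewrite minus_INR by (unfold N; lia); unfold lnat; rewrite <- ln_div by lra.
    replace ((INR N - INR n) / INR N) with (1 - / (INR N / INR n)) by (field; lra).
    apply ln_ge_1minus, Rdiv_lt_0_compat; lra. }
  assert (Hq : 0 < INR (N - n) / INR N) by (apply Rdiv_lt_0_compat; lra).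
  eapply Rle_trans; [apply cross_term_bound; [easy|lra]|].
  apply Rplus_le_compat; [|lra].
  replace (32 * INR N * / INR (N - n)) with (32 / (INR (N - n) / INR N)) by (field; lra).
  apply Rmult_le_compat_l; [lra|]; apply Rinv_le_contravar; lra. }
rewrite psum_const, psum_plus, !psum_scal in H1.
unfold N in H1 at 3; rewrite (psum_rev (fun k => / INR k) M) in H1.
fold (harm M) in H1.
assert (H2 : harm M <= 1 + ln (INR N)).
{ pose proof (harm_nonneg_mono M N ltac:(unfold N; lia)).
  pose proof (harm_le N ltac:(unfold N; lia)); lra. }
assert (H3 : psum (fun n => exp ((lnat N - lnat n) / 2)) M <= 2 * INR N).
{ eapply Rle_trans; [|apply psum_inv_sqrt; unfold N; lia].
  unfold N at 2; simpl psum; pose proof (exp_pos ((lnat N - lnat N) / 2)); unfold N in *; lra. }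
assert (HM : INR M = INR N - 1) by (unfold N; rewrite S_INR; ring).
rewrite HM in H1.
assert (H4 : 32 * INR N * harm M <= 32 * INR N * (1 + ln (INR N)))
  by (apply Rmult_le_compat_l; lra).
assert (H5 : (24 + 4 * ln (INR T)) * psum (fun n => exp ((lnat N - lnat n) / 2)) M
   <= (24 + 4 * ln (INR T)) * (2 * INR N)) by (apply Rmult_le_compat_l; lra).
assert (H6 : 0 <= PI * INR T <= 3.2 * INR N) by nra.
assert (H7 : ln (INR T) * INR N <= ln (INR N) * INR N) by nra.
assert (H8 : 0 <= ln (INR N) * INR N) by nra.
apply Rabs_le_between in H1; apply Rabs_le; lra.
Qed.

(** The weighted mean square of [zeta_approx] at height [N], as shown in
    [RInt_zeta_approx]. *)
Definition truncated_moment (T N : nat) : R :=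
  psum (fun n => psum (gram (INR T) n) N) N
  - 2 * psum (fun n => cross_term (INR T) (lnat N - lnat n)) N.

(** The contributions [2 PI T N] of the double sum and of the cross terms
    cancel. *)
Lemma truncated_moment_divisors (T N : nat) : (1 <= T)%nat -> (T <= N)%nat ->
  Rabs (truncated_moment T N - 8 * PI ^ 2 * divisor_sum N T (INR T / (2 * PI)))
  <= 304 * sqrt (INR T) * (INR N * (1 + ln (INR N))).
Proof.
intros HT HN; unfold truncated_moment; pose proof (Defs.INR_pos T HT) as HT1.
pose proof (gram_total T N HT ltac:(lia)) as H1.
pose proof (cross_total T N HT HN) as H2.
assert (Hs1 : 1 <= sqrt (INR T)) by (rewrite <- sqrt_1; apply sqrt_le_1_alt; lra).
pose proof (ln_nonneg (INR N) (Defs.INR_pos N ltac:(lia))); pose proof (Defs.INR_pos N ltac:(lia)).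
assert (0 <= INR N * (1 + ln (INR N))) by nra.
apply Rabs_le_between in H1, H2; apply Rabs_le; nra.
Qed.

(** * Approximation of zeta on the critical line *)

Definition crit (t : R) : C := (1 / 2, t).

Lemma Re_crit t : Re (crit t) = 1 / 2.
Proof. easy. Qed.

Lemma crit_neq_1 t : crit t <> 1.
Proof. intros H; apply (f_equal Re) in H; simpl in H; lra. Qed.

(** On [[n, n + 1]] its increment is the error of the trapezoidal rule for
    [x^-s]. *)
Definition trapezoid (s : C) (n x : R) : C :=
  ((RtoC x - RtoC n) * / 2 * (Rcpow n (- s) + Rcpow x (- s))
   - RtoC x * Rcpow x (- s) / (1 - s))%C.
Definition trapezoid1 (s : C) (n x : R) : C :=
  (/ 2 * (Rcpow n (- s) - Rcpow x (- s))
   - / 2 * (s * (RtoC x - RtoC n) * Rcpow x (- s) / RtoC x))%C.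

Lemma C2_neq0 : RtoC 2 <> 0.
Proof. apply RtoC_neq0; lra. Qed.

Lemma cder_trapezoid (s : C) n x : s <> 1 -> 0 < x -> cder (trapezoid s n) x (trapezoid1 s n x).
Proof.
intros Hs Hx; pose proof (one_minus_neq0 s Hs); pose proof (RtoC_neq0 x Hx).
pose proof C2_neq0.
eapply cder_eq.
- unfold trapezoid; apply cder_minus.
  + apply cder_mult.
    * apply cder_mult; [apply cder_minus; [apply cder_id|apply cder_const]|apply cder_const].
    * apply cder_plus; [apply cder_const|now apply cder_Rcpow].
  + unfold Cdiv; apply cder_mult; [|apply cder_const].
    apply cder_mult; [apply cder_id|now apply cder_Rcpow].
- unfold trapezoid1; simpl; field; auto.
Qed.

Lemma cder_inv x : 0 < x -> cder (fun u => / RtoC u)%C x (- (/ RtoC x * / RtoC x))%C.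
Proof.
intros Hx; pose proof (RtoC_neq0 x Hx).
assert (Hl : locally x (fun u => 0 < u)).
{ exists (mkposreal x Hx); intros u Hu.
  change (Rabs (u - x) < x) in Hu; apply Rabs_def2 in Hu; lra. }
assert (Hd : is_derive (fun u => / u) x (- (/ x * / x))).
{ auto_derive; [lra|field; lra]. }
assert (HR : cder (fun u => RtoC (/ u)) x (RtoC (- (/ x * / x)))) by now apply cder_real.
destruct HR as [H1 H2].
replace (- (/ RtoC x * / RtoC x))%C with (RtoC (- (/ x * / x)))
  by (rewrite RtoC_opp, RtoC_mult, RtoC_inv by lra; easy).
split; (eapply is_derive_ext_loc; [|eassumption]);
  (eapply filter_imp; [|exact Hl]); intros u Hu; cbv beta;
  rewrite RtoC_inv by lra; easy.
Qed.

Lemma cder_trapezoid1 (s : C) n x : 0 < x ->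
  cder (trapezoid1 s n) x
    (/ 2 * (s * (s + 1)) * ((RtoC x - RtoC n) * Rcpow x (- s) / RtoC x / RtoC x))%C.
Proof.
intros Hx; pose proof (RtoC_neq0 x Hx); pose proof C2_neq0.
eapply cder_eq.
- unfold trapezoid1; apply cder_minus.
  + apply cder_mult; [apply cder_const|].
    apply cder_minus; [apply cder_const|now apply cder_Rcpow].
  + apply cder_mult; [apply cder_const|].
    unfold Cdiv; apply cder_mult; [|now apply cder_inv].
    apply cder_mult; [|now apply cder_Rcpow].
    apply cder_mult; [apply cder_const|].
    apply cder_minus; [apply cder_id|apply cder_const].
- simpl; field; auto.
Qed.

(** The derivative vanishes at [n], and its own derivative is [O(|s| |s+1|
    n^(-5/2))]. *)
Lemma trapezoid1_bound t n x : 1 <= n -> n <= x <= n + 1 ->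
  Cmod (trapezoid1 (crit t) n x) <=
  3 * (Cmod (crit t) * Cmod (crit t + 1)) * (exp (- (3 / 2) * ln x) / x).
Proof.
intros Hn Hx; set (s := crit t).
set (A := Cmod s * Cmod (s + 1)).
assert (HA : 0 <= A) by (apply Rmult_le_pos; apply Cmod_ge_0).
set (M := A / 2 * exp (- (5 / 2) * ln n)).
assert (H1 : Cmod (trapezoid1 s n x - trapezoid1 s n n) <= M * x - M * n).
{ apply (cder_incr (trapezoid1 s n) (fun x => / 2 * (s * (s + 1)) *
    ((RtoC x - RtoC n) * Rcpow x (- s) / RtoC x / RtoC x))%C
    (fun u => M * u) (fun _ => M)); [lra| | |].
  - intros u Hu; apply cder_trapezoid1; lra.
  - intros u Hu; auto_derive; [easy|ring].
  - intros u Hu.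
    assert (Hu0 : RtoC u <> 0) by (apply RtoC_neq0; lra).
    rewrite !Cmod_mult, Cmod_inv by apply C2_neq0.
    unfold Cdiv at 1; rewrite Cmod_mult, Cmod_inv by easy.
    rewrite !Cmod_R, (Rabs_pos_eq 2), (Rabs_pos_eq u) by lra.
    fold A.
    pose proof (Cmod_kernel s n u ltac:(lra) ltac:(lra)) as Hk.
    unfold s in Hk; rewrite Re_crit in Hk; fold s in Hk.
    replace M with (/ 2 * A * exp (- (5 / 2) * ln n)) by (unfold M; field).
    apply Rmult_le_compat_l; [lra|].
    apply Rle_trans with (exp (- (1 / 2) * ln u) / u * / u).
    + apply Rmult_le_compat_r; [left; apply Rinv_0_lt_compat; lra|exact Hk].
    + replace (exp (- (1 / 2) * ln u) / u * / u) with (exp (- (5 / 2) * ln u)).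
      * apply exp_le; assert (ln n <= ln u) by (apply ln_le; lra); lra.
      * replace (/ u) with (exp (- ln u)) by (rewrite exp_Ropp, exp_ln by lra; easy).
        unfold Rdiv; replace (/ u) with (exp (- ln u)) by (rewrite exp_Ropp, exp_ln by lra; easy).
        rewrite <- !exp_plus; f_equal; field. }
replace (trapezoid1 s n n) with (RtoC 0) in H1.
2: { unfold trapezoid1, Cdiv; ring. }
replace (trapezoid1 s n x - 0)%C with (trapezoid1 s n x) in H1 by ring.
assert (HM : 0 <= M) by (unfold M; pose proof (exp_pos (- (5 / 2) * ln n)); nra).
apply Rle_trans with M; [nra|].
unfold M; replace (exp (- (3 / 2) * ln x) / x) with (exp (- (5 / 2) * ln x)).
2: { unfold Rdiv; replace (/ x) with (exp (- ln x)) by (rewrite exp_Ropp, exp_ln by lra; easy).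
     rewrite <- exp_plus; f_equal; field. }
assert (H6 : exp (- (5 / 2) * ln n) <= 6 * exp (- (5 / 2) * ln x)).
{ assert (Hln : ln x <= ln n + ln 2) by (rewrite <- ln_mult by lra; apply ln_le; lra).
  apply Rle_trans with (exp (5 / 2 * ln 2) * exp (- (5 / 2) * ln x)).
  - rewrite <- exp_plus; apply exp_le; lra.
  - apply Rmult_le_compat_r; [left; apply exp_pos|].
    assert (H2 : exp (5 / 2 * ln 2) * exp (5 / 2 * ln 2) = 2 ^ 5).
    { rewrite <- exp_plus; replace (5 / 2 * ln 2 + 5 / 2 * ln 2) with
        (ln 2 + ln 2 + ln 2 + ln 2 + ln 2) by field.
      rewrite !exp_plus, exp_ln by lra; ring. }
    pose proof (exp_pos (5 / 2 * ln 2)); nra. }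
nra.
Qed.

(** Halving the last term of the partial sum gains a factor [N] in the error.
    *)
Definition zeta_trapezoid (s : C) (N : nat) : C :=
  (zeta_approx s N - / 2 * Rcpow (INR N) (- s))%C.

Lemma zeta_trapezoid_step (s : C) N : s <> 1 -> (1 <= N)%nat ->
  (zeta_trapezoid s (S N) - zeta_trapezoid s N)%C =
  (trapezoid s (INR N) (INR (S N)) - trapezoid s (INR N) (INR N))%C.
Proof.
intros Hs HN.
pose proof (zeta_approx_step s N Hs HN) as H.
pose proof (one_minus_neq0 s Hs); pose proof C2_neq0.
unfold zeta_trapezoid.
transitivity ((zeta_approx s (S N) - zeta_approx s N)
  - / 2 * Rcpow (INR (S N)) (- s) + / 2 * Rcpow (INR N) (- s))%C; [ring|].
rewrite H; unfold phi, trapezoid.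
replace (RtoC (INR (S N))) with (RtoC (INR N) + 1)%C by (now rewrite S_INR, RtoC_plus).
field; auto.
Qed.

(** Telescoping the trapezoidal errors bounds the distance from zeta to
    [zeta_trapezoid]; the halved last term is then put back. *)
Lemma zeta_approx_error t N : (1 <= N)%nat ->
  Cmod (zeta (crit t) - zeta_approx (crit t) N) <=
  / 2 * exp (- (1 / 2) * lnat N)
  + 2 * (Cmod (crit t) * Cmod (crit t + 1)) * exp (- (3 / 2) * lnat N).
Proof.
intros HN; set (s := crit t).
assert (Hs : s <> 1) by apply crit_neq_1.
set (K := 3 * (Cmod s * Cmod (s + 1))).
assert (HK : 0 <= K).
{ unfold K; apply Rmult_le_pos; [lra|]; apply Rmult_le_pos; apply Cmod_ge_0. }
assert (Htel := telescope (zeta_trapezoid s) K (3 / 2) ltac:(lra) HK).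
assert (Ht : forall N M, (1 <= N)%nat -> (N <= M)%nat ->
  Cmod (zeta_trapezoid s M - zeta_trapezoid s N) <= K / (3 / 2) * exp (- (3 / 2) * ln (INR N))).
{ apply Htel; intros n Hn; rewrite zeta_trapezoid_step by easy.
  apply incr_tail with (f' := trapezoid1 s (INR n)); try easy; [lra| |].
  - intros x Hx1 Hx; apply cder_trapezoid; [easy|lra].
  - intros x Hx1 Hx; apply trapezoid1_bound; [now apply Defs.INR_pos|easy]. }
clear Htel.
assert (Hhalf : forall M, Cmod (Rcpow (INR M) (- s)) = exp (- (1 / 2) * ln (INR M))).
{ intros M; rewrite Cmod_Rcpow; f_equal; unfold s, crit, Re; simpl; ring. }
assert (H0 : clim (fun M => Rcpow (INR M) (- s)) 0).
{ assert (H : is_lim_seq (fun M => Cmod (Rcpow (INR M) (- s))) 0).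
  { eapply is_lim_seq_ext; [|apply (exp_tail_lim (1 / 2)); lra].
    intros M; now rewrite Hhalf. }
  split; apply is_lim_seq_abs_0, (is_lim_seq_le_le (fun _ => 0)
    _ (fun M => Cmod (Rcpow (INR M) (- s)))); auto using is_lim_seq_const;
    intros M; (split; [apply Rabs_pos|]); [apply abs_Re_le|apply abs_Im_le]. }
assert (Hz : clim (zeta_approx s) (zeta s)).
{ apply zeta_approx_lim; [unfold s; rewrite Re_crit; lra|easy]. }
assert (HzU : clim (zeta_trapezoid s) (zeta s)).
{ pose proof (clim_minus _ _ _ _ Hz (clim_scal (/ 2) _ _ H0)) as H.
  replace (zeta s - / 2 * 0)%C with (zeta s) in H by ring; exact H. }
assert (Hdiff : Cmod (zeta s - zeta_trapezoid s N) <= K / (3 / 2) * exp (- (3 / 2) * ln (INR N))).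
{ apply (clim_Cmod (fun M => zeta_trapezoid s (M + N) - zeta_trapezoid s N)%C).
  - apply (clim_minus (fun M => zeta_trapezoid s (M + N)) (fun _ => zeta_trapezoid s N)).
    + destruct HzU as [Ha Hb]; split.
      * exact (proj1 (is_lim_seq_incr_n _ N _) Ha).
      * exact (proj1 (is_lim_seq_incr_n _ N _) Hb).
    + split; apply is_lim_seq_const.
  - intros M HM; apply Ht; [easy|lia]. }
replace (zeta s - zeta_approx s N)%C with
  ((zeta s - zeta_trapezoid s N) + - (/ 2 * Rcpow (INR N) (- s)))%C
  by (unfold zeta_trapezoid; ring).
eapply Rle_trans; [apply Cmod_triangle|].
rewrite Cmod_opp, Cmod_mult, Hhalf, Cmod_inv by apply C2_neq0.
rewrite Cmod_R, (Rabs_pos_eq 2) by lra.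
replace (K / (3 / 2)) with (2 * (Cmod s * Cmod (s + 1))) in Hdiff by (unfold K; field).
unfold lnat; lra.
Qed.

Lemma Cmod_triangle_rev a b : Rabs (Cmod a - Cmod b) <= Cmod (a - b).
Proof.
pose proof (Cmod_triangle (a - b) b) as T1.
pose proof (Cmod_triangle (- (a - b)) a) as T2.
rewrite Cmod_opp in T2.
replace (a - b + b)%C with a in T1 by ring.
replace (- (a - b) + a)%C with b in T2 by ring.
apply Rabs_le; lra.
Qed.

Lemma Cmod_crit_sub u t : Cmod (crit u - crit t) = Rabs (u - t).
Proof.
replace (crit u - crit t)%C with (Ci * RtoC (u - t))%C.
- now rewrite Cmod_mult, Cmod_Ci, Rmult_1_l, Cmod_R.
- unfold crit, Ci; apply C_eq; unfold Re, Im; simpl; ring.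
Qed.

(** Differentiability in the complex sense gives a local Lipschitz bound along
    the critical line. *)
Lemma cont_zeta_norm : cont (fun t => Cmod (zeta (crit t))).
Proof.
intros t.
destruct (zeta_holomorphic (crit t)) as [l [_ Hl]];
  [rewrite Re_crit; lra | apply crit_neq_1|].
destruct (Hl (crit t) (fun P HP => HP) (mkposreal 1 Rlt_0_1)) as [d Hd].
apply filterlim_locally; intros eps.
assert (HM : 0 < 1 + Cmod l) by (pose proof (Cmod_ge_0 l); lra).
assert (Hm : 0 < Rmin d (eps / (1 + Cmod l))).
{ apply Rmin_glb_lt; [apply cond_pos|]; apply Rdiv_lt_0_compat; [apply cond_pos|lra]. }
exists (mkposreal _ Hm); intros u Hu.
change (Rabs (u - t) < Rmin d (eps / (1 + Cmod l))) in Hu.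
change (Rabs (Cmod (zeta (crit u)) - Cmod (zeta (crit t))) < eps).
eapply Rle_lt_trans; [apply Cmod_triangle_rev|].
assert (Hud : Cmod (crit u - crit t) < d).
{ rewrite Cmod_crit_sub; eapply Rlt_le_trans; [exact Hu|apply Rmin_l]. }
assert (Hue : Rabs (u - t) < eps / (1 + Cmod l)).
{ eapply Rlt_le_trans; [exact Hu|apply Rmin_r]. }
specialize (Hd (crit u) Hud).
change (Cmod ((zeta (crit u) - zeta (crit t)) - (crit u - crit t) * l)
  <= 1 * Cmod (crit u - crit t)) in Hd.
pose proof (Cmod_triangle ((zeta (crit u) - zeta (crit t)) - (crit u - crit t) * l)
  ((crit u - crit t) * l)) as HT.
replace ((zeta (crit u) - zeta (crit t)) - (crit u - crit t) * l + (crit u - crit t) * l)%C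
  with (zeta (crit u) - zeta (crit t))%C in HT by ring.
rewrite Cmod_mult, Cmod_crit_sub in *.
apply (Rmult_lt_compat_l (1 + Cmod l)) in Hue; [|easy].
replace ((1 + Cmod l) * (eps / (1 + Cmod l))) with (pos eps) in Hue by (field; lra).
lra.
Qed.

(** * The weighted mean square of the truncation *)

Lemma psum_prod f g N M :
  psum f N * psum g M = psum (fun n => psum (fun m => f n * g m) M) N.
Proof.
induction N as [|N IH]; simpl; [ring|].
rewrite <- IH, psum_scal; ring.
Qed.

Lemma Re_sum_n_m (f : nat -> C) N :
  Re (sum_n_m (G := C_AbelianMonoid) f 1 N) = psum (fun n => Re (f n)) N.
Proof.
induction N as [|N IH]; [rewrite sum_n_m_zero by lia; easy|].
rewrite sum_n_Sm by lia; simpl; rewrite <- IH; easy.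
Qed.

Lemma Im_sum_n_m (f : nat -> C) N :
  Im (sum_n_m (G := C_AbelianMonoid) f 1 N) = psum (fun n => Im (f n)) N.
Proof.
induction N as [|N IH]; [rewrite sum_n_m_zero by lia; easy|].
rewrite sum_n_Sm by lia; simpl; rewrite <- IH; easy.
Qed.

Lemma Cmod_sqr z : Cmod z ^ 2 = Re z ^ 2 + Im z ^ 2.
Proof.
unfold Cmod; rewrite pow2_sqrt; [easy|].
pose proof (pow2_ge_0 (fst z)); pose proof (pow2_ge_0 (snd z)); lra.
Qed.

Lemma Re_term t n : Re (Rcpow (INR n) (- crit t)) = exp (- lnat n / 2) * cos (t * lnat n).
Proof.
unfold Rcpow, Cexp, crit, lnat, Re, Im; simpl; rewrite <- (cos_neg (t * _)).
f_equal; f_equal; field.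
Qed.

Lemma Im_term t n : Im (Rcpow (INR n) (- crit t)) = - (exp (- lnat n / 2) * sin (t * lnat n)).
Proof.
unfold Rcpow, Cexp, crit, lnat, Re, Im; simpl; rewrite Ropp_mult_distr_r, <- sin_neg.
f_equal; f_equal; field.
Qed.

Lemma crit_inv t : (/ (1 - crit t))%C = ((1 / 2) / (/ 4 + t ^ 2), t / (/ 4 + t ^ 2)).
Proof.
pose proof (quarter_plus_pos t).
unfold crit; apply C_eq; unfold Re, Im; simpl; field; nra.
Qed.

(** Expansion of the square; the three lines are the Dirichlet polynomial, the
    cross terms and the square of [N^(1-s)/(1-s)]. *)
Lemma Cmod_zeta_approx_sqr t N :
  Cmod (zeta_approx (crit t) N) ^ 2 =
  psum (fun n => psum (fun m => exp (- (lnat n + lnat m) / 2) * cos (t * (lnat n - lnat m))) N) N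
  - 2 * psum (fun n => exp ((lnat N - lnat n) / 2) *
       ((/ 2 * cos (t * (lnat N - lnat n)) + t * sin (t * (lnat N - lnat n))) / (/ 4 + t ^ 2))) N
  + exp (lnat N) / (/ 4 + t ^ 2).
Proof.
pose proof (quarter_plus_pos t) as Hq.
rewrite Cmod_sqr; unfold zeta_approx.
set (L := lnat N); set (d := / 4 + t ^ 2) in *.
set (B := exp (L / 2) * (/ 2 * cos (t * L) + t * sin (t * L)) / d).
set (B' := exp (L / 2) * (t * cos (t * L) - / 2 * sin (t * L)) / d).
assert (HB : (Rcpow (INR N) (1 - crit t) / (1 - crit t))%C = (B, B')).
{ unfold Cdiv; rewrite crit_inv; fold d.
  unfold Rcpow, Cexp; fold (lnat N); fold L.
  replace (Re ((1 - crit t) * RtoC L)) with (L / 2) by (unfold crit, Re; simpl; field).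
  replace (Im ((1 - crit t) * RtoC L)) with (- (t * L)) by (unfold crit, Im; simpl; ring).
  rewrite cos_neg, sin_neg; unfold B, B'; apply C_eq; unfold Re, Im; simpl; field; lra. }
rewrite HB.
set (u := sum_n_m _ _ _).
assert (Hre : Re u = psum (fun n => exp (- lnat n / 2) * cos (t * lnat n)) N).
{ unfold u; rewrite Re_sum_n_m; apply psum_ext; intros; apply Re_term. }
assert (Him : Im u = - psum (fun n => exp (- lnat n / 2) * sin (t * lnat n)) N).
{ unfold u; rewrite Im_sum_n_m.
  replace (- psum _ N) with (-1 * psum (fun n => exp (- lnat n / 2) * sin (t * lnat n)) N) by ring.
  rewrite <- psum_scal; apply psum_ext; intros; rewrite Im_term; ring. }
change C in (type of u).
replace (Re (u - (B, B'))%C) with (Re u - B) by (unfold Re; simpl; ring).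
replace (Im (u - (B, B'))%C) with (Im u - B') by (unfold Im; simpl; ring).
rewrite Hre, Him.
set (A := psum (fun n => exp (- lnat n / 2) * cos (t * lnat n)) N).
set (A' := psum (fun n => exp (- lnat n / 2) * sin (t * lnat n)) N).
replace ((A - B) ^ 2 + (- A' - B') ^ 2) with
  ((A * A + A' * A') - 2 * (A * B - A' * B') + (B * B + B' * B')) by ring.
f_equal; [f_equal|].
- unfold A, A'; rewrite !psum_prod, <- psum_plus; apply psum_ext; intros n _.
  rewrite <- psum_plus; apply psum_ext; intros m _.
  rewrite Rmult_minus_distr_l, cos_minus.
  replace (- (lnat n + lnat m) / 2) with (- lnat n / 2 + - lnat m / 2) by field.
  rewrite exp_plus; ring.
- f_equal; rewrite (Rmult_comm A), (Rmult_comm A'); unfold A, A'.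
  rewrite <- !psum_scal, <- psum_minus; apply psum_ext; intros n _.
  rewrite Rmult_minus_distr_l, cos_minus, sin_minus.
  replace ((L - lnat n) / 2) with (L / 2 + - lnat n / 2) by field.
  rewrite exp_plus; unfold B, B'; field; lra.
- replace (exp L) with (exp (L / 2) * exp (L / 2)) by (rewrite <- exp_plus; f_equal; field).
  pose proof (sin2_cos2 (t * L)) as H; unfold Rsqr in H.
  unfold B, B'.
  transitivity (exp (L / 2) * exp (L / 2) * (/ 4 + t ^ 2) *
    (sin (t * L) * sin (t * L) + cos (t * L) * cos (t * L)) / (d * d)); [field; lra|].
  rewrite H; fold d; field; lra.
Qed.

Lemma cont_weight_cos_integrand T x : cont (fun t => 2 * (T - t) * cos (t * x)).
Proof. apply cont_derivable; intros; auto_derive; easy. Qed.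

Lemma cont_sqr f : cont f -> cont (fun t => f t ^ 2).
Proof.
intros H x; apply (continuous_ext (fun t => f t * f t));
  [intros u; change (f u * f u = f u ^ 2); ring|].
now apply cont_mult.
Qed.

Lemma truncated_moment_integrand (T N : nat) t : (1 <= N)%nat ->
  2 * (INR T - t) * Cmod (zeta_approx (crit t) N) ^ 2 =
  psum (fun n => psum (fun m => exp (- (lnat n + lnat m) / 2)
     * (2 * (INR T - t) * cos (t * (lnat n - lnat m)))) N) N
  - 2 * psum (fun n => cross_integrand (INR T) (lnat N - lnat n) t
                       - cross_integrand (INR T) 0 t) N.
Proof.
intros HN; rewrite Cmod_zeta_approx_sqr, exp_lnat by easy.
pose proof (quarter_plus_pos t) as Hq.
rewrite psum_minus, psum_const.
rewrite (psum_ext (fun n => cross_integrand (INR T) (lnat N - lnat n) t)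
  (fun n => 2 * (INR T - t) * (exp ((lnat N - lnat n) / 2) *
       ((/ 2 * cos (t * (lnat N - lnat n)) + t * sin (t * (lnat N - lnat n))) / (/ 4 + t ^ 2)))))
  by (intros; unfold cross_integrand; ring).
rewrite psum_scal.
rewrite (psum_ext (fun n => psum (fun m => exp (- (lnat n + lnat m) / 2)
     * (2 * (INR T - t) * cos (t * (lnat n - lnat m)))) N)
  (fun n => 2 * (INR T - t) * psum (fun m => exp (- (lnat n + lnat m) / 2)
     * cos (t * (lnat n - lnat m))) N))
  by (intros; rewrite <- psum_scal; apply psum_ext; intros; ring).
rewrite psum_scal.
unfold cross_integrand at 1.
rewrite Rmult_0_r, cos_0, sin_0; replace (0 / 2) with 0 by field; rewrite exp_0.
field; lra.
Qed.

Lemma RInt_zeta_approx (T N : nat) : (1 <= N)%nat ->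
  RInt (fun t => 2 * (INR T - t) * Cmod (zeta_approx (crit t) N) ^ 2) 0 (INR T)
  = truncated_moment T N.
Proof.
intros HN; rewrite (RInt_congr _ _ _ _ (fun t => truncated_moment_integrand T N t HN)).
assert (H1 : forall n m, cont (fun t => exp (- (lnat n + lnat m) / 2)
     * (2 * (INR T - t) * cos (t * (lnat n - lnat m))))).
{ intros; apply cont_mult; [apply cont_const|apply cont_weight_cos_integrand]. }
assert (H2 : forall n, cont (fun t => cross_integrand (INR T) (lnat N - lnat n) t
                       - cross_integrand (INR T) 0 t)).
{ intros; apply cont_minus; apply cont_cross. }
rewrite RInt_sub, RInt_mul, !RInt_psum; auto.
- unfold truncated_moment; f_equal; [|f_equal]; apply psum_ext; intros n _.
  + rewrite RInt_psum by auto; apply psum_ext; intros m _.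
    rewrite RInt_mul by apply cont_weight_cos_integrand; easy.
  + rewrite RInt_sub by apply cont_cross; easy.
- intros; apply cont_psum; auto.
- apply cont_psum; auto.
- apply cont_psum; intros; apply cont_psum; auto.
- apply cont_mult; [apply cont_const|apply cont_psum; auto].
Qed.

Definition fejer_moment (f : R -> R) (T : R) : R := RInt (fun t => 2 * (T - t) * f t) 0 T.

Lemma cont_weight T f : cont f -> cont (fun t => 2 * (T - t) * f t).
Proof.
intros H; apply cont_mult; [|easy].
apply cont_derivable; intros; auto_derive; easy.
Qed.

Lemma cont_zeta_approx_sqr (N : nat) :
  cont (fun t => Cmod (zeta_approx (crit t) N) ^ 2).
Proof.
intros t; eapply continuous_ext; [intros u; symmetry; apply Cmod_zeta_approx_sqr|].
revert t.
change (cont (fun u => psum (fun n => psum (fun m => exp (- (lnat n + lnat m) / 2) * cos (u * (lnat n - lnat m))) N) N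
  - 2 * psum (fun n => exp ((lnat N - lnat n) / 2) *
       ((/ 2 * cos (u * (lnat N - lnat n)) + u * sin (u * (lnat N - lnat n))) / (/ 4 + u ^ 2))) N
  + exp (lnat N) / (/ 4 + u ^ 2))).
apply cont_plus; [apply cont_minus|].
- apply cont_psum; intros; apply cont_psum; intros.
  apply cont_derivable; intros; auto_derive; easy.
- apply cont_mult; [apply cont_const|]; apply cont_psum; intros.
  apply cont_derivable; intros t; auto_derive.
  pose proof (quarter_plus_pos t); simpl in *; lra.
- apply cont_derivable; intros t; auto_derive.
  pose proof (quarter_plus_pos t); simpl in *; lra.
Qed.

(** Cauchy-Schwarz in pointwise form; the parameter [eta] balances the main
    term against the error. *)
Lemma sqr_perturb a b e eta : 0 <= a -> 0 <= b -> Rabs (a - b) <= e -> 0 < eta ->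
  Rabs (a ^ 2 - b ^ 2) <= eta * b ^ 2 + (/ eta + 1) * e ^ 2.
Proof.
intros Ha Hb He Heta.
replace (a ^ 2 - b ^ 2) with ((a - b) * (a + b)) by ring.
rewrite Rabs_mult, (Rabs_pos_eq (a + b)) by lra.
assert (He0 : 0 <= e) by (eapply Rle_trans; [apply Rabs_pos|exact He]).
assert (Hab : a + b <= 2 * b + e) by (apply Rabs_le_between in He; lra).
apply Rle_trans with (e * (2 * b + e)).
- apply Rmult_le_compat; [apply Rabs_pos|lra|easy|easy].
- assert (H : 0 <= / eta * (eta * b - e) ^ 2)
    by (apply Rmult_le_pos; [left; now apply Rinv_0_lt_compat|apply pow2_ge_0]).
  replace (/ eta * (eta * b - e) ^ 2) with (eta * b ^ 2 - 2 * b * e + / eta * e ^ 2) in H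
    by (field; lra).
  lra.
Qed.

(** The moment of the approximation enters the bound itself, which is harmless
    since its size is known from [truncated_moment_asymp]. *)
Lemma fejer_moment_perturb (T N : nat) e eta : (1 <= N)%nat -> 0 < eta ->
  (forall t, 0 <= t <= INR T -> Cmod (zeta (crit t) - zeta_approx (crit t) N) <= e) ->
  Rabs (fejer_moment (fun t => Cmod (zeta (crit t)) ^ 2) (INR T) - truncated_moment T N)
  <= eta * truncated_moment T N + (/ eta + 1) * e ^ 2 * INR T ^ 2.
Proof.
intros HN Heta He; rewrite <- RInt_zeta_approx by easy.
set (z t := Cmod (zeta (crit t)) ^ 2).
set (w t := Cmod (zeta_approx (crit t) N) ^ 2).
assert (Hz : cont z) by (apply cont_sqr, cont_zeta_norm).
assert (Hw : cont w) by apply cont_zeta_approx_sqr.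
unfold fejer_moment.
change (Rabs (RInt (fun t => 2 * (INR T - t) * z t) 0 (INR T)
  - RInt (fun t => 2 * (INR T - t) * w t) 0 (INR T)) <=
  eta * RInt (fun t => 2 * (INR T - t) * w t) 0 (INR T) + (/ eta + 1) * e ^ 2 * INR T ^ 2).
pose proof (cont_weight (INR T) z Hz) as Hcz; pose proof (cont_weight (INR T) w Hw) as Hcw.
pose proof (cont_weight (INR T) _ (cont_const 1)) as Hc1.
assert (HT2 : @eq R (RInt (fun t => 2 * (INR T - t) * 1) 0 (INR T)) (INR T ^ 2)).
{ rewrite (RInt_antiderivative (fun t => - (INR T - t) ^ 2)); [ring| |easy].
  intros t; auto_derive; [easy|ring]. }
rewrite <- RInt_sub by easy.
rewrite <- HT2, <- !RInt_mul, <- RInt_add; auto.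
2: { apply cont_mult; [apply cont_const|easy]. }
2: { apply cont_mult; [apply cont_const|easy]. }
apply Rle_trans with (RInt (fun t => Rabs (2 * (INR T - t) * z t - 2 * (INR T - t) * w t)) 0 (INR T)).
{ apply (abs_RInt_le (fun t => 2 * (INR T - t) * z t - 2 * (INR T - t) * w t));
    [apply pos_INR|apply cont_ex_RInt, cont_minus; easy]. }
apply RInt_mono; [apply pos_INR| | |].
- intros t; apply (continuous_comp (fun t => 2 * (INR T - t) * z t - 2 * (INR T - t) * w t) Rabs).
  + now apply cont_minus.
  + apply continuous_Rabs.
- apply cont_plus; apply cont_mult; try apply cont_const; easy.
- intros t Ht.
  replace (2 * (INR T - t) * z t - 2 * (INR T - t) * w t) with
    (2 * (INR T - t) * (z t - w t)) by ring.
  rewrite Rabs_mult, Rabs_pos_eq by lra.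
  replace (eta * (2 * (INR T - t) * w t) + (/ eta + 1) * e ^ 2 * (2 * (INR T - t) * 1)) with
    (2 * (INR T - t) * (eta * w t + (/ eta + 1) * e ^ 2)) by ring.
  apply Rmult_le_compat_l; [lra|].
  apply sqr_perturb; try apply Cmod_ge_0; [|easy].
  eapply Rle_trans; [|apply (He t Ht)].
  apply Cmod_triangle_rev.
Qed.

(** * The weighted mean square of zeta *)

Definition zeta_sqr (t : R) : R := Cmod (zeta (crit t)) ^ 2.
Definition kappa : R := ln (2 * PI) - 2 * euler_gamma.

Lemma cont_zeta_sqr : cont zeta_sqr.
Proof. apply cont_sqr, cont_zeta_norm. Qed.

Lemma Cmod_crit_le t T : 1 <= T -> 0 <= t <= T ->
  Cmod (crit t) * Cmod (crit t + 1) <= 6 * T ^ 2.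
Proof.
intros HT Ht.
assert (Ha : Cmod (crit t) <= 2 * T).
{ replace (crit t) with (RtoC (1 / 2) + Ci * RtoC t)%C
    by (unfold crit, Ci; apply C_eq; unfold Re, Im; simpl; ring).
  eapply Rle_trans; [apply Cmod_triangle|].
  rewrite Cmod_mult, Cmod_Ci, !Cmod_R, !Rabs_pos_eq by lra; lra. }
assert (Hb : Cmod (crit t + 1) <= 3 * T).
{ eapply Rle_trans; [apply Cmod_triangle|]; rewrite Cmod_1; lra. }
replace (6 * T ^ 2) with ((2 * T) * (3 * T)) by ring.
apply Rmult_le_compat; auto using Cmod_ge_0.
Qed.

Lemma sqrt_pow_double p k : 0 <= p -> sqrt (p ^ (2 * k)) = p ^ k.
Proof.
intros Hp; rewrite Nat.mul_comm, pow_mult; apply sqrt_pow2, pow_le; easy.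
Qed.

Lemma ln_pow_nat p k : 0 < p -> ln (p ^ k) = INR k * ln p.
Proof.
intros Hp; induction k as [|k IH]; [simpl; rewrite ln_1; ring|].
simpl pow; rewrite ln_mult, IH, S_INR by (try apply pow_lt; easy); ring.
Qed.

(** Here [p = T^(1/10)].  With [N] about [p^14 = T^(7/5)] the error [sqrt T N
    ln N] is [T^2 ln T / p]. *)
Lemma truncated_moment_asymp (T N : nat) p : (7 <= T)%nat -> 1 <= p -> p ^ 10 = INR T ->
  p ^ 14 <= INR N <= 2 * p ^ 14 ->
  Rabs (truncated_moment T N - INR T ^ 2 * (ln (INR T) - 1 / 2 - 1 - kappa))
  <= 1252 * (1 + ln (INR T)) * INR T ^ 2 / p.
Proof.
intros HT Hp HpT HN.
assert (HT7 : 7 <= INR T) by (apply le_INR in HT; simpl in HT; lra).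
pose proof PI_lt_3_2 as Hpi1; pose proof PI_RGT_0 as Hpi0; pose proof PI2_3_2 as Hpi2.
assert (Hpow : forall k, 1 <= p ^ k) by (intros; now apply pow_R1_Rle).
assert (HTN : (T <= N)%nat).
{ apply INR_le; rewrite <- HpT; eapply Rle_trans; [|apply HN].
  apply Rle_pow; [easy|lia]. }
set (x := INR T / (2 * PI)).
assert (Hx : 1 <= x).
{ unfold x; apply Rmult_le_reg_r with (2 * PI); [lra|].
  unfold Rdiv; rewrite Rmult_assoc, Rinv_l by lra; lra. }
assert (HxT : x <= INR T).
{ unfold x; apply Rmult_le_reg_r with (2 * PI); [lra|].
  unfold Rdiv; rewrite Rmult_assoc, Rinv_l by lra; nra. }
assert (HxN : x <= INR N) by (apply le_INR in HTN; lra).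
pose proof (truncated_moment_divisors T N ltac:(lia) HTN) as H1.
pose proof (divisor_sum_asymp x N T Hx HxN HxT) as H2.
fold x in H1.
assert (HlnT : ln (INR T) = 10 * ln p) by (rewrite <- HpT, ln_pow_nat by lra; simpl; ring).
assert (Hlnp : 0 <= ln p) by now apply ln_nonneg.
assert (HlnN : ln (INR N) <= 1 + 14 * ln p).
{ apply Rle_trans with (ln (2 * p ^ 14)).
  - apply ln_le; [|apply HN]; pose proof (Hpow 14%nat); lra.
  - rewrite ln_mult, ln_pow_nat by (try apply pow_lt; lra).
    pose proof (ln_le_minus1 2); simpl INR; lra. }
assert (Hsq : sqrt (INR T) = p ^ 5) by (rewrite <- HpT; apply (sqrt_pow_double p 5); lra).
assert (HT2 : INR T ^ 2 = p ^ 20) by (rewrite <- HpT; ring).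
assert (E1 : 304 * sqrt (INR T) * (INR N * (1 + ln (INR N))) <=
   1216 * (1 + ln (INR T)) * INR T ^ 2 / p).
{ rewrite Hsq, HT2, HlnT.
  replace (1216 * (1 + 10 * ln p) * p ^ 20 / p) with
    (304 * p ^ 5 * ((2 * p ^ 14) * (2 + 20 * ln p))) by (field; lra).
  apply Rmult_le_compat_l; [pose proof (Hpow 5%nat); lra|].
  assert (0 <= ln (INR N)) by (apply ln_nonneg; pose proof (Hpow 14%nat); lra).
  apply Rmult_le_compat; [pose proof (Hpow 14%nat); lra|lra|apply HN|lra]. }
assert (E2 : 8 * PI ^ 2 * (6 * (x * sqrt x)) <= 36 * INR T ^ 2 / p).
{ assert (Hsx : x * sqrt x = x ^ 2 / sqrt x).
  { assert (0 < sqrt x) by (apply sqrt_lt_R0; lra).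
    apply Rmult_eq_reg_r with (sqrt x); [|lra].
    replace (x ^ 2 / sqrt x * sqrt x) with (x ^ 2) by (field; lra).
    rewrite Rmult_assoc, sqrt_sqrt by lra; ring. }
  rewrite Hsx; replace (8 * PI ^ 2 * (6 * (x ^ 2 / sqrt x))) with (12 * INR T ^ 2 / sqrt x).
  2: { replace (INR T ^ 2) with (x ^ 2 * (4 * PI ^ 2)) by (unfold x; field; lra).
       assert (0 < sqrt x) by (apply sqrt_lt_R0; lra); field; lra. }
  assert (Hsp : p <= 3 * sqrt x).
  { apply Rsqr_incr_0_var; [|assert (0 < sqrt x) by (apply sqrt_lt_R0; lra); lra].
    unfold Rsqr; replace (3 * sqrt x * (3 * sqrt x)) with (9 * (sqrt x * sqrt x)) by ring.
    rewrite sqrt_sqrt by lra.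
    apply Rle_trans with (INR T).
    - rewrite <- HpT; replace (p ^ 10) with (p * p * p ^ 8) by ring.
      pose proof (Hpow 8%nat); nra.
    - unfold x; apply Rmult_le_reg_r with (2 * PI); [lra|].
      replace (9 * (INR T / (2 * PI)) * (2 * PI)) with (9 * INR T) by (field; lra).
      nra. }
  assert (0 < sqrt x) by (apply sqrt_lt_R0; lra).
  apply Rmult_le_reg_r with (p * sqrt x); [nra|].
  replace (12 * INR T ^ 2 / sqrt x * (p * sqrt x)) with (12 * INR T ^ 2 * p) by (field; lra).
  replace (36 * INR T ^ 2 / p * (p * sqrt x)) with (12 * INR T ^ 2 * (3 * sqrt x)) by (field; lra).
  apply Rmult_le_compat_l; [pose proof (pow2_ge_0 (INR T)); lra|easy]. }
assert (Emain : 8 * PI ^ 2 * (x ^ 2 * (ln x / 2 + euler_gamma - 3 / 4)) =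
   INR T ^ 2 * (ln (INR T) - 1 / 2 - 1 - kappa)).
{ unfold kappa, x; rewrite ln_div by lra; field; lra. }
assert (H3 : Rabs (8 * PI ^ 2 * divisor_sum N T x - INR T ^ 2 * (ln (INR T) - 1 / 2 - 1 - kappa))
   <= 36 * INR T ^ 2 / p).
{ rewrite <- Emain, <- Rmult_minus_distr_l, Rabs_mult, (Rabs_pos_eq (8 * PI ^ 2))
    by (pose proof (pow2_ge_0 PI); lra).
  eapply Rle_trans; [|exact E2].
  apply Rmult_le_compat_l; [pose proof (pow2_ge_0 PI); lra|easy]. }
replace (truncated_moment T N - _) with ((truncated_moment T N - 8 * PI ^ 2 * divisor_sum N T x) +
  (8 * PI ^ 2 * divisor_sum N T x - INR T ^ 2 * (ln (INR T) - 1 / 2 - 1 - kappa))) by ring.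
eapply Rle_trans; [apply Rabs_triang|].
assert (0 <= ln (INR T) * (INR T ^ 2 / p)).
{ apply Rmult_le_pos; [lra|]; apply Rdiv_le_0_compat; [apply pow2_ge_0|lra]. }
unfold Rdiv in *; lra.
Qed.

(** With [N] about [p^14] the error [T^2 N^(-3/2)] is [p^20 / p^21]: the
    exponent [7/5] lies between [4/3], needed here, and [3/2], needed in
    [truncated_moment_asymp]. *)
Lemma zeta_approx_error_unif (T N : nat) p t : (1 <= T)%nat -> 1 <= p -> p ^ 10 = INR T ->
  p ^ 14 <= INR N -> 0 <= t <= INR T ->
  Cmod (zeta (crit t) - zeta_approx (crit t) N) <= 13 / p.
Proof.
intros HT Hp HpT HN Ht; pose proof (Defs.INR_pos T HT) as HT1.
assert (Hpow : forall k, 1 <= p ^ k) by (intros; now apply pow_R1_Rle).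
assert (HN1 : (1 <= N)%nat) by (apply INR_le; simpl; pose proof (Hpow 14%nat); lra).
eapply Rle_trans; [apply zeta_approx_error; easy|].
assert (Hl : 14 * ln p <= lnat N).
{ unfold lnat; replace (14 * ln p) with (ln (p ^ 14)) by (rewrite ln_pow_nat by lra; simpl; ring).
  apply ln_le; [pose proof (Hpow 14%nat); lra|easy]. }
assert (Hexp : forall k, exp (- (INR k * ln p)) = / p ^ k).
{ intros k; rewrite exp_Ropp, <- ln_pow_nat, exp_ln by (try apply pow_lt; lra); easy. }
assert (H1 : exp (- (1 / 2) * lnat N) <= / p ^ 7).
{ rewrite <- Hexp; apply exp_le; simpl INR; lra. }
assert (H2 : exp (- (3 / 2) * lnat N) <= / p ^ 21).
{ rewrite <- Hexp; apply exp_le; simpl INR; lra. }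
pose proof (Cmod_crit_le t (INR T) HT1 Ht) as H3.
assert (H4 : 2 * (Cmod (crit t) * Cmod (crit t + 1)) * exp (- (3 / 2) * lnat N) <= 12 / p).
{ apply Rle_trans with (2 * (6 * INR T ^ 2) * / p ^ 21).
  - apply Rmult_le_compat; [| left; apply exp_pos | lra | easy].
    apply Rmult_le_pos; [lra|]; apply Rmult_le_pos; apply Cmod_ge_0.
  - right; rewrite <- HpT; field; lra. }
assert (H5 : / p ^ 7 <= / p).
{ apply Rinv_le_contravar; [lra|]; replace (p ^ 7) with (p * p ^ 6) by ring.
  pose proof (Hpow 6%nat); nra. }
assert (0 < / p) by (apply Rinv_0_lt_compat; lra).
unfold Rdiv in *; lra.
Qed.

Lemma exp_ge_cube z : 0 <= z -> (1 + z / 3) ^ 3 <= exp z.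
Proof.
intros Hz; replace z with (z / 3 + z / 3 + z / 3) at 2 by field.
rewrite !exp_plus; pose proof (exp_ineq1_le (z / 3)).
replace ((1 + z / 3) ^ 3) with ((1 + z / 3) * (1 + z / 3) * (1 + z / 3)) by ring.
apply Rmult_le_compat; try nra.
Qed.

(** The saving [T^(1/10)] is weakened to a power of [ln T], which is all that
    [mean_of_fejer_moment] needs; the constant [27000 = 30^3] comes from [(1 +
    L)^3 <= 30^3 (1 + L/30)^3 <= 30^3 e^(L/10)]. *)
Lemma fejer_moment_zeta : exists C, 0 <= C /\ forall T : nat, (7 <= T)%nat ->
  Rabs (fejer_moment zeta_sqr (INR T) - INR T ^ 2 * (ln (INR T) - 1 / 2 - 1 - kappa))
  <= C * INR T ^ 2 / (1 + ln (INR T)) ^ 2.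
Proof.
set (A := 2 + Rabs kappa + 1252).
assert (HA : 1252 <= A) by (unfold A; pose proof (Rabs_pos kappa); lra).
exists (27000 * (A + 1252 + 338)); split; [lra|].
intros T HT.
assert (HT7 : 7 <= INR T) by (apply le_INR in HT; simpl in HT; lra).
set (L := ln (INR T)).
assert (HL : 0 <= L) by (apply ln_nonneg; lra).
set (p := exp (L / 10)).
assert (Hp : 1 <= p) by (unfold p; rewrite <- exp_0; apply exp_le; lra).
assert (HpT : p ^ 10 = INR T).
{ unfold p; replace (exp (L / 10) ^ 10) with (exp (10 * (L / 10))).
  - replace (10 * (L / 10)) with L by field; apply exp_ln; lra.
  - replace (10 * (L / 10)) with (L/10+L/10+L/10+L/10+L/10+L/10+L/10+L/10+L/10+L/10) by field.
    rewrite !exp_plus; ring. }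
assert (Hp14 : 1 <= p ^ 14) by now apply pow_R1_Rle.
destruct (nfloor_ex (p ^ 14) ltac:(lra)) as [n [Hn1 Hn2]].
set (N := S n).
assert (HN : p ^ 14 <= INR N <= 2 * p ^ 14) by (unfold N; rewrite S_INR; lra).
assert (HN1 : (1 <= N)%nat) by (unfold N; lia).
pose proof (truncated_moment_asymp T N p HT Hp HpT HN) as H1; fold L in H1.
assert (Hip : 0 < / p <= 1).
{ split; [apply Rinv_0_lt_compat; lra|]; rewrite <- Rinv_1; apply Rinv_le_contravar; lra. }
pose proof (fejer_moment_perturb T N (13 / p) (/ p) HN1 ltac:(lra)
  (fun t Ht => zeta_approx_error_unif T N p t ltac:(lia) Hp HpT (proj1 HN) Ht)) as H2.
change (fun t => Cmod (zeta (crit t)) ^ 2) with zeta_sqr in H2.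
set (X := INR T ^ 2) in *.
assert (HX : 0 <= X) by apply pow2_ge_0.
assert (Hm : truncated_moment T N <= A * (1 + L) * X).
{ apply Rabs_le_between in H1.
  assert (1252 * (1 + L) * X / p <= 1252 * (1 + L) * X).
  { rewrite <- (Rmult_1_r (1252 * (1 + L) * X)) at 2; apply Rmult_le_compat_l; [|lra].
    apply Rmult_le_pos; [lra|easy]. }
  assert (X * (L - 1 / 2 - 1 - kappa) <= X * ((2 + Rabs kappa) * (1 + L))).
  { apply Rmult_le_compat_l; [easy|]; pose proof (Rabs_pos kappa).
    pose proof (Rle_abs (- kappa)); rewrite Rabs_Ropp in *; nra. }
  unfold A; lra. }
assert (H3 : Rabs (fejer_moment zeta_sqr (INR T) - X * (L - 1 / 2 - 1 - kappa))
  <= (A + 1252 + 338) * (1 + L) * X * / p).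
{ replace (fejer_moment zeta_sqr (INR T) - X * (L - 1 / 2 - 1 - kappa)) with
   ((fejer_moment zeta_sqr (INR T) - truncated_moment T N) +
    (truncated_moment T N - X * (L - 1 / 2 - 1 - kappa))) by ring.
  eapply Rle_trans; [apply Rabs_triang|].
  assert (/ p * truncated_moment T N <= / p * (A * (1 + L) * X)) by (apply Rmult_le_compat_l; lra).
  rewrite Rinv_inv in H2.
  assert ((p + 1) * (13 / p) ^ 2 * X <= 338 * (1 + L) * X * / p).
  { replace ((p + 1) * (13 / p) ^ 2 * X) with (169 * (1 + / p) * (X * / p)) by (field; lra).
    replace (338 * (1 + L) * X * / p) with (338 * (1 + L) * (X * / p)) by ring.
    apply Rmult_le_compat_r; [apply Rmult_le_pos; lra|lra]. }
  unfold Rdiv in *; lra. }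
eapply Rle_trans; [exact H3|].
assert (Hcube : (1 + L) ^ 3 <= 27000 * p).
{ pose proof (exp_ge_cube (L / 10) ltac:(lra)) as Hc; fold p in Hc.
  assert ((1 + L) ^ 3 <= (30 * (1 + L / 10 / 3)) ^ 3) by (apply pow_incr; lra).
  replace ((30 * (1 + L / 10 / 3)) ^ 3) with (27000 * (1 + L / 10 / 3) ^ 3) in * by ring.
  lra. }
assert (HL2 : 0 < (1 + L) ^ 2) by (apply pow_lt; lra).
apply Rmult_le_reg_r with ((1 + L) ^ 2 * p); [nra|].
replace ((A + 1252 + 338) * (1 + L) * X * / p * ((1 + L) ^ 2 * p)) with
  ((A + 1252 + 338) * X * (1 + L) ^ 3) by (field; lra).
replace (27000 * (A + 1252 + 338) * X / (1 + L) ^ 2 * ((1 + L) ^ 2 * p)) with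
  ((A + 1252 + 338) * X * (27000 * p)) by (field; lra).
apply Rmult_le_compat_l; [apply Rmult_le_pos; lra|easy].
Qed.

(** * From the weighted mean to the mean *)

(** The increment of the weight [2 max(0, T - t)] from [a] to [b] is [2 (b -
    a)] up to [a] and between [0] and [2 (b - a)] on [[a, b]]. *)
Lemma fejer_moment_diff f (a b : R) : cont f -> (forall t, 0 <= f t) -> 0 <= a <= b ->
  2 * (b - a) * RInt f 0 a <= fejer_moment f b - fejer_moment f a
  <= 2 * (b - a) * RInt f 0 b.
Proof.
intros Hc Hf Hab; unfold fejer_moment.
pose proof (cont_weight b f Hc) as Hb; pose proof (cont_weight a f Hc) as Ha.
assert (E1 : RInt (fun t => 2 * (b - t) * f t) 0 b =
  RInt (fun t => 2 * (b - t) * f t) 0 a + RInt (fun t => 2 * (b - t) * f t) a b).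
{ symmetry; apply (RInt_Chasles (fun t => 2 * (b - t) * f t)); now apply cont_ex_RInt. }
assert (E2 : RInt (fun t => 2 * (b - t) * f t) 0 a - RInt (fun t => 2 * (a - t) * f t) 0 a
  = 2 * (b - a) * RInt f 0 a).
{ rewrite <- RInt_sub, <- RInt_mul by easy; apply RInt_congr; intros; ring. }
assert (E3 : RInt f 0 b = RInt f 0 a + RInt f a b).
{ symmetry; apply (RInt_Chasles f); now apply cont_ex_RInt. }
assert (E4 : 0 <= RInt (fun t => 2 * (b - t) * f t) a b <= 2 * (b - a) * RInt f a b).
{ split.
  - apply RInt_ge_0; [lra|now apply cont_ex_RInt|].
    intros t Ht; apply Rmult_le_pos; [lra|apply Hf].
  - rewrite <- RInt_mul by easy; apply RInt_mono; [lra|easy| |].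
    + apply cont_mult; [apply cont_const|easy].
    + intros t Ht; apply Rmult_le_compat_r; [apply Hf|lra]. }
rewrite E1, E3; lra.
Qed.

Lemma RInt_nonneg_mono f a b : cont f -> (forall t, 0 <= f t) -> 0 <= a <= b ->
  RInt f 0 a <= RInt f 0 b.
Proof.
intros Hc Hf Hab.
assert (E3 : RInt f 0 b = RInt f 0 a + RInt f a b).
{ symmetry; apply (RInt_Chasles f); now apply cont_ex_RInt. }
assert (0 <= RInt f a b) by (apply RInt_ge_0; [lra|now apply cont_ex_RInt|auto]).
lra.
Qed.

Lemma xlnx_diff c x y : 0 < x <= y -> 0 <= ln x + c ->
  0 <= y * (ln y + c) - x * (ln x + c) <= (y - x) * (ln y + c + 1).
Proof.
intros Hxy Hc.
assert (Hl : forall u, x <= u <= y -> ln x <= ln u <= ln y)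
  by (intros; split; apply ln_le; lra).
split.
- apply Rge_le, Rge_minus, Rle_ge.
  apply (mvt_nonneg (fun u => u * (ln u + c)) (fun u => ln u + c + 1)); [lra|].
  intros u Hu; split; [auto_derive; [lra|field; lra]|specialize (Hl u Hu); lra].
- assert (x * (ln y + c + 1) - x * (ln x + c) <= y * (ln y + c + 1) - y * (ln y + c)); [|lra].
  apply (mvt_nonneg (fun u => u * (ln y + c + 1) - u * (ln u + c))
    (fun u => ln y - ln u)); [lra|].
  intros u Hu; split; [auto_derive; [lra|field; lra]|specialize (Hl u Hu); lra].
Qed.

Lemma x2lnx_diff c x y : 0 < x <= y -> 0 <= ln x + c ->
  2 * (y - x) * (x * (ln x + c)) <= y ^ 2 * (ln y + c - 1 / 2) - x ^ 2 * (ln x + c - 1 / 2)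
  <= 2 * (y - x) * (y * (ln y + c)).
Proof.
intros Hxy Hc.
assert (Hm : forall u, x <= u <= y -> x * (ln x + c) <= u * (ln u + c) <= y * (ln y + c)).
{ intros u Hu; assert (ln x <= ln u) by (apply ln_le; lra).
  pose proof (xlnx_diff c x u ltac:(lra) Hc).
  pose proof (xlnx_diff c u y ltac:(lra) ltac:(lra)); lra. }
split.
- assert (x ^ 2 * (ln x + c - 1 / 2) - 2 * x * (x * (ln x + c)) <=
    y ^ 2 * (ln y + c - 1 / 2) - 2 * y * (x * (ln x + c))); [|lra].
  apply (mvt_nonneg (fun u => u ^ 2 * (ln u + c - 1 / 2) - 2 * u * (x * (ln x + c)))
    (fun u => 2 * (u * (ln u + c)) - 2 * (x * (ln x + c)))); [lra|].
  intros u Hu; split; [auto_derive; [lra|field; lra]|specialize (Hm u Hu); lra].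
- assert (2 * x * (y * (ln y + c)) - x ^ 2 * (ln x + c - 1 / 2) <=
    2 * y * (y * (ln y + c)) - y ^ 2 * (ln y + c - 1 / 2)); [|lra].
  apply (mvt_nonneg (fun u => 2 * u * (y * (ln y + c)) - u ^ 2 * (ln u + c - 1 / 2))
    (fun u => 2 * (y * (ln y + c)) - 2 * (u * (ln u + c)))); [lra|].
  intros u Hu; split; [auto_derive; [lra|field; lra]|specialize (Hm u Hu); lra].
Qed.

(** A Tauberian step.  Take difference quotients of the moment over a step [d]
    about [eta T / ln T]: the error of order [T^2 / ln^2 T], divided by [d],
    is [o(T)], while [T ln T] varies over the step by [O(eta T)]. *)
Lemma mean_of_fejer_moment f c C : cont f -> (forall t, 0 <= f t) -> 0 <= C ->
  (forall T : nat, (7 <= T)%nat ->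
    Rabs (fejer_moment f (INR T) - INR T ^ 2 * (ln (INR T) + c - 1 / 2))
    <= C * INR T ^ 2 / (1 + ln (INR T)) ^ 2) ->
  forall eps, 0 < eps -> exists T0, forall T, T0 <= T ->
    Rabs (RInt f 0 T - T * (ln T + c)) <= eps * T.
Proof.
intros Hc Hf HC HG eps Heps.
(* The deviations below add up to [9 eta T]; [eta <= 1/8] keeps every point in
   [[T/2, 2T]]. *)
set (eta := Rmin (eps / 9) (/ 8)).
assert (Heta : 0 < eta) by (unfold eta; apply Rmin_glb_lt; lra).
assert (Heta8 : eta <= / 8) by apply Rmin_r.
assert (Heta9 : 9 * eta <= eps) by (assert (eta <= eps / 9) by apply Rmin_l; lra).
(* [8 / eta] makes the step at least [2], the second summand makes [E / d <=
   eta T], the third absorbs [c]. *)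
set (Lam := 8 / eta + 16 * C / eta ^ 2 + 2 * (2 + Rabs c)).
exists (exp Lam); intros T HT.
assert (H8 : 64 <= 8 / eta).
{ apply Rmult_le_reg_r with eta; [easy|].
  replace (8 / eta * eta) with 8 by (field; lra); lra. }
assert (H16 : 0 <= 16 * C / eta ^ 2) by (apply Rdiv_le_0_compat; [lra|now apply pow_lt]).
pose proof (Rabs_pos c) as Hca.
assert (HT0 : 0 < T) by (pose proof (exp_pos Lam); lra).
set (lam := 1 + ln T).
assert (Hlam : Lam <= lam - 1).
{ unfold lam; replace (1 + ln T - 1) with (ln T) by ring.
  rewrite <- (ln_exp Lam); apply ln_le; [apply exp_pos|easy]. }
assert (HlnT : ln T = lam - 1) by (unfold lam; ring).
assert (HTlam : 2 * lam <= eta * T).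
{ assert (Hexp : lam * lam / 4 <= T).
  { rewrite <- (exp_ln T) by easy; rewrite HlnT.
    replace (lam - 1) with ((lam - 1) / 2 + (lam - 1) / 2) by field.
    rewrite exp_plus; pose proof (exp_ineq1_le ((lam - 1) / 2)).
    assert (0 <= lam) by (unfold Lam in *; lra); nra. }
  assert (8 <= eta * lam).
  { replace 8 with (eta * (8 / eta)) by (field; lra).
    apply Rmult_le_compat_l; unfold Lam in *; lra. }
  assert (0 <= lam) by (unfold Lam in *; lra).
  apply Rle_trans with (eta * (lam * lam / 4)); nra. }
assert (Hlam64 : 64 <= lam) by (unfold Lam in *; lra).
set (r := eta * T / lam).
assert (Hr2 : 2 <= r).
{ unfold r; apply Rmult_le_reg_r with lam; [lra|].
  replace (eta * T / lam * lam) with (eta * T) by (field; lra); easy. }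
assert (HrT : r * lam = eta * T) by (unfold r; field; lra).
destruct (nfloor_ex r ltac:(lra)) as [d0 [Hd1 Hd2]].
set (d := S d0).
assert (Hd : r <= INR d <= 2 * r) by (unfold d; rewrite S_INR; lra).
assert (HdT : INR d <= T / 8) by nra.
destruct (nfloor_ex T ltac:(lra)) as [m [Hm1 Hm2]].
assert (HT64 : 64 <= T) by nra.
set (E := 16 * C * T ^ 2 / lam ^ 2).
assert (Hlam2 : 0 < lam ^ 2) by (apply pow_lt; lra).
assert (HE : forall v : nat, T / 2 <= INR v <= 2 * T ->
   Rabs (fejer_moment f (INR v) - INR v ^ 2 * (ln (INR v) + c - 1 / 2)) <= E).
{ intros v Hv; eapply Rle_trans; [apply HG|].
  - apply INR_le; simpl; lra.
  - assert (Hlv : lam / 2 <= 1 + ln (INR v)).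
    { assert (ln (T / 2) <= ln (INR v)) by (apply ln_le; lra).
      rewrite ln_div, HlnT in * by lra; pose proof (ln_le_minus1 2); lra. }
    replace E with (C * (2 * T) ^ 2 / (lam / 2) ^ 2) by (unfold E; field; lra).
    apply Rmult_le_compat.
    + apply Rmult_le_pos; [easy|apply pow2_ge_0].
    + left; apply Rinv_0_lt_compat, pow_lt; lra.
    + apply Rmult_le_compat_l; [easy|]; apply pow_incr; lra.
    + apply Rinv_le_contravar; [apply pow_lt; lra|]; apply pow_incr; lra. }
assert (HEd : E <= INR d * (eta * T)).
{ apply Rle_trans with (r * (eta * T)); [|apply Rmult_le_compat_r; nra].
  assert (Hk : 16 * C <= eta ^ 2 * lam).
  { replace (16 * C) with (eta ^ 2 * (16 * C / eta ^ 2)) by (field; lra).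
    apply Rmult_le_compat_l; [apply pow2_ge_0|unfold Lam in *; lra]. }
  unfold E, r; apply Rmult_le_reg_r with (lam ^ 2); [easy|].
  replace (16 * C * T ^ 2 / lam ^ 2 * lam ^ 2) with (16 * C * T ^ 2) by (field; lra).
  replace (eta * T / lam * (eta * T) * lam ^ 2) with (eta ^ 2 * lam * T ^ 2) by (field; lra).
  apply Rmult_le_compat_r; [apply pow2_ge_0|easy]. }
assert (Hlnc : forall v, T / 2 <= v <= 2 * T -> 0 <= ln v + c <= lam + Rabs c).
{ intros v Hv.
  assert (ln (T / 2) <= ln v) by (apply ln_le; lra).
  assert (ln v <= ln (2 * T)) by (apply ln_le; lra).
  rewrite ln_div, ln_mult, HlnT in * by lra; pose proof (ln_le_minus1 2).
  pose proof (Rle_abs c); pose proof (Rle_abs (- c)); rewrite Rabs_Ropp in *.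
  unfold Lam in *; lra. }
assert (Hstep : (1 + INR d) * (lam + Rabs c + 1) <= 8 * eta * T).
{ apply Rle_trans with ((2 * r + 1) * (2 * lam)); [apply Rmult_le_compat; unfold Lam in *; lra|].
  nra. }
assert (Hdpos : 0 < INR d) by lra.
assert (Hup : RInt f 0 T <= T * (ln T + c) + 9 * eta * T).
{ set (u := S m).
  assert (Hu : T <= INR u <= T + 1) by (unfold u; rewrite S_INR; lra).
  pose proof (fejer_moment_diff f (INR u) (INR (u + d)) Hc Hf) as HD.
  rewrite plus_INR in HD; destruct HD as [HD _]; [lra|].
  pose proof (HE u ltac:(lra)) as E1.
  pose proof (HE (u + d)%nat ltac:(rewrite plus_INR; lra)) as E2.
  rewrite plus_INR in E2.
  destruct (Hlnc (INR u) ltac:(lra)) as [Hlu _].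
  pose proof (x2lnx_diff c (INR u) (INR u + INR d) ltac:(lra) Hlu) as [_ HX].
  destruct (Hlnc T ltac:(lra)) as [HlT _].
  pose proof (xlnx_diff c T (INR u + INR d) ltac:(lra) HlT) as [_ HY].
  destruct (Hlnc (INR u + INR d) ltac:(lra)) as [_ Hlud].
  pose proof (RInt_nonneg_mono f T (INR u) Hc Hf ltac:(lra)) as HM.
  apply Rabs_le_between in E1, E2.
  replace (INR u + INR d - INR u) with (INR d) in * by ring.
  assert (HF : RInt f 0 (INR u) <= (INR u + INR d) * (ln (INR u + INR d) + c) + eta * T).
  { apply Rmult_le_reg_l with (2 * INR d); [lra|]; lra. }
  assert ((INR u + INR d - T) * (ln (INR u + INR d) + c + 1)
     <= (1 + INR d) * (lam + Rabs c + 1)).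
  { destruct (Hlnc (INR u + INR d) ltac:(lra)) as [Hlud0 _].
    apply Rmult_le_compat; lra. }
  lra. }
assert (Hlo : T * (ln T + c) - 9 * eta * T <= RInt f 0 T).
{ assert (Hdm : (d <= m)%nat) by (apply INR_le; lra).
  set (u := (m - d)%nat).
  assert (Hu : INR u = INR m - INR d) by (unfold u; now rewrite minus_INR).
  pose proof (fejer_moment_diff f (INR u) (INR m) Hc Hf) as HD.
  destruct HD as [_ HD]; [lra|].
  pose proof (HE u ltac:(lra)) as E1.
  pose proof (HE m ltac:(lra)) as E2.
  destruct (Hlnc (INR u) ltac:(lra)) as [Hlu _].
  pose proof (x2lnx_diff c (INR u) (INR m) ltac:(lra) Hlu) as [HX _].
  pose proof (xlnx_diff c (INR u) T ltac:(lra) Hlu) as [_ HY].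
  destruct (Hlnc T ltac:(lra)) as [HlT0 HlT].
  pose proof (RInt_nonneg_mono f (INR m) T Hc Hf ltac:(lra)) as HM.
  apply Rabs_le_between in E1, E2.
  replace (INR m - INR u) with (INR d) in * by lra.
  assert (HF : INR u * (ln (INR u) + c) - eta * T <= RInt f 0 (INR m)).
  { apply Rmult_le_reg_l with (2 * INR d); [lra|]; lra. }
  assert ((T - INR u) * (ln T + c + 1) <= (1 + INR d) * (lam + Rabs c + 1))
    by (apply Rmult_le_compat; lra).
  lra. }
assert (9 * eta * T <= eps * T) by (apply Rmult_le_compat_r; lra).
apply Rabs_le; lra.
Qed.

Lemma mean_square_zeta eps : 0 < eps -> exists T0, forall T, T0 <= T ->
  Rabs (RInt zeta_sqr 0 T - T * (ln T - 1 - kappa)) <= eps * T.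
Proof.
intros Heps; destruct fejer_moment_zeta as [C [HC H]].
destruct (mean_of_fejer_moment zeta_sqr (- 1 - kappa) C cont_zeta_sqr (fun t => pow2_ge_0 _) HC) with (eps := eps)
  as [T0 HT0]; [|easy|].
- intros T HT; specialize (H T HT).
  replace (ln (INR T) + (- 1 - kappa) - 1 / 2) with (ln (INR T) - 1 / 2 - 1 - kappa) by ring.
  exact H.
- exists T0; intros T HT; specialize (HT0 T HT).
  replace (ln T + (- 1 - kappa)) with (ln T - 1 - kappa) in HT0 by ring; exact HT0.
Qed.

(** * The limit *)

(** [gamma <= H_2 - ln 2], so it is enough that [ln (2 PI) > ln 6] and [ln 24
    > 3]. *)
Lemma kappa_pos : 0 < kappa.
Proof.
unfold kappa.
pose proof (harm_gamma 2 ltac:(lia)) as [H _].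
unfold harm in H; simpl psum in H; simpl INR in H.
replace (1 + 1) with 2 in H by ring.
assert (H2 : ln 6 < ln (2 * PI)).
{ apply ln_increasing; [lra|]; pose proof PI2_3_2; lra. }
assert (H3 : 3 < ln 24).
{ rewrite <- (ln_exp 3); apply ln_increasing; [apply exp_pos|].
  replace 3 with (1 + 1 + 1) by ring; rewrite !exp_plus.
  assert (He : exp 1 <= 2.81); [|pose proof (exp_pos 1); nra].
  assert (H16 : exp (1/16) <= 16/15).
  { apply Rmult_le_reg_r with (exp (- (1/16))); [apply exp_pos|].
    rewrite <- exp_plus; replace (1/16 + - (1/16)) with 0 by field; rewrite exp_0.
    pose proof (exp_ineq1_le (- (1/16))); lra. }
  pose proof (exp_pos (1/16)) as H16p.
  assert (H8 : 0 < exp (1/8) <= 1.1378).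
  { split; [apply exp_pos|]; replace (1/8) with (1/16+1/16) by field; rewrite exp_plus; nra. }
  assert (H4 : 0 < exp (1/4) <= 1.2946).
  { split; [apply exp_pos|]; replace (1/4) with (1/8+1/8) by field; rewrite exp_plus; nra. }
  assert (Hh : 0 < exp (1/2) <= 1.676).
  { split; [apply exp_pos|]; replace (1/2) with (1/4+1/4) by field; rewrite exp_plus; nra. }
  replace 1 with (1/2+1/2) by field; rewrite exp_plus; nra. }
replace 24 with (6 * 2 * 2) in H3 by ring.
rewrite !ln_mult in H3 by lra; lra.
Qed.

Lemma RInt_ln a b : 0 < a -> a <= b ->
  RInt ln a b = (b * ln b - b) - (a * ln a - a) /\ ex_RInt ln a b.
Proof.
intros Ha Hab.
assert (H : is_RInt ln a b (minus (b * ln b - b) (a * ln a - a))).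
{ apply (is_RInt_derive (fun x => x * ln x - x)).
  - rewrite Rmin_left, Rmax_right by easy; intros x Hx.
    assert (Hd : is_derive (fun x => x * ln x - x) x (ln x))
      by (auto_derive; [lra|field; lra]); exact Hd.
  - rewrite Rmin_left, Rmax_right by easy; intros x Hx.
    apply (@ex_derive_continuous R_AbsRing R_NormedModule); auto_derive; lra. }
split; [exact (is_RInt_unique _ _ _ _ H)|eexists; exact H].
Qed.

(** The primitives of [ln] and of [zeta_sqr] at the endpoints [b > a] differ
    by [kappa (b - a)] up to [e (a + b)], and [kappa (b - a) / tau = N q]. *)
Lemma fermat_rational_limit (N : nat) (q : R) : 0 < q ->
  is_lim (fun tau => 1 / tau *
     RInt (fun t => ln t - Cmod (zeta (1 / 2, t)) ^ 2)
       (q * (tau / kappa)) ((INR N + 1) * q * (tau / kappa)))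
    p_infty (INR N * q).
Proof.
intros Hq; pose proof kappa_pos as Hk; pose proof (pos_INR N) as HN.
apply is_lim_spec; intros eps.
set (e := eps * kappa / (2 * (INR N + 2) * q)).
assert (He : 0 < e).
{ unfold e; apply Rdiv_lt_0_compat; [apply Rmult_lt_0_compat; [apply cond_pos|easy]|].
  apply Rmult_lt_0_compat; lra. }
destruct (mean_square_zeta e He) as [T0 HT0].
exists (Rmax 1 (kappa / q * T0)); intros tau Htau; cbv beta.
assert (H1 : 1 < tau) by (eapply Rle_lt_trans; [apply Rmax_l|exact Htau]).
assert (H2 : kappa / q * T0 < tau) by (eapply Rle_lt_trans; [apply Rmax_r|exact Htau]).
set (a := q * (tau / kappa)).
assert (Ha : 0 < a) by (unfold a; apply Rmult_lt_0_compat; [easy|apply Rdiv_lt_0_compat; lra]).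
assert (HaT : T0 <= a).
{ apply Rmult_le_reg_l with (kappa / q); [apply Rdiv_lt_0_compat; lra|].
  replace (kappa / q * a) with tau by (unfold a; field; lra); lra. }
replace ((INR N + 1) * q * (tau / kappa)) with ((INR N + 1) * a) by (unfold a; ring).
set (b := (INR N + 1) * a).
assert (Hab : a <= b) by (unfold b; nra).
destruct (RInt_ln a b Ha Hab) as [Hln Hexln].
pose proof (HT0 a HaT) as Ea; pose proof (HT0 b ltac:(lra)) as Eb.
assert (Hint : RInt (fun t => ln t - Cmod (zeta (1 / 2, t)) ^ 2) a b =
  RInt ln a b - RInt zeta_sqr a b).
{ apply (RInt_minus ln zeta_sqr); [exact Hexln|apply cont_ex_RInt, cont_zeta_sqr]. }
assert (Hch : RInt zeta_sqr 0 b = RInt zeta_sqr 0 a + RInt zeta_sqr a b).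
{ symmetry; apply (RInt_Chasles zeta_sqr); apply cont_ex_RInt, cont_zeta_sqr. }
rewrite Hint, Hln.
set (I := RInt zeta_sqr a b) in *.
assert (HNq : INR N * q = 1 / tau * (kappa * (b - a))) by (unfold b, a; field; lra).
rewrite HNq, <- Rmult_minus_distr_l, Rabs_mult, (Rabs_pos_eq (1 / tau))
  by (apply Rdiv_le_0_compat; lra).
apply Rle_lt_trans with (1 / tau * (e * (a + b))).
- apply Rmult_le_compat_l; [apply Rdiv_le_0_compat; lra|].
  apply Rabs_le_between in Ea, Eb; apply Rabs_le; lra.
- replace (1 / tau * (e * (a + b))) with (eps / 2)
    by (unfold e, b, a; field; repeat split; lra).
  pose proof (cond_pos eps); lra.
Qed.

Theorem theorem4 (N : nat) (hN : (1 <= N)%nat) :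
  (forall x y z n : nat,
     (1 <= x)%nat -> (1 <= y)%nat -> (1 <= z)%nat -> (3 <= n)%nat ->
     let q := (INR x ^ n + INR y ^ n) / INR z ^ n in
     let kappa := ln (2 * PI) - 2 * euler_gamma in
     exists l : R,
       is_lim
         (fun tau : R =>
            1 / tau *
            RInt (fun t : R => ln t - Cmod (zeta (1 / 2, t)) ^ 2)
                 (q * (tau / kappa))
                 ((INR N + 1) * q * (tau / kappa)))
         p_infty (Finite l)
       /\ l <> INR N)
  <->
  (forall x y z n : nat,
     (1 <= x)%nat -> (1 <= y)%nat -> (1 <= z)%nat -> (3 <= n)%nat ->
     (x ^ n + y ^ n)%nat <> (z ^ n)%nat).
Proof.
assert (HN1 := Defs.INR_pos N hN).
assert (Hpow : forall x n, (1 <= x)%nat -> 0 < INR x ^ n).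
{ intros x n Hx; apply pow_lt; pose proof (Defs.INR_pos x Hx); lra. }
assert (Hq : forall x y z n, (1 <= x)%nat -> (1 <= y)%nat -> (1 <= z)%nat ->
  0 < (INR x ^ n + INR y ^ n) / INR z ^ n).
{ intros; apply Rdiv_lt_0_compat; [apply Rplus_lt_0_compat|]; auto. }
split; intros H x y z n Hx Hy Hz Hn.
- intros E.
  destruct (H x y z n Hx Hy Hz Hn) as [l [Hl Hne]]; apply Hne.
  pose proof (fermat_rational_limit N _ (Hq x y z n Hx Hy Hz)) as Hlim.
  assert (Hq1 : (INR x ^ n + INR y ^ n) / INR z ^ n = 1).
  { rewrite <- !pow_INR, <- plus_INR, E, pow_INR; field.
    pose proof (Hpow z n Hz); lra. }
  apply is_lim_unique in Hl; apply is_lim_unique in Hlim.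
  fold kappa in Hl; rewrite Hlim in Hl; injection Hl as Hl.
  rewrite <- Hl, Hq1; ring.
- intros q k; exists (INR N * q); split.
  + now apply fermat_rational_limit, Hq.
  + intros E; apply (H x y z n Hx Hy Hz Hn).
    assert (Hq1 : q = 1) by (apply Rmult_eq_reg_l with (INR N); lra).
    apply INR_eq; rewrite plus_INR, !pow_INR.
    unfold q in Hq1; pose proof (Hpow z n Hz).
    apply Rmult_eq_reg_r with (/ INR z ^ n); [|apply Rinv_neq_0_compat; lra].
    rewrite Rinv_r by lra; exact Hq1.
Qed.
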